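(* Let $A_0$ be a Dedekind domain with field of fractions $K_0$, let $Y=\operatorname{Spec}A_0$ and let $Z$ be the set of closed points of $Y$. Let $N$ be a lattice, $M=\operatorname{Hom}(N,\mathbb{Z})$ its dual, and let $\sigma\subset N_{\mathbb{Q}}$ be a strongly convex polyhedral cone. Then: (i) If $\mathfrak{D}$ is a $\sigma$-polyhedral divisor over $A_0$, then the algebra $A_0[\mathfrak{D}]$ is normal, noetherian, and has the same field of fractions as $K_0[M]$. (ii) Conversely, let $A=\bigoplus_{m\in\sigma^\vee\cap M}A_m\chi^m$ (with $A_m\subset K_0$) be a normal noetherian $M$-graded $A_0$-subalgebra of $K_0[M]$ whose homogeneous component of degree $0$ is $A_0$ and whose weight cone is $\sigma^\vee$. Assume that $A$ and $K_0[M]$ have the same field of fractions. Then there exists a unique $\sigma$-polyhedral divisor $\mathfrak{D}$ over $A_0$ such that $A=A_0[\mathfrak{D}]$. (iii) Let $f=(f_1\chi^{m_1},\dots,f_r\chi^{m_r})$ be an $r$-tuple of homogeneous elements of $K_0[M]$ (with $f_i\in K_0^\star$) whose degrees $m_1,\dots,m_r$ are nonzero and generate the lattice $M$, and let $\sigma$ be the dual cone of $\operatorname{Cone}(m_1,\dots,m_r)$. Then the normalization of the ring $A_0[f_1\chi^{m_1},\dots,f_r\chi^{m_r}]$ is equal to $A_0[\mathfrak{D}[f]]$.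
   Context: $N_{\mathbb{Q}}=\mathbb{Q}\otimes N$, $M_{\mathbb{Q}}=\mathbb{Q}\otimes M$, $\langle m,v\rangle=m(v)$; $\sigma^\vee=\{m\in M_{\mathbb{Q}}:\langle m,v\rangle\ge 0\ \forall v\in\sigma\}$; a cone is strongly convex if it has a vertex. $\operatorname{Pol}_\sigma(N_{\mathbb{Q}})$ is the set of polyhedra $Q+\sigma$ (Minkowski sum) with $Q\subset N_{\mathbb{Q}}$ a polytope (convex hull of finitely many points, nonempty). A $\sigma$-polyhedral divisor over $A_0$ is a formal sum $\mathfrak{D}=\sum_{z\in Z}\Delta_z\cdot z$ with $\Delta_z\in\operatorname{Pol}_\sigma(N_{\mathbb{Q}})$ and $\Delta_z=\sigma$ for all but finitely many $z$. Its evaluation at $m\in\sigma^\vee$ is the $\mathbb{Q}$-divisor $\mathfrak{D}(m)=\sum_{z\in Z}\min_{v\in\Delta_z}\langle m,v\rangle\cdot z$ on $Y$. For a $\mathbb{Q}$-divisor $D$ on $Y$, $H^0(Y,\mathcal{O}_Y(\lfloor D\rfloor))=\{g\in K_0^\star:\operatorname{div}g+\lfloor D\rfloor\ge 0\}\cup\{0\}$. $K_0[M]=\bigoplus_{m\in M}K_0\chi^m$ with $\chi^m\chi^{m'}=\chi^{m+m'}$, and $A_0[\mathfrak{D}]=\bigoplus_{m\in\sigma^\vee\cap M}H^0(Y,\mathcal{O}_Y(\lfloor\mathfrak{D}(m)\rfloor))\chi^m\subset K_0[M]$. The weight cone of an $M$-graded algebra is the cone generated by the degrees $m$ with nonzero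 homogeneous component. For $f$ as in (iii), $\mathfrak{D}[f]=\sum_{z\in Z}\Delta_z[f]\cdot z$ with $\Delta_z[f]=\{v\in N_{\mathbb{Q}}:\langle m_i,v\rangle\ge-\operatorname{ord}_z f_i,\ i=1,\dots,r\}$. *)

(* Defs.v *)
From mathcomp Require Import all_boot all_order all_algebra fraction.
From mathcomp Require Import mpoly.
Set Implicit Arguments.
Unset Strict Implicit.
Unset Printing Implicit Defensive.
Import Order.TTheory GRing.Theory Num.Theory.
Local Open Scope ring_scope.

Definition subring (F : fieldType) (S : F -> Prop) : Prop :=
  [/\ S 0, S 1, (forall x y, S x -> S y -> S (x - y))
      & (forall x y, S x -> S y -> S (x * y))].

Definition fracS (F : fieldType) (S : F -> Prop) (x : F) : Prop :=
  exists a b, [/\ S a, S b, b != 0 & x = a / b].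

Definition integral_over (F : fieldType) (S : F -> Prop) (x : F) : Prop :=
  exists p : {poly F}, [/\ p \is monic, (forall i, S p`_i) & root p x].

Definition normal (F : fieldType) (S : F -> Prop) : Prop :=
  forall x, fracS S x -> integral_over S x -> S x.

Definition normalization (F : fieldType) (S : F -> Prop) (x : F) : Prop :=
  fracS S x /\ integral_over S x.

Definition ideal (F : fieldType) (S I : F -> Prop) : Prop :=
  [/\ (forall x, I x -> S x), I 0, (forall x y, I x -> I y -> I (x + y))
      & (forall r x, S r -> I x -> I (r * x))].

Definition fin_gen (F : fieldType) (S I : F -> Prop) : Prop :=
  exists s : seq F, (forall x, x \in s -> I x) /\
    forall x, I x <-> exists c : 'I_(size s) -> F,
        (forall i, S (c i)) /\ x = \sum_(i < size s) c i * s`_i.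

Definition noetherian (F : fieldType) (S : F -> Prop) : Prop :=
  forall I, ideal S I -> fin_gen S I.

Definition prime_ideal (F : fieldType) (S I : F -> Prop) : Prop :=
  [/\ ideal S I, ~ I 1 & forall a b, S a -> S b -> I (a * b) -> I a \/ I b].

Definition maximal_ideal (F : fieldType) (S I : F -> Prop) : Prop :=
  [/\ ideal S I, ~ I 1 &
      forall J, ideal S J -> (forall x, I x -> J x) ->
        (forall x, J x <-> I x) \/ J 1].

Definition dedekind (F : fieldType) (S : F -> Prop) : Prop :=
  [/\ subring S, noetherian S, normal S,
      (forall P, prime_ideal S P -> (exists x, P x /\ x != 0) ->
         maximal_ideal S P)
    & exists P, prime_ideal S P /\ exists x, P x /\ x != 0].

Definition closed_pt (F : fieldType) (A0 : F -> Prop) : Type :=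
  {P : F -> Prop | maximal_ideal A0 P}.

Fixpoint ipow (F : fieldType) (S P : F -> Prop) (k : nat) : F -> Prop :=
  match k with
  | 0 => S
  | k'.+1 => fun x => exists s : seq (F * F),
      (forall p, p \in s -> ipow S P k' p.1 /\ P p.2) /\
      x = \sum_(p <- s) p.1 * p.2
  end.

Definition ordS (F : fieldType) (S P : F -> Prop) (a : F) (k : nat) : Prop :=
  ipow S P k a /\ ~ ipow S P k.+1 a.

Definition ord (F : fieldType) (A0 : F -> Prop) (z : closed_pt A0)
    (f : F) (n : int) : Prop :=
  exists a b ka kb, [/\ A0 a, A0 b, a != 0, b != 0 & f = a / b] /\
    [/\ ordS A0 (sval z) a ka, ordS A0 (sval z) b kb
       & n = (ka%:Z - kb%:Z)%R].

(* Convex geometry.  N = Z^n, M = Hom(N,Z) = Z^n (row vectors),         *)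
(* N_Q = M_Q = Q^n, pairing = dot product.                              *)

Definition pairQ (n : nat) (u v : 'rV[rat]_n) : rat :=
  \sum_(i < n) u 0 i * v 0 i.

Definition toQ (n : nat) (m : 'rV[int]_n) : 'rV[rat]_n := map_mx intr m.

Definition pair (n : nat) (m : 'rV[int]_n) (v : 'rV[rat]_n) : rat :=
  pairQ (toQ m) v.

Definition cone_gen (n : nat) (G : 'rV[rat]_n -> Prop) (u : 'rV[rat]_n) : Prop :=
  exists s : seq 'rV[rat]_n, (forall g, g \in s -> G g) /\
    exists lam : 'I_(size s) -> rat, (forall i, 0 <= lam i) /\
      u = \sum_(i < size s) lam i *: s`_i.

Definition polyhedral_cone (n : nat) (sigma : 'rV[rat]_n -> Prop) : Prop :=
  exists s : seq 'rV[rat]_n, forall v, sigma v <-> cone_gen (fun g => g \in s) v.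

Definition strongly_convex (n : nat) (sigma : 'rV[rat]_n -> Prop) : Prop :=
  forall v, sigma v -> sigma (- v) -> v = 0.

Definition dualQ (n : nat) (sigma : 'rV[rat]_n -> Prop) (u : 'rV[rat]_n) : Prop :=
  forall v, sigma v -> 0 <= pairQ u v.

Definition in_hull (n : nat) (s : seq 'rV[rat]_n) (q : 'rV[rat]_n) : Prop :=
  exists lam : 'I_(size s) -> rat, [/\ (forall i, 0 <= lam i),
    \sum_(i < size s) lam i = 1 & q = \sum_(i < size s) lam i *: s`_i].

Definition pol_sigma (n : nat) (sigma Delta : 'rV[rat]_n -> Prop) : Prop :=
  exists s : seq 'rV[rat]_n, s != [::] /\
    forall v, Delta v <-> exists q c, [/\ in_hull s q, sigma c & v = q + c].

Definition polyhedral_divisor (K0 : fieldType) (A0 : K0 -> Prop) (n : nat)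
    (sigma : 'rV[rat]_n -> Prop) (D : closed_pt A0 -> 'rV[rat]_n -> Prop) : Prop :=
  (forall z, pol_sigma sigma (D z)) /\
  exists (k : nat) (zs : 'I_k -> closed_pt A0),
    forall z, (forall i, z <> zs i) -> forall v, D z v <-> sigma v.

Definition is_min (n : nat) (Delta : 'rV[rat]_n -> Prop) (m : 'rV[int]_n)
    (h : rat) : Prop :=
  (exists v, Delta v /\ pair m v = h) /\ forall v, Delta v -> h <= pair m v.

(* g in H^0(Y, O(floor(D(m)))) *)
Definition H0 (K0 : fieldType) (A0 : K0 -> Prop) (n : nat)
    (D : closed_pt A0 -> 'rV[rat]_n -> Prop) (m : 'rV[int]_n) (g : K0) : Prop :=
  g = 0 \/ (g != 0 /\ forall z k h, ord z g k -> is_min (D z) m h ->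
                        (0 <= k + Num.floor h)%R).

Definition compD (K0 : fieldType) (A0 : K0 -> Prop) (n : nat)
    (sigma : 'rV[rat]_n -> Prop) (D : closed_pt A0 -> 'rV[rat]_n -> Prop)
    (m : 'rV[int]_n) (g : K0) : Prop :=
  (dualQ sigma (toQ m) /\ H0 D m g) \/ g = 0.

(* K0[M] realised inside L = K0(x_1,...,x_n), chi^m = prod x_i^(m_i).  *)

Definition Lfield (K0 : fieldType) (n : nat) : fieldType :=
  {fraction {mpoly K0[n]}}.

Definition emb (K0 : fieldType) (n : nat) (a : K0) : Lfield K0 n :=
  tofrac (mpolyC n a).

Definition chi (K0 : fieldType) (n : nat) (m : 'rV[int]_n) : Lfield K0 n :=
  \prod_(i < n) (tofrac ('X_i : {mpoly K0[n]})) ^ (m 0 i).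

Definition graded (K0 : fieldType) (n : nat) (A : 'rV[int]_n -> K0 -> Prop)
    (x : Lfield K0 n) : Prop :=
  exists s : seq ('rV[int]_n * K0), (forall p, p \in s -> A p.1 p.2) /\
    x = \sum_(p <- s) emb n p.2 * chi K0 p.1.

Definition KM (K0 : fieldType) (n : nat) : Lfield K0 n -> Prop :=
  graded (fun (_ : 'rV[int]_n) (_ : K0) => True).

Definition A0D (K0 : fieldType) (A0 : K0 -> Prop) (n : nat)
    (sigma : 'rV[rat]_n -> Prop) (D : closed_pt A0 -> 'rV[rat]_n -> Prop) :
    Lfield K0 n -> Prop :=
  graded (compD sigma D).

Definition graded_subalg (K0 : fieldType) (A0 : K0 -> Prop) (n : nat)
    (A : 'rV[int]_n -> K0 -> Prop) : Prop :=
  [/\ (forall m, A m 0), (forall m a b, A m a -> A m b -> A m (a - b)),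
      (forall m m' a b, A m a -> A m' b -> A (m + m') (a * b))
    & (forall a, A 0 a <-> A0 a)].

Definition weight_cone (K0 : fieldType) (n : nat) (A : 'rV[int]_n -> K0 -> Prop) :
    'rV[rat]_n -> Prop :=
  cone_gen (fun u => exists m, u = toQ m /\ exists a, A m a /\ a != 0).

Definition gen_ring (K0 : fieldType) (A0 : K0 -> Prop) (n r : nat)
    (g : 'I_r -> Lfield K0 n) (x : Lfield K0 n) : Prop :=
  forall S : Lfield K0 n -> Prop, subring S -> (forall a, A0 a -> S (emb n a)) ->
    (forall i, S (g i)) -> S x.

Definition Df (K0 : fieldType) (A0 : K0 -> Prop) (n r : nat)
    (f : 'I_r -> K0) (ms : 'I_r -> 'rV[int]_n) (z : closed_pt A0)
    (v : 'rV[rat]_n) : Prop :=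
  forall i k, ord z (f i) k -> (- (k%:~R) <= pair (ms i) v)%R.

(* Main.v *)
(** At a closed point [z] the order function is a discrete valuation, so for
    [m] in the dual cone of [sigma] a nonzero [g] is a section of
    [floor (D m)] iff [ord_z g + <m, v> >= 0] for all [z] and all [v] in [D_z].
    This family of linear inequalities is invariant under passing from
    [s x^k] (all [k]) to the leading term of [x], so a graded ring defined by
    it is completely integrally closed in the Laurent ring, hence normal.
    Recording a homogeneous element by its degree and its orders at the finitely
    many special points turns finite generation into Gordan's lemma, because
    fractional ideals with prescribed orders are locally principal; Hilbert's
    basis theorem then gives noetherianity.

    For generators [f_i chi^(m_i)], Farkas' lemma applied at each point to the
    pairs [(m_i, ord_z f_i)] together with [(0, 1)] shows that some power of
    every homogeneous element of [A_0[D[f]]] lies, locally at each point and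
    hence globally, in the ring that they generate.  Since that ring is
    noetherian, elements that are almost integral over it are integral.

    A graded noetherian ring is generated by finitely many homogeneous elements
    over its degree zero part, which reduces the converse to this normalization
    statement; [D_z] is recovered from the sections, since a polyhedron is an
    intersection of half-spaces. *)
From Stdlib Require Import Classical ClassicalEpsilon FunctionalExtensionality PropExtensionality.
Require Import Defs.
From mathcomp Require Import all_boot all_order all_algebra fraction.
From mathcomp Require Import mpoly.
From mathcomp Require Import ring lra zify.
Set Implicit Arguments.
Unset Strict Implicit.
Unset Printing Implicit Defensive.
Import Order.TTheory GRing.Theory Num.Theory.
Local Open Scope ring_scope.

(** All rings are subsets of a fixed field, and localizations never appear as rings: a statement in
    the local ring at P is written with a denominator outside P, and membership is recovered
    globally because the denominators of an element form an ideal. The recurrent tool is almost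
    integrality: one nonzero b with b x^k in the ring for all k. It passes to sums by the binomial
    formula alone, and noetherianity turns it back into an integral equation. Closedness inside the
    Laurent ring gives normality only once the Laurent ring is integrally closed in its own fraction
    field. This is reduced to complete integral closedness of polynomial rings, proved one variable
    at a time without factorization in several variables. In the third statement some Delta_z[f] may
    be empty; [H0] then imposes nothing at z. Farkas' lemma agrees: a separating vector of positive
    height would give a point of Delta_z[f], and one of height zero contradicts m lying in the dual
    cone. In the converse, emptiness is excluded by the degree zero part, since it would allow a
    pole at z. The exponent in the power argument must be common to all points, which is where
    finiteness of supports enters. *)

Lemma In_cat (T : Type) (x : T) (s t : seq T) :
  List.In x (s ++ t) <-> List.In x s \/ List.In x t.
Proof. exact: List.in_app_iff. Qed.

Lemma In_mem (T : eqType) (x : T) (s : seq T) : List.In x s <-> x \in s.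
Proof.
elim: s => //= y s IH; rewrite inE; split.
  by case=> [->|/IH ->]; rewrite ?eqxx ?orbT.
by case/orP => [/eqP ->|/IH]; [left|right].
Qed.

(** * Subrings of a field, noetherian induction, integrality *)

Section Subrings.
Variable F : fieldType.
Implicit Types (S N I J : F -> Prop) (x y b : F).

(** Submodules of the whole field, so that fractional ideals and sets of coefficients can be tested
    against generators, not only ideals. *)
Definition smod S N : Prop :=
  [/\ N 0, (forall x y, N x -> N y -> N (x + y))
      & (forall r x, S r -> N x -> N (r * x))].

Lemma subring0 S : subring S -> S 0. Proof. by case. Qed.
Lemma subring1 S : subring S -> S 1. Proof. by case. Qed.
Lemma subringB S : subring S -> forall x y, S x -> S y -> S (x - y).
Proof. by case. Qed.
Lemma subringM S : subring S -> forall x y, S x -> S y -> S (x * y).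
Proof. by case. Qed.
Lemma subringN S : subring S -> forall x, S x -> S (- x).
Proof. by case=> S0 _ SB _ x Sx; rewrite -sub0r; apply: SB. Qed.
Lemma subringD S : subring S -> forall x y, S x -> S y -> S (x + y).
Proof.
move=> hS x y Sx Sy; rewrite -[y]opprK.
by apply: subringB => //; apply: subringN.
Qed.
Lemma subringX S : subring S -> forall x k, S x -> S (x ^+ k).
Proof.
move=> hS x k Sx; elim: k => [|k IH]; first by rewrite expr0; apply: subring1.
by rewrite exprS; apply: subringM.
Qed.
Lemma subringMn S : subring S -> forall x k, S x -> S (x *+ k).
Proof.
move=> hS x k Sx; elim: k => [|k IH]; first by rewrite mulr0n; apply: subring0.
by rewrite mulrS; apply: subringD.
Qed.
Lemma subring_prod S (I : Type) (r : seq I) (P : pred I) (f : I -> F) :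
  subring S -> (forall i, P i -> S (f i)) -> S (\prod_(i <- r | P i) f i).
Proof.
move=> hS hf; elim/big_rec: _ => [|i x Pi Sx]; first exact: subring1.
by apply: subringM => //; apply: hf.
Qed.

Lemma smod_sum S N (I : Type) (r : seq I) (P : pred I) (f : I -> F) :
  smod S N -> (forall i, P i -> N (f i)) -> N (\sum_(i <- r | P i) f i).
Proof.
case=> N0 ND _ hf; elim/big_rec: _ => [|i x Pi Nx] //.
by apply: ND => //; apply: hf.
Qed.
Arguments smod_sum {S N I r P f}.

Lemma subring_smod S : subring S -> smod S S.
Proof.
move=> hS; split; [exact: subring0|exact: subringD|exact: subringM].
Qed.

Lemma ideal_smod S I : ideal S I -> smod S I.
Proof. by case. Qed.

Lemma smodN S N : subring S -> smod S N -> forall x, N x -> N (- x).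
Proof.
move=> hS [_ _ NM] x Nx; rewrite -mulN1r; apply: NM => //.
by apply: subringN => //; apply: subring1.
Qed.

Lemma smodB S N : subring S -> smod S N -> forall x y, N x -> N y -> N (x - y).
Proof.
by move=> hS hN x y Nx Ny; case: (hN) => _ ND _; apply: ND => //; apply: (smodN hS hN).
Qed.

(** Trades families of coefficients for an induction principle: a submodule that contains the
    generators contains the ideal. *)
Lemma fin_gen_span S I : ideal S I -> fin_gen S I ->
  exists s : seq F, (forall x, x \in s -> I x) /\
    forall N, smod S N -> (forall x, x \in s -> N x) -> forall x, I x -> N x.
Proof.
move=> hI [s [hs h]]; exists s; split=> // N hN Ns x /h [c [Sc ->]].
apply: (smod_sum hN) => i _; case: hN => _ _; apply=> //.
by apply: Ns; apply: mem_nth.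
Qed.

Lemma span_fin_gen S I (s : seq F) : subring S -> ideal S I ->
  (forall x, x \in s -> I x) ->
  (forall N, smod S N -> (forall x, x \in s -> N x) -> forall x, I x -> N x) ->
  fin_gen S I.
Proof.
move=> hS hI Is h; exists s; split=> // x; split; last first.
  case=> c [Sc ->]; apply: (smod_sum (ideal_smod hI)) => i _.
  by case: hI => _ _ _; apply=> //; apply: Is; apply: mem_nth.
move: x; apply: h => [|x xs].
  split.
  - exists (fun=> 0); split=> [i|]; first exact: subring0.
    by rewrite big1 // => i _; rewrite mul0r.
  - move=> _ _ [c [Sc ->]] [d [Sd ->]]; exists (fun i => c i + d i).
    split=> [i|]; first exact: subringD.
    by rewrite -big_split; apply: eq_bigr => i _; rewrite mulrDl.
  - move=> r _ Sr [c [Sc ->]]; exists (fun i => r * c i).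
    split=> [i|]; first exact: subringM.
    by rewrite mulr_sumr; apply: eq_bigr => i _; rewrite mulrA.
have hi : (index x s < size s)%N by rewrite index_mem.
exists (fun i => if i == Ordinal hi then 1 else 0); split=> [i|].
  by case: ifP => _; [exact: subring1|exact: subring0].
rewrite (bigD1 (Ordinal hi)) //= eqxx mul1r nth_index // big1 ?addr0 //.
by move=> i /negbTE ->; rewrite mul0r.
Qed.

Lemma noeth_chain S (J : nat -> F -> Prop) : subring S -> noetherian S ->
  (forall k, ideal S (J k)) -> (forall k x, J k x -> J k.+1 x) ->
  exists K, forall k x, J k x -> J K x.
Proof.
move=> hS nS hJ hinc.
have hmono k l x : (k <= l)%N -> J k x -> J l x.
  move=> /subnK <-; elim: (l - k)%N => // d IH Jx.
  by rewrite addSn; apply: hinc; apply: IH.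
pose U x := exists k, J k x.
have hU : ideal S U.
  split.
  - by move=> x [k]; case: (hJ k) => h _ _ _; apply: h.
  - by exists 0%N; case: (hJ 0%N).
  - move=> x y [k Jx] [l Jy]; exists (maxn k l).
    case: (hJ (maxn k l)) => _ _ h _; apply: h.
      by apply: hmono Jx; apply: leq_maxl.
    by apply: hmono Jy; apply: leq_maxr.
  - by move=> r x Sr [k Jx]; exists k; case: (hJ k) => _ _ _; apply.
have [s [Us hs]] := fin_gen_span hU (nS _ hU).
have [K hK] : exists K, forall x, x \in s -> J K x.
  elim: s Us {hs} => [|a s IH] Us; first by exists 0%N.
  have [|K hK] := IH; first by move=> x xs; apply: Us; rewrite inE xs orbT.
  have [l Ja] := Us a (mem_head _ _).
  exists (maxn K l) => x; rewrite inE => /orP [/eqP ->|xs].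
    by apply: hmono Ja; apply: leq_maxr.
  by apply: hmono (hK _ xs); apply: leq_maxl.
exists K => k x Jx; apply: (hs (J K)) => //; first exact: ideal_smod.
by exists k.
Qed.

(** An ideal violating Q would have a strictly larger one violating Q; choosing successors
    repeatedly gives a chain that never stabilizes. *)
Lemma noeth_ind S (Q : (F -> Prop) -> Prop) : subring S -> noetherian S ->
  (forall I, ideal S I ->
     (forall J, ideal S J -> (forall x, I x -> J x) ->
        (exists x, J x /\ ~ I x) -> Q J) -> Q I) ->
  forall I, ideal S I -> Q I.
Proof.
move=> hS nS hind I hI; apply: NNPP => nQ.
pose T := {J | ideal S J /\ ~ Q J}.
have step (t : T) : {t' : T | (forall x, sval t x -> sval t' x) /\
     exists x, sval t' x /\ ~ sval t x}.
  apply: constructive_indefinite_description.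
  case: t => J [hJ nQJ] /=; apply: NNPP => hn; apply: nQJ; apply: hind => // J' hJ' hs hx.
  apply: NNPP => nQJ'; apply: hn.
  by exists (exist _ J' (conj hJ' nQJ')).
pose f k : T := iter k (fun t => sval (step t)) (exist _ I (conj hI nQ)).
have [||K hK] := @noeth_chain S (fun k => sval (f k)) hS nS.
- by move=> k; case: (f k) => J [].
- by move=> k x; case: (svalP (step (f k))) => h _; apply: h.
case: (svalP (step (f K))) => _ [x [h1 h2]]; apply: h2; exact: (hK K.+1).
Qed.

Lemma fracS_sub S : subring S -> forall x, S x -> fracS S x.
Proof.
move=> hS x Sx; exists x, 1; split=> //; first exact: subring1.
  exact: oner_neq0.
by rewrite divr1.
Qed.

Lemma fracS_mono S N : (forall x, S x -> N x) -> forall x, fracS S x -> fracS N x.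
Proof. by move=> h x [a [b [Sa Sb b0 ->]]]; exists a, b; split=> //; apply: h. Qed.

Lemma fracS_subring S : subring S -> subring (fracS S).
Proof.
move=> hS; split.
- exact: (fracS_sub hS (subring0 hS)).
- exact: (fracS_sub hS (subring1 hS)).
- move=> _ _ [a [b [Sa Sb b0 ->]]] [c [d [Sc Sd d0 ->]]].
  exists (a * d - b * c), (b * d); split; try by apply: subringM.
  + by apply: subringB => //; apply: subringM.
  + by rewrite mulf_neq0.
  + by field; rewrite b0 d0.
- move=> _ _ [a [b [Sa Sb b0 ->]]] [c [d [Sc Sd d0 ->]]].
  exists (a * c), (b * d); split; try by apply: subringM.
  + by rewrite mulf_neq0.
  + by field; rewrite b0 d0.
Qed.

Lemma fracSV S : subring S -> forall x, fracS S x -> fracS S x^-1.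
Proof.
move=> hS _ [a [b [Sa Sb b0 ->]]].
have [->|a0] := eqVneq a 0.
  by rewrite mul0r invr0; apply: fracS_sub => //; apply: subring0.
by exists b, a; split=> //; rewrite invf_div.
Qed.

Lemma fracSXz S : subring S -> forall x (k : int), fracS S x -> fracS S (x ^ k).
Proof.
move=> hS x [k|k] h.
  by apply: subringX => //; apply: fracS_subring.
rewrite NegzE -exprnN; apply: fracSV => //.
by apply: subringX => //; apply: fracS_subring.
Qed.

Lemma integral_over_mono S N : (forall x, S x -> N x) ->
  forall x, integral_over S x -> integral_over N x.
Proof. by move=> h x [p [pm pS rp]]; exists p; split=> // i; apply: h. Qed.

(** The ideals spanned by b, b x, ..., b x^(k-1) stabilize at some K, and the resulting expression
    of b x^K, divided by b, is a monic equation for x. *)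
Lemma almost_integral_integral S b x : subring S -> noetherian S -> b != 0 ->
  (forall k, S (b * x ^+ k)) -> integral_over S x.
Proof.
move=> hS nS b0 hb.
pose J k y := exists c : nat -> F, (forall i, S (c i)) /\
   y = \sum_(i < k) c i * (b * x ^+ i).
have hJ k : ideal S (J k).
  split.
  - move=> _ [c [Sc ->]]; apply: (smod_sum (subring_smod hS)) => i _.
    exact: subringM.
  - exists (fun=> 0); split=> [i|]; first exact: subring0.
    by rewrite big1 // => i _; rewrite mul0r.
  - move=> _ _ [c [Sc ->]] [d [Sd ->]]; exists (fun i => c i + d i).
    split=> [i|]; first exact: subringD.
    by rewrite -big_split; apply: eq_bigr => i _; rewrite mulrDl.
  - move=> r _ Sr [c [Sc ->]]; exists (fun i => r * c i).
    split=> [i|]; first exact: subringM.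
    by rewrite mulr_sumr; apply: eq_bigr => i _; rewrite mulrA.
have [|K hK] := @noeth_chain S J hS nS hJ.
  move=> k _ [c [Sc ->]].
  exists (fun i => if (i < k)%N then c i else 0); split=> [i|].
    by case: ifP => _ //; apply: subring0.
  rewrite big_ord_recr /= ltnn mul0r addr0.
  by apply: eq_bigr => i _; rewrite ltn_ord.
have [|c [Sc hc]] := hK K.+1 (b * x ^+ K).
  exists (fun i => if i == K then 1 else 0); split=> [i|].
    by case: ifP => _; [exact: subring1|exact: subring0].
  rewrite big_ord_recr /= eqxx mul1r big1 ?add0r // => i _.
  by rewrite ltn_eqF ?mul0r.
exists ('X^K - \poly_(i < K) c i); split.
- rewrite monicE lead_coefDl ?lead_coefXn // size_polyXn ltnS size_polyN.
  exact: size_poly.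
- move=> i; rewrite coefB coefXn coef_poly.
  apply: subringB => //; first by case: eqP => _; [exact: subring1|exact: subring0].
  by case: ifP => _ //; apply: subring0.
- rewrite /root hornerD hornerN hornerXn horner_poly subr_eq0; apply/eqP.
  apply: (mulfI b0); rewrite hc mulr_sumr; apply: eq_bigr => i _; ring.
Qed.

(** With N the degree of p, b^N clears the denominator of x^k for k up to N, and the monic equation
    reduces every higher power to lower ones. The denominator is therefore uniform in k. *)
Lemma integral_almost_integral S (p : {poly F}) a b : subring S ->
  p \is monic -> (forall i, S p`_i) -> S a -> S b -> b != 0 -> root p (a / b) ->
  forall k, S (b ^+ (size p).-1 * (a / b) ^+ k).
Proof.
move=> hS pm pS Sa Sb b0 rp; set x := a / b; set N := (size p).-1.
have hN : x ^+ N = - \sum_(i < N) p`_i * x ^+ i.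
  have := rootP rp; rewrite horner_coef -/x.
  have -> : size p = N.+1 by rewrite prednK // lt0n size_poly_eq0 monic_neq0.
  rewrite big_ord_recr /= -/N.
  have -> : p`_N = 1 by apply/eqP; rewrite -monicE in pm *.
  by rewrite mul1r => /eqP; rewrite addrC addr_eq0 => /eqP.
elim/ltn_ind => k IH; have [kN|kN] := leqP k N.
  rewrite -(subnK kN) exprD -mulrA -exprMn.
  have -> : b * x = a by rewrite mulrC mulfVK.
  by apply: subringM => //; apply: subringX.
rewrite -(subnK (ltnW kN)) exprD hN mulrN mulrN.
apply: subringN => //.
rewrite mulr_sumr mulr_sumr; apply: (smod_sum (subring_smod hS)) => i _.
have -> : b ^+ N * (x ^+ (k - N) * (p`_i * x ^+ i)) =
          p`_i * (b ^+ N * x ^+ (k - N + i)) by rewrite exprD; ring.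
apply: subringM => //; apply: IH.
by have := ltn_ord i; lia.
Qed.

Lemma almost_integralD S b c x y : subring S ->
  (forall k, S (b * x ^+ k)) -> (forall k, S (c * y ^+ k)) ->
  forall k, S (b * c * (x + y) ^+ k).
Proof.
move=> hS hx hy k; rewrite exprDn mulr_sumr.
apply: (smod_sum (subring_smod hS)) => i _.
rewrite -mulr_natr mulrA mulr_natr; apply: subringMn => //.
rewrite (_ : _ * _ = (b * x ^+ (k - i)) * (c * y ^+ i)); last by ring.
exact: subringM.
Qed.

End Subrings.

#[global] Arguments smod_sum {F S N I r P f}.

(** * Hilbert's basis theorem for adjoining one element of the field *)

Section Hilbert.
Variable F : fieldType.
Implicit Types (S N I J : F -> Prop) (x y b : F).

Definition adjoin S x y : Prop :=
  exists p : {poly F}, (forall i, S p`_i) /\ y = p.[x].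

Lemma adjoin_sub S x : subring S -> forall y, S y -> adjoin S x y.
Proof.
move=> hS y Sy; exists y%:P; rewrite hornerC; split=> // i.
by rewrite coefC; case: eqP => // _; apply: subring0.
Qed.

Lemma adjoin_gen S x : subring S -> adjoin S x x.
Proof.
move=> hS; exists 'X; rewrite hornerX; split=> // i.
by rewrite coefX; case: eqP => // _; [apply: subring1|apply: subring0].
Qed.

Lemma adjoin_subring S x : subring S -> subring (adjoin S x).
Proof.
move=> hS; split.
- exact: (adjoin_sub _ hS (subring0 hS)).
- exact: (adjoin_sub _ hS (subring1 hS)).
- move=> _ _ [p [pS ->]] [q [qS ->]]; exists (p - q).
  by rewrite hornerD hornerN; split=> // i; rewrite coefB; apply: subringB.
- move=> _ _ [p [pS ->]] [q [qS ->]]; exists (p * q).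
  rewrite hornerM; split=> // i; rewrite coefM.
  by apply: (smod_sum (subring_smod hS)) => j _; apply: subringM.
Qed.

Lemma adjoin_min S N x : subring N -> (forall y, S y -> N y) -> N x ->
  forall y, adjoin S x y -> N y.
Proof.
move=> hN SN Nx _ [p [pS ->]]; rewrite horner_coef.
apply: (smod_sum (subring_smod hN)) => i _.
by apply: subringM => //; [apply: SN|apply: subringX].
Qed.

Lemma size_mulXn_le (p : {poly F}) k d :
  (size p <= k.+1)%N -> (size (p * 'X^d)%R <= (k + d).+1)%N.
Proof.
have [->|p0] := eqVneq p 0; first by rewrite mul0r size_poly0.
by rewrite size_mulXn // addnC -addSn leq_add2r.
Qed.

(** The ideal is pulled back along evaluation to a set [I'] of polynomials: x may satisfy equations
    over S, so elements of the adjoined ring have no leading coefficient of their own. The ideals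
    [L k] of k-th coefficients in degree at most k increase and stabilize at K, and generators taken
    in degrees up to K suffice. *)
Lemma hilbert_basis S x : subring S -> noetherian S -> noetherian (adjoin S x).
Proof.
move=> hS nS I hI; have hSx := adjoin_subring x hS.
pose I' (p : {poly F}) := (forall i, S p`_i) /\ I p.[x].
have I'D p q : I' p -> I' q -> I' (p + q).
  case: hI => _ _ ID _ [pS Ip] [qS Iq]; split=> [i|].
    by rewrite coefD; apply: subringD.
  by rewrite hornerD; apply: ID.
have I'Z c p : S c -> I' p -> I' (c *: p).
  case: hI => _ _ _ IM Sc [pS Ip]; split=> [i|].
    by rewrite coefZ; apply: subringM.
  by rewrite hornerZ; apply: IM => //; apply: adjoin_sub.
have I'X p k : I' p -> I' (p * 'X^k).
  case: hI => _ _ _ IM [pS Ip]; split=> [i|].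
    by rewrite coefMXn; case: ifP => _ //; apply: subring0.
  rewrite hornerM hornerXn mulrC; apply: IM => //.
  by apply: subringX => //; apply: adjoin_gen.
pose L k c := exists p, [/\ I' p, (size p <= k.+1)%N & p`_k = c].
have hL k : ideal S (L k).
  split.
  - by move=> _ [p [[pS _] _ <-]].
  - exists 0; rewrite size_poly0 coef0; split=> //; split=> [i|].
      by rewrite coef0; apply: subring0.
    by rewrite horner0; case: hI.
  - move=> _ _ [p [Ip sp <-]] [q [Iq sq <-]]; exists (p + q).
    split; [exact: I'D| |by rewrite coefD].
    by rewrite (leq_trans (size_polyD _ _)) // geq_max sp sq.
  - move=> r _ Sr [p [Ip sp <-]]; exists (r *: p).
    split; [exact: I'Z| |by rewrite coefZ].
    exact: leq_trans (size_scale_leq _ _) sp.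
have LX k d c : L k c -> L (k + d)%N c.
  move=> [p [Ip sp <-]]; exists (p * 'X^d); split; first exact: I'X.
    exact: size_mulXn_le.
  by rewrite coefMXn ltnNge leq_addl /= addnK.
have [|K hK] := noeth_chain hS nS hL.
  by move=> k c /(LX k 1%N); rewrite addn1.
have hs k := constructive_indefinite_description _ (fin_gen_span (hL k) (nS _ (hL k))).
have hp k c : {p | L k c -> [/\ I' p, (size p <= k.+1)%N & p`_k = c]}.
  apply: constructive_indefinite_description.
  by case: (classic (L k c)) => [[p hp]|h]; [exists p|exists 0].
pose G := flatten [seq [seq (sval (hp k c)).[x] | c <- sval (hs k)] | k <- iota 0 K.+1].
apply: (@span_fin_gen _ _ I G) => //.
  move=> y /flatten_mapP [k _ /mapP [c cs ->]].
  case: (hs k) cs => s /= [hs1 _] cs; case: (hp k c) => p /= hp1.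
  by case: (hp1 (hs1 _ cs)) => [[]].
move=> N hN NG.
have key n : forall p : {poly F}, (size p <= n)%N -> I' p -> N p.[x].
  elim: n => [|n IH] p sp Ip.
    have -> : p = 0 by apply/eqP; rewrite -size_poly_leq0.
    by rewrite horner0; case: hN.
  pose k := minn n K.
  have Lk : L k p`_n.
    have Ln : L n p`_n by exists p.
    rewrite /k; have [nK|Kn] := leqP n K; first exact: Ln.
    exact: hK Ln.
  have [hs1 hs2] := svalP (hs k).
  (* The coefficients of degree n realized by some q in [I'] whose value already lies in N. As a
     submodule containing the generators of [L k] it contains the top coefficient of p, and p - q
     has smaller degree. *)
  pose N' c := exists q, [/\ I' q, (size q <= n.+1)%N, q`_n = c & N q.[x]].
  case: (hN) => N0 ND NM.
  have hN' : smod S N'.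
    split.
    - exists 0; rewrite size_poly0 coef0 horner0; split=> //.
      by split=> [i|]; [rewrite coef0; apply: subring0|rewrite horner0; case: hI].
    - move=> _ _ [q1 [I1 s1 <- N1]] [q2 [I2 s2 <- N2]]; exists (q1 + q2).
      split; [exact: I'D| |by rewrite coefD|by rewrite hornerD; apply: ND].
      by rewrite (leq_trans (size_polyD _ _)) // geq_max s1 s2.
    - move=> r _ Sr [q [Iq sq <- Nq]]; exists (r *: q).
      split; [exact: I'Z|exact: leq_trans (size_scale_leq _ _) sq|by rewrite coefZ|].
      by rewrite hornerZ; apply: NM => //; apply: adjoin_sub.
  have [|q [Iq sq qc Nq]] := hs2 N' hN' _ _ Lk.
    move=> c cs; have Lc := hs1 c cs.
    have [Ip0 sp0 p0c] := svalP (hp k c) Lc; set p0 := sval (hp k c) in Ip0 sp0 p0c.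
    exists (p0 * 'X^(n - k)); split; first exact: I'X.
    + rewrite -{2}(subnKC (geq_minl n K : k <= n)%N).
      exact: size_mulXn_le.
    + by rewrite coefMXn ltnNge leq_subr /= subKn // geq_minl.
    + rewrite hornerM hornerXn mulrC; apply: NM.
        by apply: subringX => //; apply: adjoin_gen.
      apply: NG; apply/flatten_mapP; exists k.
        by rewrite mem_iota /= add0n ltnS geq_minr.
      by apply/mapP; exists c.
  have -> : p.[x] = (p - q).[x] + q.[x] by rewrite hornerD hornerN subrK.
  apply: ND => //; apply: IH; last first.
    by rewrite -scaleN1r; apply: I'D => //; apply: I'Z => //; apply: subringN; rewrite //; apply: subring1.
  apply/leq_sizeP => j; rewrite leq_eqVlt => /orP [/eqP <-|nj].
    by rewrite coefB qc subrr.
  by rewrite coefB !nth_default ?subrr //; [apply: leq_trans sq _|apply: leq_trans sp _].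
move=> y Iy; case: (hI) => /(_ _ Iy) [p [pS yE]] _ _ _.
by rewrite yE; apply: (key (size p)) => //; split=> //; rewrite -yE.
Qed.

End Hilbert.

(** * Valuations of a Dedekind domain *)

Section MaximalIdeals.
Variables (F : fieldType) (A : F -> Prop).
Hypothesis hA : dedekind A.
Hypothesis hK : forall x, fracS A x.
Implicit Types (P I J : F -> Prop) (x y : F).

Let hS : subring A. Proof. by case: hA. Qed.
Let nS : noetherian A. Proof. by case: hA. Qed.

Lemma maximal_nonzero P : maximal_ideal A P -> exists x, P x /\ x != 0.
Proof.
case=> hP P1 Pmax; case: hA => _ _ _ _ [Q [[hQ Q1 _] [x [Qx x0]]]].
apply: NNPP => nP; have [|h|//] := Pmax Q hQ.
  move=> y Py; have [->|y0] := eqVneq y 0; first by case: hQ.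
  by case: nP; exists y.
by apply: nP; exists x; split=> //; apply/h.
Qed.

Lemma maximal_comax P t : maximal_ideal A P -> A t -> ~ P t ->
  exists y r, [/\ A y, P r & t * y + r = 1].
Proof.
case=> [[PA P0 PD PM]] P1 Pmax At nPt.
pose J x := exists y r, [/\ A y, P r & x = t * y + r].
have [||h|[y [r [Ay Pr ->]]]] := Pmax J.
- split.
  + by move=> _ [y [r [Ay Pr ->]]]; apply: subringD => //; [apply: subringM|apply: PA].
  + by exists 0, 0; rewrite mulr0 addr0; split=> //; apply: subring0.
  + move=> _ _ [y [r [Ay Pr ->]]] [y' [r' [Ay' Pr' ->]]]; exists (y + y'), (r + r').
    by split; [exact: subringD|exact: PD|ring].
  + move=> c _ Ac [y [r [Ay Pr ->]]]; exists (c * y), (c * r).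
    by split; [exact: subringM|exact: PM|ring].
- by move=> x Px; exists 0, x; rewrite mulr0 add0r; split=> //; apply: subring0.
- case: nPt; apply/h; exists 1, 0; rewrite mulr1 addr0; split=> //.
  exact: subring1.
- by exists y, r.
Qed.

Lemma maximal_prime P : maximal_ideal A P -> prime_ideal A P.
Proof.
move=> hP; case: (hP) => [hI P1 _]; case: (hI) => [PA P0 PD PM].
split=> // a b Aa Ab Pab; apply: NNPP => /not_or_and [nPa nPb].
have [y [r [Ay Pr E]]] := maximal_comax hP Aa nPa.
apply: nPb; rewrite -[b]mulr1 -E.
have -> : b * (a * y + r) = y * (a * b) + b * r by ring.
by apply: PD; apply: PM.
Qed.

Lemma maximal_notM P a b : maximal_ideal A P -> A a -> A b -> ~ P a -> ~ P b -> ~ P (a * b).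
Proof. by move=> /maximal_prime [_ _ h] Aa Ab nPa nPb /(h a b Aa Ab) []. Qed.

Lemma maximal_exists I : ideal A I -> ~ I 1 ->
  exists P, maximal_ideal A P /\ forall x, I x -> P x.
Proof.
move: I; apply: (noeth_ind hS nS) => I hI IH I1.
apply: NNPP => nP; apply: (nP); exists I; split=> //; split=> // J hJ IJ.
apply: NNPP => /not_or_and [nJI nJ1]; apply: nP.
have [|P [hP JP]] := IH J hJ IJ _ nJ1; last by exists P; split=> // x /IJ /JP.
apply: NNPP => nx; apply: nJI => x; split=> [Jx|]; last exact: IJ.
by apply: NNPP => nIx; apply: nx; exists x.
Qed.

Lemma closed_pt_inhabited : inhabited (closed_pt A).
Proof.
case: hA => _ _ _ hmax [Q [hQ [y [Qy y0]]]].
by constructor; exists Q; apply: hmax => //; exists y.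
Qed.

(** The maximal ideal of the local ring at P is generated by p, stated without localizing: the
    single denominator u outside P serves all q. *)
Definition uniformizing P p u : Prop :=
  [/\ P p, A u, ~ P u & forall q, P q -> exists s, A s /\ u * q = p * s].

(* [T] below is the contraction of the localized ideal [a A_P].  A maximal
   proper colon ideal [(T : b)] is prime and contained in [P], hence equal to [P];
   so some [x = t b / a] outside [A] maps [P] into [A], and [x P] is not inside
   [P] because [A] is normal. *)
Lemma uniformizer_exists P : maximal_ideal A P -> exists p u, uniformizing P p u.
Proof.
move=> hP; case: (hP) => [[PA P0 PD PM] P1 Pmax].
have [a [Pa a0]] := maximal_nonzero hP; have Aa := PA a Pa.
pose T s := A s /\ exists t r, [/\ A t, ~ P t, A r & t * s = a * r].
have hT : ideal A T.
  split.
  - by move=> x [].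
  - split; first exact: subring0.
    by exists 1, 0; rewrite !mulr0; split=> //; [exact: subring1|exact: subring0].
  - move=> x y [Ax [t [r [At nt Ar E]]]] [Ay [t' [r' [At' nt' Ar' E']]]].
    split; first exact: subringD.
    exists (t * t'), (r * t' + r' * t); split.
    + exact: subringM.
    + exact: maximal_notM.
    + by apply: subringD => //; apply: subringM.
    + transitivity (t * x * t' + t' * y * t); first by ring.
      by rewrite E E'; ring.
  - move=> c x Ac [Ax [t [r [At nt Ar E]]]]; split; first exact: subringM.
    exists t, (c * r); split=> //; first exact: subringM.
    by rewrite mulrCA E; ring.
case: (hT) => TA T0 TD TM.
have hcol b : A b -> ideal A (fun x => A x /\ T (x * b)).
  move=> Ab; split.
  - by move=> x [].
  - by split; [exact: subring0|rewrite mul0r].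
  - move=> x y [Ax Tx] [Ay Ty]; split; first exact: subringD.
    by rewrite mulrDl; apply: TD.
  - move=> c x Ac [Ax Tx]; split; first exact: subringM.
    by rewrite -mulrA; apply: TM.
have [b [Ab nTb Qprime]] : exists b, [/\ A b, ~ T b &
    prime_ideal A (fun x => A x /\ T (x * b))].
  have main I : ideal A I -> forall b, A b -> ~ T b ->
     (forall x, I x <-> A x /\ T (x * b)) -> exists b, [/\ A b, ~ T b &
       prime_ideal A (fun x => A x /\ T (x * b))].
    move: I; apply: (noeth_ind hS nS) => I hI IH b Ab nTb IE.
    apply: NNPP => nex; apply: (nex); exists b; split=> //.
    split; [exact: hcol|by rewrite mul1r => -[]|] => x y Ax Ay [Axy Txy].
    apply: NNPP => /not_or_and [nx ny].
    have nTy : ~ T (y * b) by move=> h; apply: ny.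
    apply: nex.
    apply: (IH _ (hcol _ (subringM hS Ay Ab)) _ _ (y * b)) => //.
    + move=> w /IE [Aw Tw]; split=> //.
      by rewrite mulrCA; apply: TM.
    + exists x; split; first by rewrite mulrA.
      by move=> /IE /nx.
    + exact: subringM.
  apply: (main _ (hcol 1 (subring1 hS))) => //; [exact: subring1| |by move=> x; split].
  move=> [_ [t [r [At nt Ar]]]]; rewrite mulr1 => E; apply: nt.
  by rewrite E mulrC; apply: PM.
have Qmax : maximal_ideal A (fun x => A x /\ T (x * b)).
  case: hA => _ _ _ h _; apply: h => //; exists a; split=> //; split=> //.
  rewrite mulrC; apply: TM => //; split=> //.
  exists 1, 1; rewrite mul1r mulr1; split=> //; exact: subring1.
have QP x : A x /\ T (x * b) -> P x.
  move=> [Ax [_ [t [r [At nt Ar E]]]]]; apply: NNPP => nPx; apply: nTb.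
  split=> //; exists (t * x), r; split=> //; [exact: subringM|exact: maximal_notM|].
  by rewrite -mulrA.
have PQ x : P x -> T (x * b).
  case: (Qmax) => _ _ /(_ P (proj1 (conj (And4 PA P0 PD PM) I)) QP) [h|//].
  by move=> /h [].
have [s [Ps hs]] := fin_gen_span (And4 PA P0 PD PM) (nS (And4 PA P0 PD PM)).
have [t [At nt ht]] : exists t, [/\ A t, ~ P t & forall x, x \in s ->
    exists r, A r /\ t * (x * b) = a * r].
  elim: s Ps {hs} => [|x s IH] Ps.
    by exists 1; split=> //; apply: subring1.
  have [|t [At nt ht]] := IH; first by move=> y ys; apply: Ps; rewrite inE ys orbT.
  have [_ [t' [r [At' nt' Ar E]]]] := PQ x (Ps x (mem_head _ _)).
  exists (t * t'); split; [exact: subringM|exact: maximal_notM|].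
  move=> y; rewrite inE => /orP [/eqP ->|ys].
    by exists (t * r); split; [exact: subringM|rewrite -mulrA E; ring].
  have [r' [Ar' E']] := ht y ys.
  exists (t' * r'); split; [exact: subringM|].
  by transitivity (t' * (t * (y * b))); [ring|rewrite E'; ring].
pose x := t * b / a.
have Ax q : P q -> A (x * q).
  move: q; apply: (hs (fun q => A (x * q))).
    split.
    - by rewrite mulr0; apply: subring0.
    - by move=> y z Ay Az; rewrite mulrDr; apply: subringD.
    - by move=> c y Ac Ay; rewrite mulrCA; apply: subringM.
  move=> q /ht [r [Ar E]].
  suff -> : x * q = r by [].
  by apply: (mulfI a0); rewrite -E /x; field.
have nAx : ~ A x.
  move=> hx; apply: nTb; split=> //; exists t, x; split=> //.
  by rewrite /x; field.
have [p [Pp nxp]] : exists p, P p /\ ~ P (x * p).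
  apply: NNPP => np; apply: nAx.
  have xP q : P q -> P (x * q) by move=> Pq; apply: NNPP => nq; apply: np; exists q.
  case: hA => _ _ nor _ _; apply: nor => //.
  apply: (almost_integral_integral hS nS a0) => k; apply: PA.
  elim: k => [|k IH]; first by rewrite mulr1.
  by rewrite exprS mulrCA; apply: xP.
exists p, (x * p); split=> //; first exact: Ax.
move=> q Pq; exists (x * q); split; first exact: Ax.
by ring.
Qed.

(** * The discrete valuation at one maximal ideal *)

Section Valuation.
Variable P : F -> Prop.
Hypothesis hP : maximal_ideal A P.
Variables p u : F.
Hypothesis hu : uniformizing P p u.

Let Pp : P p. Proof. by case: hu. Qed.
Let Au : A u. Proof. by case: hu. Qed.
Let nPu : ~ P u. Proof. by case: hu. Qed.
Let huP q : P q -> exists s, A s /\ u * q = p * s.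
Proof. by case: hu => _ _ _; apply. Qed.

Let PI : ideal A P. Proof. by case: hP. Qed.
Let PA x : P x -> A x. Proof. by case: PI => h _ _ _; apply: h. Qed.
Let Ap : A p. Proof. exact: PA. Qed.
Let P1 : ~ P 1. Proof. by case: hP. Qed.
Let PM r x : A r -> P x -> P (r * x). Proof. by case: PI => _ _ _; apply. Qed.
Let P0 : P 0. Proof. by case: PI. Qed.

Lemma uniformizer_neq0 : p != 0.
Proof.
apply/eqP => p0; have [q [Pq q0]] := maximal_nonzero hP.
have [s [_ E]] := huP Pq.
move/eqP: E; rewrite p0 mul0r mulf_eq0 (negbTE q0) orbF => /eqP u0.
by apply: nPu; rewrite u0.
Qed.

Let p0 := uniformizer_neq0.

Lemma ipow_smod k : smod A (ipow A P k).
Proof.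
case: k => [|k]; first exact: subring_smod.
split.
- by exists [::]; rewrite big_nil; split.
- move=> _ _ [s [hs ->]] [t [ht ->]]; exists (s ++ t); rewrite big_cat; split=> //.
  by move=> q; rewrite mem_cat => /orP []; [apply: hs|apply: ht].
- move=> r _ Ar [s [hs ->]]; exists [seq (q.1, r * q.2) | q <- s].
  rewrite big_map mulr_sumr; split=> [_ /mapP [q /hs [h1 h2] ->] /=|].
    by split=> //; apply: PM.
  by apply: eq_bigr => q _ /=; ring.
Qed.

Lemma ipowX k r : P r -> ipow A P k (r ^+ k).
Proof.
move=> Pr; elim: k => [|k IH] /=; first by rewrite expr0; apply: subring1.
exists [:: (r ^+ k, r)]; rewrite big_seq1 exprSr; split=> // q.
by rewrite inE => /eqP ->.
Qed.

(** Links the powers of P, through which orders are defined, to divisibility by p in the local ring.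
    For the converse, t outside P is comaximal with r^k for some r in P, so a = a t y' + a r^k, and
    both terms lie in P^k. *)
Lemma ipowP k a : ipow A P k a <->
  A a /\ exists t s, [/\ A t, ~ P t, A s & t * a = p ^+ k * s].
Proof.
split.
  elim: k a => [|k IH] a /=.
    move=> Aa; split=> //; exists 1, a; rewrite expr0; split=> //.
    exact: subring1.
  move=> [s [hs ->]]; rewrite big_seq.
  pose N a := A a /\ exists t s, [/\ A t, ~ P t, A s & t * a = p ^+ k.+1 * s].
  have hN : smod A N.
    split.
    - split; [exact: subring0|exists 1, 0; split=> //].
      + exact: subring1.
      + exact: subring0.
      + by rewrite !mulr0.
    - move=> x y [Ax [t [r [At nt Ar E]]]] [Ay [t' [r' [At' nt' Ar' E']]]].
      split; first exact: subringD.
      exists (t * t'), (r * t' + r' * t); split.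
      + exact: subringM.
      + exact: maximal_notM.
      + by apply: subringD => //; apply: subringM.
      + transitivity (t * x * t' + t' * y * t); first by ring.
        by rewrite E E'; ring.
    - move=> c x Ac [Ax [t [r [At nt Ar E]]]]; split; first exact: subringM.
      exists t, (c * r); split=> //; first exact: subringM.
      by rewrite mulrCA E; ring.
  apply: (smod_sum hN) => q /hs [/IH [Aq1 [t [r [At nt Ar E]]]] Pq2].
  have [r' [Ar' E']] := huP Pq2.
  split; first by apply: subringM => //; apply: PA.
  exists (t * u), (r * r'); split; [exact: subringM|exact: maximal_notM|exact: subringM|].
  transitivity (t * q.1 * (u * q.2)); first by ring.
  by rewrite E E' exprS; ring.
move=> [Aa [t [s [At nt As E]]]].
case: (ipow_smod k) => _ ID IM.
have [y [r [Ay Pr E1]]] := maximal_comax hP At nt.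
have [y' [Ay' E2]] : exists y', A y' /\ t * y' + r ^+ k = 1.
  elim: k {E ID IM} => [|k [y' [Ay' IH]]].
    exists 0; split; [exact: subring0|by rewrite mulr0 add0r expr0].
  exists (y' + y * r ^+ k); split.
    by apply: subringD => //; apply: subringM => //; apply: subringX => //; apply: PA.
  transitivity (t * y' + (t * y + r) * r ^+ k); first by rewrite exprS; ring.
  by rewrite E1 mul1r.
rewrite -[a]mulr1 -E2 mulrDr; apply: ID; last by apply: IM => //; apply: ipowX.
have -> : a * (t * y') = (y' * s) * p ^+ k by rewrite mulrA (mulrC a) E; ring.
by apply: IM; [exact: subringM|exact: ipowX].
Qed.

(** Valuation k: x is p^k times the unit s / t of the local ring. *)
Definition hasval (k : int) x : Prop :=
  exists s t, [/\ A s, A t, ~ P s, ~ P t & x = p ^ k * s / t].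

Let n0 s : ~ P s -> s != 0.
Proof. by move=> ns; apply/eqP => s0; apply: ns; rewrite s0. Qed.

Local Ltac nz := repeat (apply/andP; split);
  first [exact: p0 | by apply: n0 | exact: expfz_neq0 | exact: expf_neq0].

Lemma hasval_neq0 k x : hasval k x -> x != 0.
Proof.
move=> [s [t [As At ns nt ->]]].
apply: mulf_neq0; last by rewrite invr_eq0 n0.
by apply: mulf_neq0; [exact: expfz_neq0|exact: n0].
Qed.

Lemma hasvalM k l x y : hasval k x -> hasval l y -> hasval (k + l) (x * y).
Proof.
move=> [s [t [As At ns nt ->]]] [s' [t' [As' At' ns' nt' ->]]].
exists (s * s'), (t * t'); split; try exact: subringM; try exact: maximal_notM.
by rewrite expfzDr //; field; nz.
Qed.

Lemma hasvalV k x : hasval k x -> hasval (- k) x^-1.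
Proof.
move=> [s [t [As At ns nt ->]]]; exists t, s; split=> //.
by rewrite -invr_expz; field; nz.
Qed.

Lemma hasval_uniq k l x : hasval k x -> hasval l x -> k = l.
Proof.
wlog kl : k l / k <= l => [h hk hl|].
  by case: (lerP k l) => kl; [apply: h|apply/esym; apply: h => //; apply: ltW].
move=> [s [t [As At ns nt ->]]] [s' [t' [As' At' ns' nt' E]]].
apply/eqP; apply: contraT => nkl.
have [d E2] : exists d : nat, l = k + d.+1%:Z.
  by have kl' : k < l by [rewrite lt_neqAle nkl]; exists (absz (l - k)).-1; lia.
exfalso.
have : P (s * t').
  have -> : s * t' = (p ^+ d * s' * t) * p.
    apply: (mulfI (expfz_neq0 k p0)).
    move/(congr1 (fun x => x * t * t')): E; rewrite E2 expfzDr // -exprnP exprS.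
    have -> : p ^ k * s / t * t * t' = p ^ k * (s * t') by field; nz.
    by move=> ->; field; nz.
  by apply: PM => //; apply: subringM => //; apply: subringM => //; apply: subringX.
exact: maximal_notM.
Qed.

Lemma not_unit_div s : P s -> forall k t a, A t -> ~ P t -> t * a = p ^+ k * s ->
  exists t' s', [/\ A t', ~ P t', A s' & t' * a = p ^+ k.+1 * s'].
Proof.
move=> Ps k t a At nt E; have [s' [As' E']] := huP Ps.
exists (u * t), s'; split=> //; [exact: subringM|exact: maximal_notM|].
by rewrite -mulrA E mulrCA E' exprSr mulrA.
Qed.

(** If a were locally divisible by every p^k, the contractions [J k] of the local colon ideals (a :
    p^k) would stabilize at some K. Writing t a = p^(K+1) s, the element s lies in [J K.+1], and its
    membership in [J K] would make p a local unit. *)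
Lemma hasval_ex_sub a : A a -> a != 0 -> exists k : nat, hasval k%:Z a.
Proof.
move=> Aa a0; apply: NNPP => nex.
have div k : exists t s, [/\ A t, ~ P t, A s & t * a = p ^+ k * s].
  elim: k => [|k [t [s [At nt As E]]]].
    by exists 1, a; rewrite expr0; split=> //; apply: subring1.
  apply: (@not_unit_div s _ k t) => //.
  apply: NNPP => ns; apply: nex; exists k, s, t; split=> //.
  by rewrite -exprnP -E; field; nz.
pose J (k : nat) y := A y /\ exists t s, [/\ A t, ~ P t, A s & t * p ^+ k * y = a * s].
have hJ k : ideal A (J k).
  split.
  - by move=> x [].
  - split; [exact: subring0|exists 1, 0; split=> //].
    + exact: subring1.
    + exact: subring0.
    + by rewrite !mulr0.
  - move=> x y [Ax [t [r [At nt Ar E]]]] [Ay [t' [r' [At' nt' Ar' E']]]].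
    split; first exact: subringD.
    exists (t * t'), (r * t' + r' * t); split.
    + exact: subringM.
    + exact: maximal_notM.
    + by apply: subringD => //; apply: subringM.
    + transitivity (t * p ^+ k * x * t' + t' * p ^+ k * y * t); first by ring.
      by rewrite E E'; ring.
  - move=> c x Ac [Ax [t [r [At nt Ar E]]]]; split; first exact: subringM.
    exists t, (c * r); split=> //; first exact: subringM.
    by rewrite mulrCA E; ring.
have [|K hKK] := noeth_chain hS nS hJ.
  move=> k x [Ax [t [r [At nt Ar E]]]]; split=> //; exists t, (p * r).
  split=> //; first exact: subringM.
  transitivity (p * (t * p ^+ k * x)); first by rewrite exprS; ring.
  by rewrite E; ring.
have [t [s [At nt As E]]] := div K.+1.
have [|_ [t' [s' [At' nt' As' E']]]] := hKK K.+1 s.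
  by split=> //; exists 1, t; rewrite mul1r -E; split=> //; [exact: subring1|ring].
have : P (t' * t).
  have -> : t' * t = s' * p; last exact: PM.
  apply: (mulfI a0); transitivity (t' * (t * a)); first by ring.
  rewrite E exprS; transitivity (p * (t' * p ^+ K * s)); first by ring.
  by rewrite E'; ring.
exact: maximal_notM.
Qed.

Lemma hasval_ex x : x != 0 -> exists k, hasval k x.
Proof.
have [a [b [Aa Ab b0 ->]]] := hK x => ab0.
have a0 : a != 0 by apply: contraNneq ab0 => ->; rewrite mul0r.
have [k hk] := hasval_ex_sub Aa a0; have [l hl] := hasval_ex_sub Ab b0.
by exists (k%:Z - l%:Z); apply: hasvalM => //; apply: hasvalV.
Qed.

Lemma hasval_sub_ge0 k a : A a -> hasval k a -> 0 <= k.
Proof.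
move=> Aa ha; have [l hl] := hasval_ex_sub Aa (hasval_neq0 ha).
by rewrite (hasval_uniq ha hl).
Qed.

Lemma hasvalD k l m x y : hasval k x -> hasval l y -> hasval m (x + y) ->
  Num.min k l <= m.
Proof.
wlog kl : k l x y / k <= l => [h hk hl|].
  case: (lerP k l) => kl; first by move=> hm; have := h _ _ _ _ kl hk hl hm; rewrite min_l.
  by rewrite addrC => hm; have := h _ _ _ _ (ltW kl) hl hk hm; rewrite min_l // ltW.
rewrite min_l // => hx hy hxy.
have [s [t [As At ns nt Ex]]] := hx; have [s' [t' [As' At' ns' nt' Ey]]] := hy.
have [d E2] : exists d : nat, l = k + d%:Z by exists (absz (l - k)); lia.
have htt : hasval 0 (t * t').
  exists (t * t'), 1; split; [exact: subringM|exact: subring1|exact: maximal_notM|done|].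
  by rewrite expr0z mul1r divr1.
have hp : hasval (- k) (p ^ (- k)).
  exists 1, 1; split=> //; try exact: subring1.
  by rewrite mulr1 divr1.
(* Multiplying x + y by t t' p^(-k) lands in A, where valuations are nonnegative. *)
have := hasvalM htt (hasvalM hp hxy); set w := _ * _.
have Aw : A w.
  have -> : w = s * t' + p ^+ d * s' * t.
    rewrite /w Ex Ey E2 expfzDr // -exprnP -invr_expz.
    by field; nz.
  apply: subringD => //; apply: subringM => //; apply: subringM => //.
  exact: subringX.
move=> /(hasval_sub_ge0 Aw); lia.
Qed.

Lemma ordS_hasval a (k : nat) : A a -> Defs.ordS A P a k <-> hasval k%:Z a.
Proof.
move=> Aa; split.
  move=> [/ipowP [_ [t [s [At nt As E]]]] nk]; exists s, t; split=> //.
    move=> Ps; apply: nk; apply/ipowP; split=> //.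
    exact: (not_unit_div Ps At nt E).
  by rewrite -exprnP -E; field; nz.
move=> ha; have [s [t [As At ns nt E]]] := ha; split.
  apply/ipowP; split=> //; exists t, s; split=> //.
  by rewrite E -exprnP; field; nz.
move=> /ipowP [_ [t' [s' [At' nt' As' E']]]].
have : P (s * t').
  have -> : s * t' = (s' * t) * p; last by apply: PM => //; apply: subringM.
  apply: (mulfI (expf_neq0 k p0)).
  have -> : p ^+ k * (s * t') = t' * a * t by rewrite E -exprnP; field; nz.
  by rewrite E' exprS; ring.
exact: maximal_notM.
Qed.

End Valuation.

(** * The order functions at all closed points *)

Local Notation pt := (closed_pt A).
Implicit Types z w : pt.

(* Unspecified at [x = 0]. *)
Definition ordf z x : int := epsilon (inhabits 0) (fun k => ord z x k).

(** [ord] ranges over all presentations of x as a quotient; uniqueness of the valuation makes it the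
    graph of the function [ordf z]. *)
Lemma ordf_spec z : exists p u, uniformizing (sval z) p u /\
  forall x, x != 0 -> hasval (sval z) p (ordf z x) x /\ forall k, ord z x k <-> k = ordf z x.
Proof.
have hz := svalP z; have [p [u hu]] := uniformizer_exists hz.
exists p, u; split=> // x x0.
have hord k : ord z x k <-> hasval (sval z) p k x.
  split.
    move=> [a [b [ka [kb [[Aa Ab a0 b0 ->] [ha hb ->]]]]]].
    apply: (hasvalM hz hu); first exact/(ordS_hasval hz hu).
    by apply: (hasvalV hz hu); apply/(ordS_hasval hz hu).
  move=> hk; have [a [b [Aa Ab b0 E]]] := hK x.
  have a0 : a != 0 by apply: contraNneq x0 => a0; rewrite E a0 mul0r.
  have [ka ha] := hasval_ex_sub hz hu Aa a0.
  have [kb hb] := hasval_ex_sub hz hu Ab b0.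
  exists a, b, ka, kb; split; [by split|split].
  - exact/(ordS_hasval hz hu).
  - exact/(ordS_hasval hz hu).
  - apply: (hasval_uniq hz hu hk); rewrite E.
    by apply: (hasvalM hz hu) => //; apply: (hasvalV hz hu).
have [k0 hk0] := hasval_ex hz hu x0.
have hv : hasval (sval z) p (ordf z x) x.
  by apply/hord; apply: epsilon_spec; exists k0; apply/hord.
split=> // k; split=> [/hord hk|->]; last exact/hord.
exact: (hasval_uniq hz hu hk hv).
Qed.

Lemma ordfP z x k : x != 0 -> ord z x k <-> k = ordf z x.
Proof. by have [p [u [_ h]]] := ordf_spec z => /h []. Qed.

Lemma ordfM z x y : x != 0 -> y != 0 -> ordf z (x * y) = ordf z x + ordf z y.
Proof.
have [p [u [hu h]]] := ordf_spec z => x0 y0; have hz := svalP z.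
have [hx _] := h x x0; have [hy _] := h y y0.
have [hxy _] := h _ (mulf_neq0 x0 y0).
exact: (hasval_uniq hz hu hxy (hasvalM hz hu hx hy)).
Qed.

Lemma ordfV z x : x != 0 -> ordf z x^-1 = - ordf z x.
Proof.
have [p [u [hu h]]] := ordf_spec z => x0; have hz := svalP z.
have [hx _] := h x x0.
have [|hV _] := h x^-1; first by rewrite invr_eq0.
exact: (hasval_uniq hz hu hV (hasvalV hz hu hx)).
Qed.

Lemma ordf1 z : ordf z 1 = 0.
Proof.
have := ordfM z (oner_neq0 F) (oner_neq0 F); rewrite mulr1 => E.
by apply: (addrI (ordf z 1)); rewrite -E addr0.
Qed.

Lemma ordfX z x k : x != 0 -> ordf z (x ^+ k) = ordf z x *+ k.
Proof.
move=> x0; elim: k => [|k IH]; first by rewrite expr0 ordf1.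
by rewrite exprS ordfM ?expf_neq0 // IH mulrS.
Qed.

Lemma ordfXz z x (k : int) : x != 0 -> ordf z (x ^ k) = ordf z x * k.
Proof.
move=> x0; case: k => k; first by rewrite -exprnP ordfX // pmulrn mulrzz.
by rewrite NegzE -exprnN ordfV ?expf_neq0 // ordfX // mulrN pmulrn mulrzz.
Qed.

Lemma ordf_prod z (I : Type) (r : seq I) (f : I -> F) : (forall i, f i != 0) ->
  ordf z (\prod_(i <- r) f i) = \sum_(i <- r) ordf z (f i).
Proof.
move=> f0; elim: r => [|i r IH]; first by rewrite !big_nil ordf1.
rewrite !big_cons ordfM ?IH //; elim: {IH} r => [|j r IH].
  by rewrite big_nil oner_neq0.
by rewrite big_cons mulf_neq0.
Qed.

Lemma ordfD z x y : x != 0 -> y != 0 -> x + y != 0 ->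
  Num.min (ordf z x) (ordf z y) <= ordf z (x + y).
Proof.
have [p [u [hu h]]] := ordf_spec z => x0 y0 xy0; have hz := svalP z.
have [hx _] := h x x0; have [hy _] := h y y0; have [hxy _] := h _ xy0.
exact: (hasvalD hz hu hx hy hxy).
Qed.

Lemma ordf_ge0 z x : x != 0 -> A x -> 0 <= ordf z x.
Proof.
have [p [u [hu h]]] := ordf_spec z => x0 Ax; have hz := svalP z.
have [hx _] := h x x0; exact: (hasval_sub_ge0 hz hu Ax hx).
Qed.

Lemma ordf_unit z x : A x -> ~ sval z x -> ordf z x = 0.
Proof.
have [p [u [hu h]]] := ordf_spec z => Ax nx; have hz := svalP z.
have x0 : x != 0.
  by apply/eqP => x0; apply: nx; rewrite x0; case: hz => [[]].
have [hx _] := h x x0; apply: (hasval_uniq hz hu hx).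
exists x, 1; split=> //; first exact: subring1.
  by case: hz.
by rewrite expr0z mul1r divr1.
Qed.

Lemma ordf_gt0 z x : x != 0 -> sval z x -> 1 <= ordf z x.
Proof.
have [p [u [hu h]]] := ordf_spec z => x0 Px; have hz := svalP z.
have Ax : A x by case: (hz) => [[PA _ _ _] _ _]; apply: PA.
have [hx _] := h x x0; have := ordf_ge0 z x0 Ax.
rewrite le_eqVlt => /orP [/eqP E|]; last by rewrite gtz0_ge1.
move: hx; rewrite -E => -[s [t [As At ns nt]]].
rewrite expr0z mul1r => Ex; case: ns.
have t0 : t != 0 by apply/eqP => t0; apply: nt; rewrite t0; case: hz => [[]].
have -> : s = t * x by rewrite Ex; field.
by case: hz => [[_ _ _ PM] _ _]; apply: PM.
Qed.

Lemma ordf_ge0_local z x : x != 0 -> 0 <= ordf z x ->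
  exists t, [/\ A t, ~ sval z t & A (t * x)].
Proof.
have [p [u [hu h]]] := ordf_spec z => x0 vx; have hz := svalP z.
have [[s [t [As At ns nt Ex]]] _] := h x x0; exists t; split=> //.
have t0 : t != 0 by apply/eqP => t0; apply: nt; rewrite t0; case: hz => [[]].
have -> : t * x = p ^ ordf z x * s by rewrite {1}Ex; field.
apply: subringM => //; case: (ordf z x) vx => // k _; apply: subringX => //.
by case: hz => [[PA _ _ _] _ _]; case: hu => /PA.
Qed.

Lemma ordf_uniformizer z : exists p, p != 0 /\ ordf z p = 1.
Proof.
have [p [u [hu h]]] := ordf_spec z; have hz := svalP z.
have p0 := uniformizer_neq0 hz hu; exists p; split=> //.
have [hp _] := h p p0; apply: (hasval_uniq hz hu hp).
have h1 : ~ sval z 1 by case: hz.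
exists 1, 1; split=> //; try exact: subring1.
by rewrite expr1z divr1 mulr1.
Qed.

(** The ideal of all s with s g in N lies in no maximal ideal, so it contains 1. *)
Lemma local_mem N g : smod A N ->
  (forall z, exists t, [/\ A t, ~ sval z t & N (t * g)]) -> N g.
Proof.
move=> [N0 ND NM] h; pose I s := A s /\ N (s * g).
have hI : ideal A I.
  split.
  - by move=> x [].
  - by split; [exact: subring0|rewrite mul0r].
  - by move=> x y [Ax Nx] [Ay Ny]; split; [exact: subringD|rewrite mulrDl; apply: ND].
  - by move=> r x Ar [Ax Nx]; split; [exact: subringM|rewrite -mulrA; apply: NM].
case: (classic (I 1)) => [[_]|I1]; first by rewrite mul1r.
have [P [hP IP]] := maximal_exists hI I1.
have [t [At nt Nt]] := h (exist _ P hP).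
by case: nt; apply: IP.
Qed.

Lemma ordf_ge0_mem x : x != 0 -> (forall z, 0 <= ordf z x) -> A x.
Proof.
move=> x0 hx; apply: (local_mem (subring_smod hS)) => z.
exact: ordf_ge0_local.
Qed.

Lemma pt_eq z w : (forall x, sval w x -> sval z x) -> z = w.
Proof.
move=> h; have hw := svalP w; have hz := svalP z.
have E : sval z = sval w.
  case: hw => _ _ /(_ (sval z)) [||hE|h1] //; first by case: hz.
    by apply: functional_extensionality => x; apply: propositional_extensionality.
  by case: hz.
case: z w E {h hw hz} => P hP [Q hQ] /= E.
by subst Q; rewrite (proof_irrelevance _ hP hQ).
Qed.

(** * Finiteness of supports and elements with prescribed orders *)

Definition finite_pts (Q : pt -> Prop) : Prop :=
  exists l : seq pt, forall z, Q z -> List.In z l.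

Lemma finite_pts_sub (Q R : pt -> Prop) : (forall z, Q z -> R z) -> finite_pts R -> finite_pts Q.
Proof. by move=> h [l hl]; exists l => z /h /hl. Qed.

Lemma finite_ptsU (Q R : pt -> Prop) : finite_pts Q -> finite_pts R -> finite_pts (fun z => Q z \/ R z).
Proof.
move=> [l hl] [k hk]; exists (l ++ k) => z.
by case=> [/hl|/hk] h; apply/List.in_or_app; [left|right].
Qed.

Lemma finite_pts_bigU (r : nat) (Q : 'I_r -> pt -> Prop) :
  (forall i, finite_pts (Q i)) -> finite_pts (fun z => exists i, Q i z).
Proof.
move=> hQ; have hl i := constructive_indefinite_description _ (hQ i).
exists (flatten [seq sval (hl i) | i <- enum 'I_r]) => z [i /(svalP (hl i)) hi].
have : i \in enum 'I_r by rewrite mem_enum.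
elim: (enum _) => //= j s IH; rewrite inE => /orP [/eqP <-|/IH hj].
  by apply/In_cat; left.
by apply/In_cat; right.
Qed.

(** Noetherian induction. A nonzero prime is maximal and lies in just one closed point. If a b is in
    I but neither factor is, every point containing I contains I + (a) or I + (b), which are
    larger. *)
Lemma finite_pts_ideal I : ideal A I -> (exists x, I x /\ x != 0) ->
  finite_pts (fun z => forall x, I x -> sval z x).
Proof.
move: I; apply: (noeth_ind hS nS) => I hI IH Inz; case: (hI) => IA I0 ID IM.
case: (classic (I 1)) => [I1|nI1].
  exists [::] => z h; have := svalP z => -[_ + _]; by case; apply: h.
case: (classic (prime_ideal A I)) => [Ip|nIp].
  have hmax : maximal_ideal A I by case: hA => _ _ _ h _; apply: h.
  exists [:: exist _ I hmax] => z h; left; apply/esym.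
  exact: pt_eq.
have [a [b [Aa Ab Iab nIa nIb]]] : exists a b, [/\ A a, A b, I (a * b), ~ I a & ~ I b].
  apply: NNPP => nex; apply: nIp; split=> // a b Aa Ab Iab.
  by apply: NNPP => /not_or_and [na nb]; apply: nex; exists a, b.
pose J a x := exists i r, [/\ I i, A r & x = i + a * r].
have hJ c : A c -> ideal A (J c).
  move=> Ac; split.
  - by move=> _ [i [r [Ii Ar ->]]]; apply: subringD; [|exact: IA|exact: subringM].
  - by exists 0, 0; rewrite mulr0 addr0; split=> //; exact: subring0.
  - move=> _ _ [i [r [Ii Ar ->]]] [i' [r' [Ii' Ar' ->]]]; exists (i + i'), (r + r').
    by split; [exact: ID|exact: subringD|ring].
  - move=> q _ Aq [i [r [Ii Ar ->]]]; exists (q * i), (q * r).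
    by split; [exact: IM|exact: subringM|ring].
have IJ c x : I x -> J c x.
  by move=> Ix; exists x, 0; rewrite mulr0 addr0; split=> //; exact: subring0.
have hf c : A c -> ~ I c -> finite_pts (fun z => forall x, J c x -> sval z x).
  move=> Ac nIc; apply: IH; [exact: hJ|exact: IJ| |].
    exists c; split=> //; exists 0, 1; rewrite mulr1 add0r; split=> //.
    exact: subring1.
  by case: Inz => x [Ix x0]; exists x; split=> //; apply: IJ.
apply: finite_pts_sub (finite_ptsU (hf a Aa nIa) (hf b Ab nIb)) => z h.
have hz := svalP z; case: (maximal_prime hz) => _ _ hp.
case: (hz) => [[_ _ PD PM] _ _].
have key c : sval z c -> forall x, J c x -> sval z x.
  move=> zc _ [i [r [Ii Ar ->]]]; apply: PD; first exact: h.
  by rewrite mulrC; apply: PM.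
by case: (hp a b Aa Ab (h _ Iab)) => ?; [left|right]; apply: key.
Qed.

Lemma finite_pts_ordf x : x != 0 -> finite_pts (fun z => ordf z x <> 0).
Proof.
have hsub a : A a -> a != 0 -> finite_pts (fun z => ordf z a <> 0).
  move=> Aa a0.
  have hI : ideal A (fun x => exists r, A r /\ x = r * a).
    split.
    - by move=> _ [r [Ar ->]]; apply: subringM.
    - by exists 0; rewrite mul0r; split=> //; apply: subring0.
    - move=> _ _ [r [Ar ->]] [r' [Ar' ->]]; exists (r + r').
      by rewrite mulrDl; split=> //; apply: subringD.
    - move=> q _ Aq [r [Ar ->]]; exists (q * r).
      by rewrite mulrA; split=> //; apply: subringM.
  have [|l hl] := finite_pts_ideal hI.
    by exists a; split=> //; exists 1; rewrite mul1r; split=> //; apply: subring1.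
  exists l => z hz; apply: hl => _ [r [Ar ->]].
  have za : sval z a by apply: NNPP => nz; apply: hz; apply: ordf_unit.
  by have [[_ _ _ PM] _ _] := svalP z; apply: PM.
have [a [b [Aa Ab b0 ->]]] := hK x => ab0.
have a0 : a != 0 by apply: contraNneq ab0 => ->; rewrite mul0r.
apply: finite_pts_sub (finite_ptsU (hsub a Aa a0) (hsub b Ab b0)) => z.
rewrite ordfM ?invr_eq0 // ordfV // => h.
by apply: NNPP => /not_or_and [/NNPP ha /NNPP hb]; apply: h; rewrite ha hb subrr.
Qed.

(** Exactness at a single point with mere lower bounds elsewhere avoids the full approximation
    theorem. A power of a uniformizer is right at [z0]; at each of the finitely many points where it
    falls short, an element of A vanishing there but not at [z0] is multiplied in. *)
Lemma exists_exact_order (e : pt -> int) z0 : finite_pts (fun z => e z <> 0) ->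
  exists g, [/\ g != 0, ordf z0 g = e z0 & forall z, e z <= ordf z g].
Proof.
move=> he; have [p [p0 vp]] := ordf_uniformizer z0.
pose g0 := p ^ e z0; have g00 : g0 != 0 by apply: expfz_neq0.
have vg0 : ordf z0 g0 = e z0 by rewrite ordfXz // vp mul1r.
have [l hl] : finite_pts (fun z => ordf z g0 < e z).
  apply: finite_pts_sub (finite_ptsU he (finite_pts_ordf g00)) => z; move/eqP => h.
  apply: NNPP => /not_or_and [/NNPP h1 /NNPP h2]; move/eqP: h.
  by rewrite h1 h2 ltxx.
have [c [Ac c0 vc hc]] : exists c, [/\ A c, c != 0, ordf z0 c = 0 &
    forall z, List.In z l -> z <> z0 -> e z - ordf z g0 <= ordf z c].
  elim: l {hl} => [|w l [c [Ac c0 vc hc]]].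
    by exists 1; split=> //; [exact: subring1|exact: oner_neq0|exact: ordf1].
  case: (classic (w = z0)) => [->|wz].
    by exists c; split=> // z [->|] //; apply: hc.
  have [d [wd nd]] : exists d, sval w d /\ ~ sval z0 d.
    apply: NNPP => nex; apply: wz; apply/esym; apply: pt_eq => x wx.
    by apply: NNPP => nx; apply: nex; exists x.
  have Ad : A d by have [[PA _ _ _] _ _] := svalP w; apply: PA.
  have d0 : d != 0.
    by apply/eqP => d0; apply: nd; rewrite d0; have [[]] := svalP z0.
  (* Since d has order at least 1 at w, this power makes up the whole deficit there, and it does not
     change the order at [z0]. *)
  pose N := absz (e w - ordf w g0).
  have dN : d ^+ N != 0 by apply: expf_neq0.
  exists (c * d ^+ N); split.
  - by apply: subringM => //; apply: subringX.
  - exact: mulf_neq0.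
  - by rewrite ordfM // vc ordfX // (ordf_unit Ad nd) mul0rn.
  - move=> z; rewrite ordfM // ordfX //; case=> [<- _|zl zz0].
      have := ordf_ge0 w c0 Ac; have := ordf_gt0 d0 wd; rewrite pmulrn mulrzz /N; nia.
    have := hc z zl zz0; have := mulrn_wge0 N (ordf_ge0 z d0 Ad); lia.
exists (g0 * c); split; [exact: mulf_neq0|by rewrite ordfM // vg0 vc addr0|].
move=> z; rewrite ordfM //; have c_ge0 := ordf_ge0 z c0 Ac.
case: (classic (z = z0)) => [->|zz0]; first by rewrite vg0 vc addr0.
case: (lerP (e z) (ordf z g0)) => h; first lia.
have := hc z (hl z h) zz0; lia.
Qed.

(** The fractional ideal of functions with divisor at least e, that is, the sections of O(-e). *)
Definition above (e : pt -> int) x : Prop := x = 0 \/ forall z, e z <= ordf z x.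

Lemma above_smod e : smod A (above e).
Proof.
split; first by left.
  move=> x y [->|hx] [->|hy]; rewrite ?addr0 ?add0r; [by left|by right|by right|].
  have [xy0|xy0] := eqVneq (x + y) 0; first by left.
  have [x0|x0] := eqVneq x 0; first by right; rewrite x0 add0r.
  have [y0|y0] := eqVneq y 0; first by right; rewrite y0 addr0.
  by right=> z; apply: le_trans (ordfD z x0 y0 xy0); rewrite le_min hx hy.
move=> r x Ar [->|hx]; first by rewrite mulr0; left.
have [->|r0] := eqVneq r 0; first by rewrite mul0r; left.
have [->|x0] := eqVneq x 0; first by rewrite mulr0; left.
by right=> z; rewrite ordfM // -[e z]add0r lerD // ordf_ge0.
Qed.

(** An element c of order at least -e everywhere carries this fractional ideal isomorphically onto
    an ideal of A. *)
Lemma above_fin_gen e : finite_pts (fun z => e z <> 0) -> exists s : seq F,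
  (forall x, x \in s -> above e x) /\
  forall N, smod A N -> (forall x, x \in s -> N x) -> forall x, above e x -> N x.
Proof.
move=> he; have [z0] := closed_pt_inhabited.
have [|c [c0 _ hc]] := @exists_exact_order (fun z => - e z) z0.
  by apply: finite_pts_sub he => z h1 h2; apply: h1; rewrite h2 oppr0.
have [eD0 eDD eDM] := above_smod e.
have hI : ideal A (fun x => A x /\ above e (x / c)).
  split.
  - by move=> x [].
  - by split; [exact: subring0|rewrite mul0r].
  - by move=> x y [Ax Nx] [Ay Ny]; split; [exact: subringD|rewrite mulrDl; apply: eDD].
  - by move=> r x Ar [Ax Nx]; split; [exact: subringM|rewrite -mulrA; apply: eDM].
have [s [hs1 hs2]] := fin_gen_span hI (nS hI).
exists [seq x / c | x <- s]; split=> [_ /mapP [x /hs1 [_ h] ->] //|N hN Ns x hx].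
have := hs2 (fun y => N (y / c)); move=> /(_ _ _ (x * c)); rewrite mulfK //; apply.
- case: hN => N0 ND NM; split; first by rewrite mul0r.
    by move=> y y' Ny Ny'; rewrite mulrDl; apply: ND.
  by move=> r y Ar Ny; rewrite -mulrA; apply: NM.
- by move=> y ys; apply: Ns; apply/mapP; exists y.
- split=> //; have [->|x0] := eqVneq x 0; first by rewrite mul0r; apply: subring0.
  apply: ordf_ge0_mem => [|z]; first exact: mulf_neq0.
  case: hx => [xE|hx]; first by rewrite xE eqxx in x0.
  by rewrite ordfM //; have := hx z; have := hc z; lia.
Qed.

End MaximalIdeals.

(** * Rational polyhedral cones and polyhedra *)

Section Pairing.
Variable n : nat.
Implicit Types (u v w : 'rV[rat]_n) (m : 'rV[int]_n).

Lemma pairQC u v : pairQ u v = pairQ v u.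
Proof. by apply: eq_bigr => i _; rewrite mulrC. Qed.
Lemma pairQDl u v w : pairQ (u + v) w = pairQ u w + pairQ v w.
Proof. by rewrite -big_split; apply: eq_bigr => i _; rewrite !mxE mulrDl. Qed.
Lemma pairQZl a u w : pairQ (a *: u) w = a * pairQ u w.
Proof. by rewrite mulr_sumr; apply: eq_bigr => i _; rewrite !mxE mulrA. Qed.
Lemma pairQDr u v w : pairQ w (u + v) = pairQ w u + pairQ w v.
Proof. by rewrite pairQC pairQDl !(pairQC w). Qed.
Lemma pairQZr a u w : pairQ w (a *: u) = a * pairQ w u.
Proof. by rewrite pairQC pairQZl (pairQC w). Qed.
Lemma pairQ0l w : pairQ 0 w = 0.
Proof. by rewrite -(scale0r w) pairQZl mul0r. Qed.
Lemma pairQ0r w : pairQ w 0 = 0.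
Proof. by rewrite pairQC pairQ0l. Qed.
Lemma pairQNl u w : pairQ (- u) w = - pairQ u w.
Proof. by rewrite -scaleN1r pairQZl mulN1r. Qed.
Lemma pairQNr u w : pairQ w (- u) = - pairQ w u.
Proof. by rewrite pairQC pairQNl pairQC. Qed.
Lemma pairQ_suml (I : Type) (r : seq I) (f : I -> 'rV[rat]_n) w :
  pairQ (\sum_(i <- r) f i) w = \sum_(i <- r) pairQ (f i) w.
Proof.
elim: r => [|i r IH]; first by rewrite !big_nil pairQ0l.
by rewrite !big_cons pairQDl IH.
Qed.
Lemma pairQ_delta v i : pairQ (delta_mx 0 i) v = v 0 i.
Proof.
rewrite /pairQ (bigD1 i) //= mxE !eqxx mul1r big1 ?addr0 // => j /negbTE ji.
by rewrite mxE ji mul0r.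
Qed.

Lemma toQD m m' : toQ (m + m') = toQ m + toQ m'.
Proof. by rewrite /toQ map_mxD. Qed.
Lemma toQMn m k : toQ (m *+ k) = k%:R *: toQ m.
Proof. by apply/rowP => i; rewrite !mxE mulmxnE rmorphMn /= mulr_natl. Qed.
Lemma toQ0 : toQ (0 : 'rV[int]_n) = 0.
Proof. by rewrite /toQ map_mx0. Qed.
Lemma toQ_inj : injective (@toQ n).
Proof.
move=> m m' /rowP h; apply/rowP => i; have := h i; rewrite !mxE.
exact: intr_inj.
Qed.

Lemma pairD m m' v : pair (m + m') v = pair m v + pair m' v.
Proof. by rewrite /pair toQD pairQDl. Qed.
Lemma pairMn m k v : pair (m *+ k) v = k%:R * pair m v.
Proof. by rewrite /pair toQMn pairQZl. Qed.
Lemma pair0 v : pair 0 v = 0.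
Proof. by rewrite /pair toQ0 pairQ0l. Qed.

End Pairing.

Lemma clear_denom (r : nat) (c : 'I_r -> rat) :
  exists2 d : nat, (0 < d)%N & forall i, exists k : int, d%:R * c i = k%:~R.
Proof.
exists (\prod_(i < r) absz (denq (c i)))%N => [|i].
  by rewrite prodn_gt0 // => i; rewrite absz_gt0 denq_neq0.
rewrite (bigD1 i) //= natrM mulrAC.
exists (numq (c i) * (\prod_(j < r | j != i) absz (denq (c j)))%N%:Z).
rewrite intrM; congr (_ * _).
rewrite -{2}(divq_num_den (c i)) pmulrn abszE gtr0_norm ?denq_gt0 //.
by rewrite mulrC divfK // intr_eq0 denq_neq0.
Qed.

Lemma clear_denom_row n (a : 'rV[rat]_n) :
  exists2 d : nat, (0 < d)%N & exists m, toQ m = d%:R *: a.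
Proof.
have [d d0 hd] := clear_denom (fun i => a 0 i); exists d => //.
have hk i := constructive_indefinite_description _ (hd i).
exists (\row_i sval (hk i)); apply/rowP => i; rewrite !mxE.
by rewrite -(svalP (hk i)).
Qed.

(** * Finitely generated cones, the theorem of Weyl and Farkas' lemma *)

Section Cones.
Variable n : nat.
Local Notation V := 'rV[rat]_n.
Implicit Types (u v w y g b : V) (s B G : seq V) (C : V -> Prop).

Definition convex_cone C : Prop :=
  [/\ C 0, (forall u v, C u -> C v -> C (u + v))
      & (forall t u, 0 <= t -> C u -> C (t *: u))].

(** A recursive form of [cone_gen] that exposes the coefficient of one generator at a time, as
    elimination requires. *)
Fixpoint cone s v : Prop :=
  if s is g :: s' then exists t, 0 <= t /\ cone s' (v - t *: g) else v = 0.

Lemma cone_convex s : convex_cone (cone s).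
Proof.
elim: s => [|g s [C0 CD CZ]] /=.
  split=> //; first by move=> u v -> ->; rewrite addr0.
  by move=> t u _ ->; rewrite scaler0.
split.
- by exists 0; rewrite scale0r subr0.
- move=> u v [t [t0 hu]] [t' [t'0 hv]]; exists (t + t'); split.
    exact: addr_ge0.
  by rewrite scalerDl opprD addrACA; apply: CD.
- move=> r u r0 [t [t0 hu]]; exists (r * t); split; first exact: mulr_ge0.
  by rewrite -scalerA -scalerBr; apply: CZ.
Qed.

Lemma cone_mem s g : g \in s -> cone s g.
Proof.
elim: s => //= h s IH; rewrite inE => /orP [/eqP ->|gs].
  exists 1; split=> //; rewrite scale1r subrr.
  by case: (cone_convex s).
by exists 0; rewrite scale0r subr0; split=> //; apply: IH.
Qed.

Lemma cone_min s C : convex_cone C -> (forall g, g \in s -> C g) ->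
  forall v, cone s v -> C v.
Proof.
case=> C0 CD CZ; elim: s => [_ v ->//|g s IH Cs v [t [t0 h]]].
rewrite -(subrK (t *: g) v); apply: CD.
  by apply: IH => // h' hs; apply: Cs; rewrite inE hs orbT.
by apply: CZ => //; apply: Cs; apply: mem_head.
Qed.

Lemma cone_genE G v : cone_gen (fun g => g \in G) v <-> cone G v.
Proof.
split.
  move=> [s [sG [lam [l0 ->]]]]; case: (cone_convex G) => C0 CD CZ.
  elim/big_ind: _ => // i _; apply: CZ => //.
  by apply: cone_mem; apply: sG; apply: mem_nth.
move: v; apply: cone_min => [|g gG].
  split.
  - exists [::]; split=> //; exists (fun=> 0); split=> //.
    by rewrite big_ord0.
  - move=> _ _ [s [sG [lam [l0 ->]]]] [s' [sG' [lam' [l0' ->]]]].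
    exists (s ++ s'); split=> [g|].
      by rewrite mem_cat => /orP [/sG|/sG'].
    have E : size (s ++ s') = (size s + size s')%N by rewrite size_cat.
    exists (fun i => match split (cast_ord E i) with inl j => lam j | inr j => lam' j end).
    split=> [i|]; first by case: split.
    rewrite (reindex_onto (cast_ord (esym E)) (cast_ord E)) => [|i _]; last by rewrite cast_ordK.
    rewrite (eq_bigl xpredT) => [|i]; last by rewrite cast_ordKV eqxx.
    rewrite big_split_ord /=; congr (_ + _); apply: eq_bigr => i _.
      rewrite cast_ordKV (unsplitK (inl i)) nth_cat ltn_ord //.
    by rewrite cast_ordKV (unsplitK (inr i)) nth_cat ltnNge leq_addr /= addKn.
  - move=> t _ t0 [s [sG [lam [l0 ->]]]]; exists s; split=> //.
    exists (fun i => t * lam i); split=> [i|]; first exact: mulr_ge0.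
    by rewrite scaler_sumr; apply: eq_bigr => i _; rewrite scalerA.
exists [:: g]; split=> [h|]; first by rewrite inE => /eqP ->.
by exists (fun=> 1); split=> //; rewrite big_ord1 scale1r.
Qed.

Lemma cone_sum (r : nat) (g : 'I_r -> V) v : cone [seq g i | i <- enum 'I_r] v ->
  exists c : 'I_r -> rat, (forall i, 0 <= c i) /\ v = \sum_i c i *: g i.
Proof.
move: v; apply: cone_min => [|_ /mapP [i _ ->]].
  split.
  - exists (fun=> 0); split=> //; rewrite big1 // => i _; exact: scale0r.
  - move=> _ _ [c [c0 ->]] [d [d0 ->]]; exists (fun i => c i + d i).
    split=> [i|]; first exact: addr_ge0.
    by rewrite -big_split; apply: eq_bigr => i _; rewrite scalerDl.
  - move=> t _ t0 [c [c0 ->]]; exists (fun i => t * c i).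
    split=> [i|]; first exact: mulr_ge0.
    by rewrite scaler_sumr; apply: eq_bigr => i _; rewrite scalerA.
exists (fun j => (j == i)%:R); split=> [j|]; first exact: ler0n.
rewrite (bigD1 i) //= eqxx scale1r big1 ?addr0 // => j /negbTE ->.
exact: scale0r.
Qed.

Lemma half_space_convex w : convex_cone (fun v => 0 <= pairQ w v).
Proof.
split; first by rewrite pairQ0r.
  by move=> u v hu hv; rewrite pairQDr addr_ge0.
by move=> t u t0 hu; rewrite pairQZr mulr_ge0.
Qed.

(** The value for the eliminated coefficient; either list of bounds may be empty. *)
Lemma between (L U : seq rat) : (forall l h : rat, l \in L -> h \in U -> l <= h) ->
  (forall h, h \in U -> 0 <= h) ->
  exists t, [/\ 0 <= t, forall l, l \in L -> l <= t & forall h, h \in U -> t <= h].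
Proof.
elim: L => [|l L IH] LU U0; first by exists 0.
have [|t [t0 tL tU]] := IH _ U0.
  by move=> l' h l'L; apply: LU; rewrite inE l'L orbT.
exists (Num.max l t); split.
- by rewrite le_max t0 orbT.
- move=> l'; rewrite inE le_max => /orP [/eqP ->|/tL ->]; first by rewrite lexx.
  by rewrite orbT.
- by move=> u uU; rewrite ge_max tU // LU // mem_head.
Qed.

(* One step of Fourier-Motzkin elimination per generator. *)
Lemma weyl s : exists B, forall v, cone s v <-> forall b, b \in B -> 0 <= pairQ b v.
Proof.
elim: s => [|g s [B hB]].
  exists ([seq delta_mx 0 i | i <- enum 'I_n] ++ [seq - delta_mx 0 i | i <- enum 'I_n]).
  move=> v /=; split=> [-> b _|h]; first by rewrite pairQ0r.
  apply/rowP => i; rewrite mxE; apply/eqP; rewrite eq_le -oppr_ge0.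
  rewrite -(pairQ_delta v i) -pairQNl !h // mem_cat.
    by apply/orP; left; apply/mapP; exists i; rewrite ?mem_enum.
  by apply/orP; right; apply/mapP; exists i; rewrite ?mem_enum.
pose be b := pairQ b g.
exists ([seq b <- B | 0 <= be b] ++
  [seq be b1 *: b2 - be b2 *: b1 | b1 <- [seq b <- B | 0 < be b], b2 <- [seq b <- B | be b < 0]]).
move=> v /=; split.
  move=> [t [t0 /hB h]] b.
  have h' c : c \in B -> t * be c <= pairQ c v.
    by move=> /h; rewrite pairQDr pairQNr pairQZr subr_ge0.
  rewrite mem_cat mem_filter => /orP [/andP [b0 bB]|].
    by apply: le_trans (h' b bB); apply: mulr_ge0.
  move=> /allpairsP [[b1 b2] /=]; rewrite !mem_filter => -[/andP [b10 b1B] /andP [b20 b2B] ->].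
  rewrite pairQDl pairQNl !pairQZl; have := h' _ b1B; have := h' _ b2B; nra.
move=> h.
have hpos b : b \in B -> 0 <= be b -> 0 <= pairQ b v.
  by move=> bB b0; apply: h; rewrite mem_cat mem_filter b0 bB.
have hmix b1 b2 : b1 \in B -> b2 \in B -> 0 < be b1 -> be b2 < 0 ->
    be b2 * pairQ b1 v <= be b1 * pairQ b2 v.
  move=> b1B b2B h1 h2; rewrite -subr_ge0.
  have := h (be b1 *: b2 - be b2 *: b1); rewrite pairQDl pairQNl !pairQZl; apply.
  rewrite mem_cat; apply/orP; right; apply/allpairsP; exists (b1, b2).
  by rewrite !mem_filter h1 h2.
have [||t [t0 tL tU]] := @between [seq pairQ b v / be b | b <- B & be b < 0]
   [seq pairQ b v / be b | b <- B & 0 < be b].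
- move=> _ _ /mapP [b2 + ->] /mapP [b1 + ->]; rewrite !mem_filter.
  move=> /andP [h2 b2B] /andP [h1 b1B].
  by rewrite ler_ndivrMr // mulrAC ler_pdivrMr // mulrC [leRHS]mulrC hmix.
- move=> _ /mapP [b + ->]; rewrite mem_filter => /andP [b0 bB].
  by apply: divr_ge0; [apply: hpos => //; apply: ltW|apply: ltW].
exists t; split=> //; apply/hB => b bB; rewrite pairQDr pairQNr pairQZr subr_ge0 -/(be b).
case: (ltrgt0P (be b)) => b0.
- have := tU (pairQ b v / be b); rewrite ler_pdivlMr //; apply.
  by apply/mapP; exists b; rewrite ?mem_filter ?b0.
- have := tL (pairQ b v / be b); rewrite ler_ndivrMr //; apply.
  by apply/mapP; exists b; rewrite ?mem_filter ?b0.
- by rewrite b0 mulr0; apply: hpos; rewrite // b0.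
Qed.

(** The separating vector is one of the inequalities cutting out the cone that u violates. *)
Lemma farkas s u : cone s u \/
  exists y, (forall g, g \in s -> 0 <= pairQ g y) /\ pairQ u y < 0.
Proof.
have [B hB] := weyl s; case: (classic (cone s u)) => [|nc]; first by left.
right; apply: NNPP => ny; apply: nc; apply/hB => b bB.
rewrite leNgt; apply/negP => bu; apply: ny; exists b; split=> [g gs|].
  rewrite pairQC; exact: (proj1 (hB g) (cone_mem gs)).
by rewrite pairQC.
Qed.

(** If the vectors C cut out the cone generated by B, then C generates the dual of B: a vector
    separating v from the cone on C would lie in the cone on B, where v is nonnegative. *)
Lemma dual_cone_fg B : exists s, forall v,
  (forall b, b \in B -> 0 <= pairQ b v) <-> cone s v.
Proof.
have [C hC] := weyl B; exists C => v; split.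
  move=> hv; case: (farkas C v) => // -[y [yC yv]].
  have yB : cone B y by apply/hC => c cC; apply: yC.
  have : 0 <= pairQ v y.
    apply: (cone_min (half_space_convex v)) yB => b bB.
    by rewrite pairQC; apply: hv.
  by rewrite leNgt yv.
move=> hv b bB; move: v hv; apply: (cone_min (half_space_convex b)) => c cC.
by rewrite pairQC; apply: (proj1 (hC b) (cone_mem bB)).
Qed.

(** Convex combinations of total weight t: the slice at height t of the cone over the hull. At t = 0
    it is reduced to the origin. *)
Definition whull s (t : rat) x : Prop :=
  exists lam : 'I_(size s) -> rat, [/\ (forall i, 0 <= lam i),
    \sum_(i < size s) lam i = t & x = \sum_(i < size s) lam i *: s`_i].

Lemma whull0 s : whull s 0 0.
Proof.
exists (fun=> 0); split=> //; first by rewrite big1.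
by rewrite big1 // => i _; rewrite scale0r.
Qed.

Lemma whullD s t t' x x' : whull s t x -> whull s t' x' -> whull s (t + t') (x + x').
Proof.
move=> [c [c0 <- ->]] [d [d0 <- ->]]; exists (fun i => c i + d i); split.
- by move=> i; apply: addr_ge0.
- by rewrite big_split.
- by rewrite -big_split; apply: eq_bigr => i _; rewrite scalerDl.
Qed.

Lemma whullZ s r t x : 0 <= r -> whull s t x -> whull s (r * t) (r *: x).
Proof.
move=> r0 [c [c0 <- ->]]; exists (fun i => r * c i); split.
- by move=> i; apply: mulr_ge0.
- by rewrite mulr_sumr.
- by rewrite scaler_sumr; apply: eq_bigr => i _; rewrite scalerA.
Qed.

Lemma whull_mem s x : x \in s -> whull s 1 x.
Proof.
move=> xs; have hi : (index x s < size s)%N by rewrite index_mem.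
exists (fun i => (i == Ordinal hi)%:R); split.
- by move=> i; apply: ler0n.
- rewrite (bigD1 (Ordinal hi)) //= eqxx big1 ?addr0 // => i /negbTE -> //.
- rewrite (bigD1 (Ordinal hi)) //= eqxx scale1r nth_index // big1 ?addr0 //.
  by move=> i /negbTE ->; rewrite scale0r.
Qed.

Lemma whull_pair_ge s t x w (h : rat) : whull s t x ->
  (forall y, y \in s -> h <= pairQ w y) -> h * t <= pairQ w x.
Proof.
move=> [c [c0 <- ->]] hs; rewrite pairQC pairQ_suml mulr_sumr.
apply: ler_sum => i _; rewrite pairQZl mulrC; apply: ler_wpM2l => //.
by rewrite pairQC; apply: hs; apply: mem_nth.
Qed.

Lemma in_hullE s q : in_hull s q = whull s 1 q. Proof. by []. Qed.

End Cones.

(** * Polyhedra as slices at height one of cones *)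

Section Homogenize.
Variable n : nat.
Local Notation V := 'rV[rat]_n.
Local Notation W := 'rV[rat]_(n + 1).

Definition homogenize (v : V) (t : rat) : W := row_mx v t%:M.

Lemma homogenizeE (w : W) : exists v t, w = homogenize v t.
Proof.
exists (lsubmx w), (rsubmx w 0 0); rewrite -[LHS]hsubmxK /homogenize; congr row_mx.
by apply/matrixP => i j; rewrite !ord1 !mxE.
Qed.

Lemma homogenize_inj v t v' t' : homogenize v t = homogenize v' t' -> v = v' /\ t = t'.
Proof.
move=> /eq_row_mx [-> /matrixP /(_ 0 0)]; by rewrite !mxE.
Qed.

Lemma homogenizeD v t v' t' : homogenize v t + homogenize v' t' = homogenize (v + v') (t + t').
Proof.
rewrite /homogenize add_row_mx; congr row_mx.
by apply/matrixP => i j; rewrite !ord1 !mxE.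
Qed.

Lemma homogenizeZ r v t : r *: homogenize v t = homogenize (r *: v) (r * t).
Proof.
rewrite /homogenize scale_row_mx; congr row_mx.
by apply/matrixP => i j; rewrite !ord1 !mxE.
Qed.

Lemma homogenize0 : homogenize 0 0 = 0.
Proof.
rewrite /homogenize; apply/matrixP => i j; rewrite !mxE; case: split => k; by rewrite !mxE ?mul0rn.
Qed.

Lemma pair_homogenize u s v t : pairQ (homogenize u s) (homogenize v t) = pairQ u v + s * t.
Proof.
rewrite /pairQ big_split_ord big_ord1 /=; congr (_ + _).
  by apply: eq_bigr => i _; rewrite !row_mxEl.
by rewrite !row_mxEr !mxE.
Qed.

(** The cone over the polyhedron hull(s) + [sigma]; its slice at height 0 is the recession cone
    [sigma]. *)
Definition homogenize_poly (s : seq V) (sigma : V -> Prop) (w : W) : Prop :=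
  exists x c t, [/\ whull s t x, sigma c & w = homogenize (x + c) t].

Lemma homogenize_poly_convex s sigma : convex_cone sigma -> convex_cone (homogenize_poly s sigma).
Proof.
move=> [s0 sD sZ]; split.
- by exists 0, 0, 0; rewrite addr0 homogenize0; split=> //; apply: whull0.
- move=> _ _ [x [c [t [hx sc ->]]]] [x' [c' [t' [hx' sc' ->]]]].
  exists (x + x'), (c + c'), (t + t'); split; [exact: whullD|exact: sD|].
  by rewrite homogenizeD addrACA.
- move=> r _ r0 [x [c [t [hx sc ->]]]].
  exists (r *: x), (r *: c), (r * t); split; [exact: whullZ|exact: sZ|].
  by rewrite homogenizeZ scalerDr.
Qed.

(** The homogenized inequalities together with nonnegative height define a finitely generated cone.
    Generators of positive height, rescaled to height 1, span the polytope; those of height 0 lie in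
    the recession cone. The point [v0] makes the polytope nonempty. *)
Lemma polyhedron_decomposition (r : nat) (a : 'I_r -> V) (b : 'I_r -> rat) v0 :
  (forall i, b i <= pairQ (a i) v0) ->
  exists s : seq V, s != [::] /\ forall v, (forall i, b i <= pairQ (a i) v) <->
    exists q c, [/\ in_hull s q, (forall i, 0 <= pairQ (a i) c) & v = q + c].
Proof.
move=> hv0.
pose H := homogenize 0 1 :: [seq homogenize (a i) (- b i) | i <- enum 'I_r].
have [G hG] := dual_cone_fg H.
pose tt (w : W) := rsubmx w 0 0.
have tthom v t : tt (homogenize v t) = t by rewrite /tt /homogenize row_mxKr !mxE.
pose s := [seq (tt w)^-1 *: lsubmx w | w <- G & 0 < tt w].
pose sigma (c : V) := forall i, 0 <= pairQ (a i) c.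
have sig_conv : convex_cone sigma.
  split; first by move=> i; rewrite pairQ0r.
    by move=> u v hu hv i; rewrite pairQDr addr_ge0 // ?hu ?hv.
  by move=> t u t0 hu i; rewrite pairQZr mulr_ge0 // hu.
have inG v t : homogenize v t \in G -> 0 <= t /\ forall i, b i * t <= pairQ (a i) v.
  move=> /cone_mem /hG h; split.
    by have := h _ (mem_head _ _); rewrite pair_homogenize pairQ0l add0r mul1r.
  move=> i; have := h (homogenize (a i) (- b i)); rewrite pair_homogenize mulNr subr_ge0; apply.
  by rewrite inE; apply/orP; right; apply/mapP; exists i; rewrite ?mem_enum.
have dec v : (forall i, b i <= pairQ (a i) v) ->
    exists q c, [/\ in_hull s q, sigma c & v = q + c].
  move=> hv.
  have : cone G (homogenize v 1).
    apply/hG => w; rewrite inE => /orP [/eqP ->|/mapP [i _ ->]].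
      by rewrite pair_homogenize pairQ0l add0r mulr1.
    by rewrite pair_homogenize mulr1 subr_ge0.
  move/(cone_min (homogenize_poly_convex s sig_conv)) => [w wG|x [c [t [hx sc]]]].
    have [v' [t E]] := homogenizeE w; have := wG; rewrite E => /inG [].
    rewrite le_eqVlt => /orP [/eqP <-|t0] h.
      exists 0, v', 0; rewrite add0r; split=> //; first exact: whull0.
      by move=> i; have := h i; rewrite mulr0.
    exists v', 0, t; rewrite addr0; split=> //; last by case: sig_conv.
    have -> : v' = t *: (t^-1 *: v') by rewrite scalerA divff ?scale1r // gt_eqF.
    rewrite -{1}[t]mulr1; apply: whullZ (ltW t0) _; apply: whull_mem.
    apply/mapP; exists w; last by rewrite E tthom /homogenize row_mxKl.
    by rewrite mem_filter wG E tthom t0.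
  by move=> /homogenize_inj [-> tE]; exists x, c; split=> //; rewrite in_hullE tE.
exists s; split.
  apply/eqP => s0; have [q [c [[lam [_ h _]] _ _]]] := dec v0 hv0.
  by move: lam h; rewrite s0 => lam; rewrite big_ord0.
move=> v; split; first exact: dec.
move=> [q [c [hq sc ->]]] i; rewrite pairQDr.
have : b i * 1 <= pairQ (a i) q.
  apply: whull_pair_ge hq _ => _ /mapP [w + ->]; rewrite mem_filter => /andP [t0 wG].
  have [v' [t E]] := homogenizeE w; move: wG t0; rewrite E => /inG [_ h].
  rewrite tthom /homogenize row_mxKl pairQZr => t0.
  by rewrite mulrC ler_pdivlMr.
by have := sc i; lra.
Qed.

(** Farkas' lemma for the points at height 1 and the rays at height 0. The last coordinate c of the
    separating vector is a common offset: a.v + c < 0 <= a.x + c. *)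
Lemma polyhedron_separation (s : seq V) (sigma : V -> Prop) (G : seq V) v :
  (forall c, sigma c <-> cone G c) ->
  ~ (exists q c, [/\ in_hull s q, sigma c & v = q + c]) ->
  exists a, (forall c, sigma c -> 0 <= pairQ a c) /\
    forall x, x \in s -> pairQ a v < pairQ a x.
Proof.
move=> hG nv.
have sig_conv : convex_cone sigma.
  case: (cone_convex G) => C0 CD CZ; split; first exact/hG.
    by move=> x y /hG hx /hG hy; apply/hG; apply: CD.
  by move=> t x t0 /hG hx; apply/hG; apply: CZ.
case: (farkas ([seq homogenize x 1 | x <- s] ++ [seq homogenize g 0 | g <- G]) (homogenize v 1)).
  move/(cone_min (homogenize_poly_convex s sig_conv)) => [w|x [c [t [hx sc]]]].
    rewrite mem_cat => /orP [] /mapP [x xs ->].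
      exists x, 0, 1; rewrite addr0; split=> //; first exact: whull_mem.
      by case: sig_conv.
    exists 0, x, 0; rewrite add0r; split=> //; first exact: whull0.
    by apply/hG; apply: cone_mem.
  by move=> /homogenize_inj [vE tE]; case: nv; exists x, c; split=> //; rewrite in_hullE tE.
move=> [w [hw]]; have [a [c E]] := homogenizeE w; rewrite E pair_homogenize mul1r => av.
exists a; split=> [x /hG|x xs].
  move: x; apply: (cone_min (half_space_convex a)) => g gG.
  have := hw (homogenize g 0); rewrite E pair_homogenize mul0r addr0 pairQC; apply.
  by rewrite mem_cat; apply/orP; right; apply/mapP; exists g.
have : homogenize x 1 \in [seq homogenize x 1 | x <- s] ++ [seq homogenize g 0 | g <- G].
  by rewrite mem_cat; apply/orP; left; apply/mapP; exists x.
move=> /hw; rewrite E pair_homogenize mul1r (pairQC x).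
by rewrite (pairQC v) in av; lra.
Qed.

End Homogenize.

(** * Lemmas of Dickson and Gordan *)

(** Induction on the list of coordinates. Ignoring c gives a finite [G0], on which c is bounded by
    B. Elements with c at least B are dominated by [G0]; the others fall into the finitely many
    slices where c is constant, each handled by induction. *)
Lemma dickson (X : Type) (cs : seq (X -> nat)) (T : X -> Prop) :
  exists G : seq X, (forall x, List.In x G -> T x) /\
    forall x, T x -> exists g, List.In g G /\ forall c, List.In c cs -> (c g <= c x)%N.
Proof.
elim: cs T => [|c cs IH] T.
  case: (classic (exists x, T x)) => [[x Tx]|nT]; last by exists [::]; split=> // x Tx; case: nT; exists x.
  by exists [:: x]; split=> [y [<-|]//|y _]; exists x; split=> //; left.
have [G0 [G0T hG0]] := IH T.
have [B hB] : exists B, forall g, List.In g G0 -> (c g <= B)%N.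
  elim: G0 {G0T hG0} => [|g G0 [B hB]]; first by exists 0%N.
  exists (maxn (c g) B) => h [<-|/hB hh]; first exact: leq_maxl.
  exact: leq_trans hh (leq_maxr _ _).
have [G [GT hG]] : exists G, (forall x, List.In x G -> T x) /\
    forall x, T x -> (c x < B)%N ->
      exists g, List.In g G /\ forall d, List.In d (c :: cs) -> (d g <= d x)%N.
  elim: B {hB} => [|B [G [GT hG]]]; first by exists [::].
  have [G' [GT' hG']] := IH (fun x => T x /\ c x = B).
  exists (G ++ G'); split=> [x /In_cat [/GT //|/GT' []//]|x Tx].
  rewrite ltnS leq_eqVlt => /orP [/eqP cx|cx].
    have [g [gG' hg]] := hG' x (conj Tx cx); exists g; split.
      by apply/In_cat; right.
    by move=> d [<-|/hg //]; rewrite cx; case: (GT' g gG') => _ ->.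
  have [g [gG hg]] := hG x Tx cx; exists g; split=> //.
  by apply/In_cat; left.
exists (G0 ++ G); split=> [x /In_cat [/G0T|/GT]//|x Tx].
have [cx|cx] := ltnP (c x) B.
  have [g [gG hg]] := hG x Tx cx; exists g; split=> //.
  by apply/In_cat; right.
have [g [gG hg]] := hG0 x Tx; exists g; split.
  by apply/In_cat; left.
by move=> d [<-|/hg //]; apply: leq_trans (hB g gG) cx.
Qed.

(* Positive and negative parts of all the forms embed the solutions in some
   N^k so that x <= y implies that y - x is again a solution; the minimal
   nonzero solutions therefore generate. *)
Lemma gordan (X : zmodType) (cs ds : seq (X -> int)) :
  (forall c, List.In c cs -> forall x y, c (x + y) = c x + c y) ->
  (forall x, (forall c, List.In c cs -> c x = 0) -> x = 0) ->
  (forall d, List.In d ds -> List.In d cs) ->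
  exists G : seq X, (forall g, List.In g G -> forall d, List.In d ds -> 0 <= d g) /\
    forall Q : X -> Prop, Q 0 ->
      (forall g x, List.In g G -> (forall d, List.In d ds -> 0 <= d x) ->
         Q x -> Q (g + x)) ->
      forall x, (forall d, List.In d ds -> 0 <= d x) -> Q x.
Proof.
move=> cadd cinj dc.
pose pos (c : X -> int) x := absz (Num.max (c x) 0).
pose neg (c : X -> int) x := absz (Num.max (- c x) 0).
pose E x := forall d, List.In d ds -> 0 <= d x.
have [G [GT hG]] := dickson ([seq pos c | c <- cs] ++ [seq neg c | c <- cs])
   (fun x => E x /\ x <> 0).
exists G; split=> [g /GT []//|Q Q0 QD].
pose mu x := (\sum_(c <- cs) absz (c x))%N.
have mulP x k : (mu x <= k)%N -> E x -> Q x.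
  elim: k x => [|k IH] x.
    rewrite leqn0 => mx _; rewrite (cinj x) // => c.
    elim: cs {cadd cinj dc hG} @mu mx => //= c' cs IH; rewrite big_cons addn_eq0.
    move=> /andP [/eqP h1 h2] [<-|/(IH h2)//]; lia.
  move=> mx Ex; case: (classic (x = 0)) => [->//|x0].
  have [g [gG hg]] := hG x (conj Ex x0).
  have hc c : List.In c cs -> (0 <= c (x - g) <= c x) || (c x <= c (x - g) <= 0).
    move=> cin; have /(_ (pos c)) h1 := hg; have /(_ (neg c)) h2 := hg.
    have E1 := cadd c cin (x - g) g; rewrite subrK in E1.
    have {}h1 : (pos c g <= pos c x)%N.
      by apply: h1; apply/In_cat; left; apply: List.in_map.
    have {}h2 : (neg c g <= neg c x)%N.
      by apply: h2; apply/In_cat; right; apply: List.in_map.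
    move: h1 h2; rewrite /pos /neg; lia.
  have Exg : E (x - g).
    move=> d dd; have := hc d (dc d dd); have := Ex d dd; lia.
  rewrite -(subrK g x) addrC; apply: QD => //; apply: IH => //.
  have [_ g0] := GT g gG.
  have [c [cin cg]] : exists c, List.In c cs /\ c g <> 0.
    apply: NNPP => nc; apply: g0; apply: cinj => c cin.
    by apply: NNPP => cg; apply: nc; exists c.
  rewrite -ltnS; apply: leq_trans mx.
  have hlt : (absz (c (x - g)%R) < absz (c x))%N.
    have := hc c cin; have := cadd c cin (x - g) g; rewrite subrK; lia.
  have {cg} : forall cs', (forall c', List.In c' cs' -> List.In c' cs) ->
     List.In c cs' -> (\sum_(c <- cs') absz (c (x - g)%R) < \sum_(c <- cs') absz (c x))%N.
    have hle : forall cs', (forall c', List.In c' cs' -> List.In c' cs) ->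
       (\sum_(c <- cs') absz (c (x - g)%R) <= \sum_(c <- cs') absz (c x))%N.
      elim=> [|c' cs' IH'] hs; first by rewrite !big_nil.
      rewrite !big_cons; apply: leq_add.
        have := hc c' (hs _ (or_introl erefl)); lia.
      by apply: IH' => c'' h; apply: hs; right.
    elim=> [|c' cs' IH'] hs //=; rewrite !big_cons.
    have h1 := hc c' (hs _ (or_introl erefl)).
    have h2 : forall c', List.In c' cs' -> List.In c' cs by move=> c'' h; apply: hs; right.
    case=> [E1|/(IH' h2) h3].
      rewrite E1; have := hle _ h2; lia.
    lia.
  by apply.
by move=> x; apply: (mulP x (mu x)).
Qed.

(** * Complete integral closedness of polynomial rings *)

Section CompletelyIntegrallyClosed.

(** Complete integral closedness without fractions: if s (p/q)^k lies in R for all k, so does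
    p/q. *)
Definition cic (R : idomainType) : Prop := forall p q s : R, q != 0 -> s != 0 ->
  (forall k : nat, exists t, s * p ^+ k = t * q ^+ k) -> exists t, p = t * q.

Lemma cic_field (K : fieldType) : cic K.
Proof. by move=> p q s q0 _ _; exists (p / q); rewrite mulfVK. Qed.

(** After cancelling the gcd, q'^k divides s for every k, and degrees force q' to be constant. *)
Lemma cic_poly_field (K : fieldType) : cic {poly K}.
Proof.
move=> p q s q0 s0 h.
have pq0 : (p != 0) || (q != 0) by rewrite q0 orbT.
have cop := coprimep_div_gcd pq0; set g := gcdp p q in cop.
have g0 : g != 0 by rewrite gcdp_eq0 negb_and.
have Ep : p = p %/ g * g by rewrite divpK // dvdp_gcdl.
have Eq : q = q %/ g * g by rewrite divpK // dvdp_gcdr.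
set p' := p %/ g in cop Ep; set q' := q %/ g in cop Eq.
have q'0 : q' != 0 by apply: contraNneq q0 => q'0; rewrite Eq q'0 mul0r.
have hdvd k : q' ^+ k %| s.
  have [t Et] := h k.
  have cop' : coprimep (q' ^+ k) (p' ^+ k).
    by apply: coprimep_expl; apply: coprimep_expr; rewrite coprimep_sym.
  rewrite -(Gauss_dvdpl s cop'); apply/dvdpP; exists t.
  apply: (mulIf (expf_neq0 k g0)); rewrite -!mulrA -!exprMn -Ep -Eq; exact: Et.
have sq' : size q' = 1%N.
  have hs k : ((size q').-1 * k < size s)%N.
    have := dvdp_leq s0 (hdvd k); rewrite -size_exp; apply: leq_trans.
    by rewrite prednK // size_poly_gt0 expf_neq0.
  have := hs (size s); have : (0 < size q')%N by rewrite size_poly_gt0.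
  nia.
have [c c0 Ec] : exists2 c, c != 0 & q' = c%:P by apply/size_poly1P/eqP.
exists (c^-1 *: p'); rewrite {1}Ep Eq Ec -!mul_polyC.
have Ecc : c^-1%:P * c%:P = 1 :> {poly K} by rewrite -polyCM mulVf.
by rewrite mulrACA [_ * c%:P]mulrC mulrA [_ * (c^-1)%:P]mulrC Ecc mul1r.
Qed.

Lemma fraction_ex (R : idomainType) (x : {fraction R}) :
  exists a b : R, b != 0 /\ x = FracField.tofrac a / FracField.tofrac b.
Proof.
elim/quotW: x => x; exists (frac x).1, (frac x).2; split; first exact: denom_ratioP.
apply: (mulIf (_ : FracField.tofrac (frac x).2 != 0)).
  by rewrite tofrac_eq0 denom_ratioP.
rewrite mulfVK ?tofrac_eq0 ?denom_ratioP //; unlock FracField.tofrac.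
rewrite -[LHS]FracField.pi_mul; apply/eqmodP.
rewrite /= FracField.equivfE /FracField.mulf !numden_Ratio ?oner_neq0 ?mulr1 ?denom_ratioP //.
by rewrite mulrC.
Qed.

(** Over the fraction field the quotient T of p by q is a polynomial. Its leading coefficient
    satisfies the hypothesis of [cic] in R with the leading coefficient of s as denominator, so it
    lies in R. The leading term is subtracted and the degree drops. *)
Lemma cic_poly (R : idomainType) : cic R -> cic {poly R}.
Proof.
move=> cR p q s q0 s0 h.
pose f := map_poly (@FracField.tofrac R).
have finj : injective f by apply: map_inj_poly; [move=> x y /eqP; rewrite tofrac_eq => /eqP|rewrite tofrac0].
have f0 u : u != 0 -> f u != 0 by rewrite -(inj_eq finj) /f map_poly0.
have fM u w : f (u * w) = f u * f w by rewrite /f rmorphM.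
have fX u k : f (u ^+ k) = f u ^+ k by rewrite /f rmorphXn.
have fN1 : f (-1) = -1 by rewrite /f rmorphN1.
have [T ET] : exists T : {poly {fraction R}}, f p = T * f q.
  apply: (cic_poly_field (f0 q q0) (f0 s s0)) => k.
  by have [t Et] := h k; exists (f t); rewrite -!fX -!fM Et.
have hT k : exists t, f s * T ^+ k = f t.
  have [t Et] := h k; exists t.
  by apply: (mulIf (f0 _ (expf_neq0 k q0))); rewrite -fM -Et fM !fX -mulrA -exprMn -ET.
suff [t Et] : exists t, T = f t.
  by exists t; apply: finj; rewrite fM -Et.
have [m] := ubnP (size T); elim: m T hT {ET} => [|m IH] T hT; first by rewrite ltn0.
rewrite ltnS => sT; have [->|T0] := eqVneq T 0; first by exists 0; rewrite /f map_poly0.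
have [a [b [b0 Eab]]] := fraction_ex (lead_coef T).
have b0' : FracField.tofrac b != 0 by rewrite tofrac_eq0.
have [||c Ec] := cR a b (lead_coef s) b0.
- by rewrite lead_coef_eq0.
- move=> k; have [t Et] := hT k; exists (lead_coef t).
  apply/eqP; rewrite -tofrac_eq !tofracM !tofracXn; apply/eqP.
  have lf u : lead_coef (f u) = FracField.tofrac (lead_coef u).
    by rewrite /f lead_coef_map_inj //; move=> x y /eqP; rewrite tofrac_eq => /eqP.
  rewrite -!lf -Et lead_coefM lead_coef_exp Eab lf -mulrA -exprMn.
  by rewrite mulfVK.
have Ec' : lead_coef T = FracField.tofrac c by rewrite Eab Ec tofracM mulfK.
pose T1 := f (c *: 'X^((size T).-1)).
have ET1 : T1 = lead_coef T *: 'X^((size T).-1) by rewrite /T1 /f map_polyZ map_polyXn Ec'.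
have [||t Et] := IH (T - T1).
(* The hypothesis passes from T to T - T1: each binomial term is a multiple of s T^(k-i) by a power
   of T1, and T1 has coefficients in R. *)
- move=> k; rewrite exprBn mulr_sumr.
  have hj i : exists t, f s * ((-1) ^+ i * T ^+ (k - i) * T1 ^+ i *+ 'C(k, i)) = f t.
    have [t Et] := hT (k - i)%N.
    exists ((-1) ^+ i * t * (c *: 'X^((size T).-1)) ^+ i *+ 'C(k, i)).
    rewrite {2}/f rmorphMn /= -/f !fM !fX fN1 -/T1 -Et mulrnAr.
    by congr (_ *+ _); ring.
  have hj' i := constructive_indefinite_description _ (hj i).
  exists (\sum_(i < k.+1) sval (hj' i)); rewrite /f rmorph_sum /=.
  by apply: eq_bigr => i _; exact: (svalP (hj' i)).
- rewrite (leq_ltn_trans (n := (size T).-1)) //; last first.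
    by move: (size_poly_gt0 T); rewrite T0; lia.
  apply/leq_sizeP => j mj; rewrite coefB ET1 coefZ coefXn.
  have [E|nE] := eqVneq j (size T).-1; first by rewrite mulr1 E -lead_coefE subrr.
  rewrite mulr0 subr0 nth_default //.
  by move: mj; rewrite leq_eqVlt eq_sym (negbTE nE) => /(leq_trans (leqSpred _)).
- exists (t + c *: 'X^((size T).-1)); rewrite /f rmorphD /= -/f -Et.
  by rewrite -/T1 subrK.
Qed.

(** * Polynomials in n + 1 variables as polynomials in the last one *)

Section Muni.
Variables (n : nat) (K : idomainType).
Local Notation widen := (widen_ord (leqnSn n)).

Let mj (m : 'X_{1..n}) j : 'X_{1..n.+1} := (mnmwiden m + U_(ord_max) *+ j)%MM.

Let mj_widen m j : [multinom mj m j (widen i) | i < n] = m.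
Proof.
apply/mnmP => i; rewrite mnmE /mj mnmDE mnmwiden_widen mulmnE mnm1E.
by rewrite -val_eqE /= gtn_eqF // mul0n addn0.
Qed.

Let mj_max m j : mj m j ord_max = j.
Proof. by rewrite /mj mnmDE mnmwiden_ordmax mulmnE mnm1E eqxx mul1n. Qed.

Let mj_surj (m : 'X_{1..n.+1}) : m = mj [multinom m (widen i) | i < n] (m ord_max).
Proof.
apply/mnmP => i; have [->|ni] := eqVneq i ord_max; first by rewrite mj_max.
have hi : (i < n)%N by move: ni; rewrite -val_eqE /=; have := ltn_ord i; lia.
have -> : i = widen (Ordinal hi) by apply: val_inj.
have := mj_widen [multinom m (widen i) | i < n] (m ord_max).
by move=> /mnmP /(_ (Ordinal hi)); rewrite !mnmE => ->.
Qed.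

Lemma muni_coef (p : {mpoly K[n.+1]}) j m : (muni p)`_j@_m = p@_(mj m j).
Proof.
rewrite muniE coef_sum raddf_sum /= [in RHS](mpolyE p) raddf_sum /=.
apply: eq_bigr => m' _; rewrite coefZ coefXn mcoeffZ mcoeffX.
have -> : (m' == mj m j) = ([multinom m' (widen i) | i < n] == m) && (j == m' ord_max).
  apply/eqP/andP => [->|[/eqP <- /eqP ->]]; first by rewrite mj_widen mj_max !eqxx.
  exact: mj_surj.
case: (j == _); last by rewrite mulr0 mcoeff0 andbF mulr0.
by rewrite mulr1 mcoeffZ mcoeffX andbT.
Qed.

Lemma muni_inj : injective (@muni n K).
Proof.
move=> p q E; apply/mpolyP => m; rewrite (mj_surj m).
by rewrite -!muni_coef E.
Qed.

Lemma muni_surj (P : {poly {mpoly K[n]}}) : exists p, muni p = P.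
Proof.
exists (\sum_(j < size P) \sum_(m <- msupp P`_j) (P`_j)@_m *: 'X_[mj m j]).
rewrite -[RHS]coefK poly_def raddf_sum /=; apply: eq_bigr => j _.
rewrite [in RHS](mpolyE P`_j) scaler_suml raddf_sum /=; apply: eq_bigr => m _.
rewrite muniZ muniE msuppX big_seq1 mcoeffX eqxx scale1r mj_widen mj_max.
by rewrite scalerA mul_mpolyC.
Qed.

End Muni.

Lemma cic_transfer (R S : idomainType) (f : R -> S) :
  injective f -> (forall y, exists x, f x = y) -> f 0 = 0 -> f 1 = 1 ->
  {morph f : x y / x * y} -> cic S -> cic R.
Proof.
move=> finj fsurj f0 f1 fM cS p q s q0 s0 h.
have fn0 x : x != 0 -> f x != 0.
  by move=> x0; apply/eqP => E; move/eqP: x0; apply; apply: finj; rewrite E f0.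
have fX x k : f (x ^+ k) = f x ^+ k.
  by elim: k => [|k IH]; rewrite ?expr0 // !exprS fM IH.
have [k|t Et] := cS (f p) (f q) (f s) (fn0 q q0) (fn0 s s0).
  by have [t Et] := h k; exists (f t); rewrite -!fX -!fM Et.
have [t' Et'] := fsurj t; exists t'.
by apply: finj; rewrite Et -Et' fM.
Qed.

Lemma cic_mpoly (n : nat) (K : idomainType) : cic K -> cic {mpoly K[n]}.
Proof.
move=> cK; elim: n => [|n IH].
  apply: (@cic_transfer _ _ (fun p : {mpoly K[0]} => p@_0%MM)) cK.
  - by move=> p q E; rewrite (nvar0_mpolyC p) E -nvar0_mpolyC.
  - by move=> c; exists c%:MP; rewrite mcoeffC eqxx mulr1.
  - exact: mcoeff0.
  - by rewrite mcoeff1 eqxx.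
  - move=> p q; rewrite {1}(nvar0_mpolyC p) {1}(nvar0_mpolyC q) -mpolyCM.
    by rewrite mcoeffC eqxx mulr1.
apply: (@cic_transfer _ _ (@muni n K)) (cic_poly IH).
- exact: muni_inj.
- exact: muni_surj.
- exact: muni0.
- exact: muni1.
- exact: muniM.
Qed.

End CompletelyIntegrallyClosed.

(** * Graded subrings of the Laurent polynomial ring *)

Lemma divXK (F : fieldType) (a b : F) k : b != 0 -> a ^+ k = (a / b) ^+ k * b ^+ k.
Proof. by move=> b0; rewrite -exprMn divfK. Qed.

(** Coefficient i of the new equation is p_i c^(N-i), N the degree. Splitting off one factor c in
    each nonleading coefficient lets c act as a common denominator of the p_i. *)
Lemma scale_root (F : fieldType) (p : {poly F}) (c x : F) :
  p \is monic -> root p x -> exists q : {poly F}, [/\ q \is monic, root q (x * c),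
    forall i, (i < (size p).-1)%N -> q`_i = p`_i * c * c ^+ ((size p).-1 - i).-1,
    q`_(size p).-1 = 1 & forall i, (size p <= i)%N -> q`_i = 0].
Proof.
move=> pm rp; pose N := size p.
pose q : {poly F} := \poly_(i < N) (p`_i * c ^+ (N.-1 - i)).
have N0 : (0 < N)%N by rewrite size_poly_gt0 monic_neq0.
have pN : p`_N.-1 = 1 by apply/eqP; rewrite -monicE in pm *.
have N1 : (N.-1 < N)%N by rewrite ltn_predL.
have qN : q`_N.-1 = 1 by rewrite coef_poly N1 subnn pN mulr1.
have sq : size q = N.
  by rewrite size_poly_eq // subnn expr0 mulr1 pN oner_neq0.
exists q; split=> //.
- by rewrite monicE lead_coefE sq qN.
- rewrite /root horner_poly; apply/eqP.
  transitivity (c ^+ N.-1 * p.[x]); last by rewrite (rootP rp) mulr0.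
  rewrite horner_coef mulr_sumr; apply: eq_bigr => i _.
  have iN : (i <= N.-1)%N by have := ltn_ord i; rewrite -/N; lia.
  rewrite -{2}(subnK iN) exprD exprMn; ring.
- move=> i iN; rewrite coef_poly (ltn_trans iN N1) -mulrA -exprS -/N prednK //.
  by rewrite subn_gt0.
- by move=> i iN; rewrite coef_poly ltnNge iN.
Qed.

Section LaurentRing.
Variables (K : fieldType) (n : nat).
Local Notation L := (Lfield K n).
Local Notation chi := (@chi K n).
Local Notation emb := (@emb K n).
Local Notation poly := {mpoly K[n]}.
Local Notation M := 'rV[int]_n.
Implicit Types (m e : M) (a c : K) (x y : L) (P : poly) (u : 'X_{1..n}).

Definition poly_embed P : L := tofrac P.

Lemma poly_embedD P Q : poly_embed (P + Q) = poly_embed P + poly_embed Q. Proof. exact: tofracD. Qed.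
Lemma poly_embedN P : poly_embed (- P) = - poly_embed P. Proof. exact: tofracN. Qed.
Lemma poly_embedM P Q : poly_embed (P * Q) = poly_embed P * poly_embed Q. Proof. exact: tofracM. Qed.
Lemma poly_embed0 : poly_embed 0 = 0. Proof. exact: tofrac0. Qed.
Lemma poly_embed1 : poly_embed 1 = 1. Proof. exact: tofrac1. Qed.
Lemma poly_embedX P k : poly_embed (P ^+ k) = poly_embed P ^+ k. Proof. exact: tofracXn. Qed.
Lemma poly_embed_eq P Q : (poly_embed P == poly_embed Q) = (P == Q). Proof. exact: tofrac_eq. Qed.
Lemma poly_embed_inj : injective poly_embed.
Proof. by move=> P Q /eqP; rewrite poly_embed_eq => /eqP. Qed.
Lemma poly_embed_eq0 P : (poly_embed P == 0) = (P == 0). Proof. exact: tofrac_eq0. Qed.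
Lemma poly_embed_sum (I : Type) (r : seq I) (f : I -> poly) :
  poly_embed (\sum_(i <- r) f i) = \sum_(i <- r) poly_embed (f i).
Proof.
elim: r => [|i r IH]; first by rewrite !big_nil poly_embed0.
by rewrite !big_cons poly_embedD IH.
Qed.
Lemma embE a : emb a = poly_embed a%:MP. Proof. by []. Qed.
Lemma poly_embed_ex x : exists P Q, Q != 0 /\ x = poly_embed P / poly_embed Q.
Proof. exact: fraction_ex. Qed.

Lemma embD a c : emb (a + c) = emb a + emb c.
Proof. by rewrite !embE mpolyCD poly_embedD. Qed.
Lemma embN a : emb (- a) = - emb a.
Proof. by rewrite !embE mpolyCN poly_embedN. Qed.
Lemma embM a c : emb (a * c) = emb a * emb c.
Proof. by rewrite !embE mpolyCM poly_embedM. Qed.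
Lemma emb0 : emb 0 = 0. Proof. by rewrite embE mpolyC0 poly_embed0. Qed.
Lemma emb1 : emb 1 = 1. Proof. by rewrite embE mpolyC1 poly_embed1. Qed.
Lemma embX a k : emb (a ^+ k) = emb a ^+ k.
Proof. by elim: k => [|k IH]; rewrite ?expr0 ?emb1 // !exprS embM IH. Qed.
Lemma emb_eq0 a : (emb a == 0) = (a == 0).
Proof. by rewrite embE poly_embed_eq0 mpolyC_eq0. Qed.
Lemma emb_inj : injective emb.
Proof.
move=> a c E; apply/eqP; rewrite -subr_eq0 -emb_eq0 embD embN E subrr.
exact: eqxx.
Qed.
Lemma embV a : emb a^-1 = (emb a)^-1.
Proof.
have [->|a0] := eqVneq a 0; first by rewrite invr0 emb0 invr0.
apply: (mulfI (_ : emb a != 0)); first by rewrite emb_eq0.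
by rewrite -embM !divff ?emb1 // emb_eq0.
Qed.

Definition var (i : 'I_n) : L := poly_embed 'X_i.

Lemma chiE m : chi m = \prod_(i < n) var i ^ m 0 i. Proof. by []. Qed.

Lemma var_neq0 i : var i != 0.
Proof.
rewrite /var poly_embed_eq0; apply/eqP => /mpolyP /(_ U_(i)%MM).
by rewrite mcoeffX eqxx mcoeff0 => /eqP; rewrite oner_eq0.
Qed.

Lemma chi_neq0 m : chi m != 0.
Proof.
rewrite chiE; apply/prodf_neq0 => i _; apply: expfz_neq0; exact: var_neq0.
Qed.

Lemma chiD m m' : chi (m + m') = chi m * chi m'.
Proof.
rewrite !chiE -big_split; apply: eq_bigr => i _.
by rewrite mxE expfzDr // var_neq0.
Qed.

Lemma chi0 : chi 0 = 1.
Proof. by rewrite chiE big1 // => i _; rewrite mxE expr0z. Qed.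

Lemma chiN m : chi (- m) = (chi m)^-1.
Proof.
apply: (mulfI (chi_neq0 m)); rewrite -chiD subrr chi0 divff //; exact: chi_neq0.
Qed.

Lemma chiMn m k : chi (m *+ k) = chi m ^+ k.
Proof. by elim: k => [|k IH]; rewrite ?mulr0n ?chi0 // mulrS chiD IH exprS. Qed.

Definition mnm_row u : M := \row_i (u i)%:Z.
Definition row_mnm m : 'X_{1..n} := [multinom absz (m 0%R i) | i < n].

Lemma mnm_rowD u u' : mnm_row (u + u')%MM = mnm_row u + mnm_row u'.
Proof. by apply/rowP => i; rewrite !mxE mnmDE PoszD. Qed.

Lemma row_mnmK m : (forall i, 0 <= m 0 i) -> mnm_row (row_mnm m) = m.
Proof. by move=> h; apply/rowP => i; rewrite mxE mnmE; have := h i; lia. Qed.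

Lemma mnm_row0 : mnm_row 0%MM = 0.
Proof. by apply/rowP => i; rewrite !mxE mnm0E. Qed.

Lemma mnm_rowMn u k : mnm_row (u *+ k)%MM = mnm_row u *+ k.
Proof. 
elim: k => [|k IH]; first by rewrite mulm0n mnm_row0.
by rewrite mulmS mnm_rowD IH mulrS.
Qed.

Lemma poly_embed_mono u : poly_embed 'X_[u] = chi (mnm_row u).
Proof.
rewrite mpolyXE_id chiE.
have poly_embed_prod : forall (r : seq 'I_n) (f : 'I_n -> poly),
    poly_embed (\prod_(i <- r) f i) = \prod_(i <- r) poly_embed (f i).
  move=> r f; elim: r => [|i r IH]; first by rewrite !big_nil poly_embed1.
  by rewrite !big_cons poly_embedM IH.
rewrite poly_embed_prod; apply: eq_bigr => i _.
by rewrite poly_embedX mxE -exprnP.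
Qed.

Lemma poly_embed_term c u : poly_embed (c *: 'X_[u]) = emb c * chi (mnm_row u).
Proof. by rewrite -mul_mpolyC poly_embedM -poly_embed_mono -embE. Qed.

Definition shift (d : nat) : M := const_mx d%:Z.

Lemma shift_bound (s : seq M) : exists d, forall m, m \in s -> forall i, 0 <= (m + shift d) 0 i.
Proof.
elim: s => [|m s [d hd]]; first by exists 0%N.
exists (d + \sum_i absz (m 0%R i))%N => m'; rewrite inE => /orP [/eqP ->|ms] i.
  by rewrite !mxE (bigD1 i) //=; lia.
by have := hd m' ms i; rewrite !mxE; lia.
Qed.

(** A common monomial denominator reduces Laurent polynomials to polynomials, where leading
    monomials are available. *)
Lemma KM_rep x : KM x -> exists P e, x = poly_embed P * chi (- e).
Proof.
move=> [s [_ ->]]; elim: s => [|[m a] s [P [e IH]]].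
  by exists 0, 0; rewrite big_nil poly_embed0 mul0r.
rewrite big_cons /= IH.
have [d hd] := shift_bound [:: m + e; 0].
have h1 i : 0 <= (m + e + shift d) 0 i by apply: hd; rewrite inE eqxx.
have h2 i : 0 <= (0 + shift d) 0 i by apply: hd; rewrite !inE eqxx orbT.
exists (a *: 'X_[row_mnm (m + e + shift d)] + P * 'X_[row_mnm (0 + shift d)]), (e + shift d).
rewrite poly_embedD poly_embed_term poly_embedM poly_embed_mono !row_mnmK // mulrDl -!mulrA -!chiD.
congr (_ * chi _ + _ * chi _); apply/rowP => i; rewrite !mxE; ring.
Qed.

Section Graded.
Variable A : M -> K -> Prop.
Hypothesis A0 : forall m, A m 0.
Hypothesis AB : forall m a b, A m a -> A m b -> A m (a - b).

Let AN m a : A m a -> A m (- a).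
Proof. by move=> h; rewrite -sub0r; apply: AB. Qed.
Let AD m a b : A m a -> A m b -> A m (a + b).
Proof. by move=> ha hb; rewrite -[b]opprK; apply: AB => //; apply: AN. Qed.

(** A presentation of an element of [graded A] may repeat degrees and cancel. After clearing
    monomial denominators, comparing coefficients shows that each coefficient is a sum of presented
    ones of the same degree, so membership is decided coefficient by coefficient. *)
Lemma graded_rep P e : graded A (poly_embed P * chi (- e)) <->
  forall u, A (mnm_row u - e) P@_u.
Proof.
split; last first.
  move=> h; exists [seq (mnm_row u - e, P@_u) | u <- msupp P]; split.
    by move=> _ /mapP [u _ ->]; apply: h.
  rewrite {1}(mpolyE P) poly_embed_sum mulr_suml [RHS]big_map; apply: eq_bigr => u _ /=.
  by rewrite poly_embed_term chiD mulrA.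
move=> [s [hs E]] u.
have [d hd] := shift_bound (0 :: [seq p.1 + e | p <- s]).
have h0 i : 0 <= (0 + shift d) 0 i by apply: hd; rewrite inE eqxx.
have hp p : p \in s -> forall i, 0 <= (p.1 + e + shift d) 0 i.
  by move=> ps; apply: hd; rewrite inE; apply/orP; right; apply/mapP; exists p.
have EP : P * 'X_[row_mnm (0 + shift d)] = \sum_(p <- s) p.2 *: 'X_[row_mnm (p.1 + e + shift d)].
  apply: poly_embed_inj; rewrite poly_embedM poly_embed_mono row_mnmK // add0r poly_embed_sum.
  have -> : poly_embed P = poly_embed P * chi (- e) * chi e.
    by rewrite -mulrA -chiD addNr chi0 mulr1.
  rewrite E -mulrA -chiD mulr_suml !big_seq; apply: eq_bigr => p ps.
  by rewrite poly_embed_term row_mnmK; [rewrite -mulrA -chiD addrA|exact: hp].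
have Ec : P@_u = \sum_(p <- s) p.2 * (row_mnm (p.1 + e + shift d) == (row_mnm (0 + shift d) + u)%MM)%:R.
  rewrite -(mcoeffMX P (row_mnm (0 + shift d)) u) EP raddf_sum; apply: eq_bigr => p _ /=.
  by rewrite mcoeffZ mcoeffX.
rewrite Ec big_seq; elim/big_ind: _ => [|x y hx hy|p ps] //; first exact: AD.
case: eqP => [Eu|_]; last by rewrite mulr0.
rewrite mulr1; have := hs p ps; congr A.
have := congr1 mnm_row Eu; rewrite mnm_rowD (row_mnmK h0) (row_mnmK (hp p ps)) add0r.
move=> Ez; apply: (addIr e); apply: (addIr (shift d)).
by rewrite subrK Ez addrC.
Qed.

Lemma graded_term m a : graded A (emb a * chi m) <-> A m a.
Proof.
have := graded_rep a%:MP (- m); rewrite -embE opprK => ->; split.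
  by move=> /(_ 0%MM); rewrite mnm_row0 add0r mcoeffC eqxx mulr1.
move=> h u; rewrite mcoeffC; case: eqP => [->|_]; last by rewrite mulr0.
by rewrite mnm_row0 add0r mulr1.
Qed.

Lemma graded_sub_KM x : graded A x -> KM x.
Proof. by case=> s [_ ->]; exists s. Qed.

Lemma gradedB x y : graded A x -> graded A y -> graded A (x - y).
Proof.
move=> [s [hs ->]] [t [ht ->]].
exists (s ++ [seq (p.1, - p.2) | p <- t]); split.
  move=> p; rewrite mem_cat => /orP [/hs //|/mapP [q /ht h ->]] /=.
  exact: AN.
rewrite big_cat big_map /= -sumrN; congr (_ + _); apply: eq_bigr => p _.
by rewrite embN mulNr.
Qed.

Lemma gradedD x y : graded A x -> graded A y -> graded A (x + y).
Proof.
move=> hx hy; rewrite -[y]opprK; apply: gradedB => //.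
rewrite -sub0r; apply: gradedB => //; exists [::]; split=> //.
by rewrite big_nil.
Qed.

Hypothesis A1 : A 0 1.
Hypothesis AM : forall m m' a b, A m a -> A m' b -> A (m + m') (a * b).

Lemma graded_subring : subring (graded A).
Proof.
split.
- by exists [::]; split=> //; rewrite big_nil.
- by exists [:: (0, 1)]; split=> [p|]; [rewrite inE => /eqP ->|rewrite big_seq1 emb1 chi0 mulr1].
- exact: gradedB.
- move=> _ _ [s [hs ->]] [t [ht ->]].
  exists [seq (p.1 + q.1, p.2 * q.2) | p <- s, q <- t]; split.
    by move=> _ /allpairsP [[p q] /= [ps qt ->]]; apply: AM; [apply: hs|apply: ht].
  rewrite big_allpairs_dep mulr_suml; apply: eq_bigr => p _.
  rewrite mulr_sumr; apply: eq_bigr => q _ /=.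
  by rewrite embM chiD mulrACA.
Qed.

(* If [s x^k] lies in [A] for all [k], then so does its leading term
   [lt s (lt x)^k]; split off [lt x] and induct on the support of [x]. *)
Lemma graded_almost_integral :
  (forall m0 m1 c0 c1, c0 != 0 -> c1 != 0 ->
     (forall k, A (m0 + m1 *+ k) (c0 * c1 ^+ k)) -> A m1 c1) ->
  forall x s, KM x -> graded A s -> s != 0 ->
    (forall k, graded A (s * x ^+ k)) -> graded A x.
Proof.
move=> CC x s /KM_rep [P [e ->]] hs s0.
have [S [f Es]] := KM_rep (graded_sub_KM hs).
have S0 : S != 0 by apply: contraNneq s0 => S0; rewrite Es S0 poly_embed0 mul0r.
have [N] := ubnP (size (msupp P)); elim: N P => // N IH P sP hk.
have hsub := graded_subring.
have [->|P0] := eqVneq P 0; first by rewrite poly_embed0 mul0r; apply: subring0.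
pose m1 := mnm_row (mlead P) - e; pose c1 := mleadc P.
have c10 : c1 != 0 by rewrite mleadc_eq0.
have A1c : A m1 c1.
  apply: (CC (mnm_row (mlead S) - f) m1 (mleadc S)) => //; first by rewrite mleadc_eq0.
  move=> k; have := hk k.
  have -> : s * (poly_embed P * chi (- e)) ^+ k = poly_embed (S * P ^+ k) * chi (- (f + e *+ k)).
    rewrite Es exprMn poly_embedM poly_embedX -chiMn opprD chiD mulNrn; ring.
  move=> /graded_rep /(_ (mlead (S * P ^+ k))).
  have Pk0 : P ^+ k != 0 by apply: expf_neq0.
  rewrite mleadM // mleadcM mleadX // mleadcX; congr A.
  by rewrite mnm_rowD mnm_rowMn /m1 mulrnBl; apply/rowP => i; rewrite !mxE; ring.
pose t := emb c1 * chi m1.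
have At : graded A t by apply/graded_term.
have Ex : poly_embed P * chi (- e) = poly_embed (P - c1 *: 'X_[mlead P]) * chi (- e) + t.
  by rewrite poly_embedD poly_embedN poly_embed_term mulrBl -mulrA -chiD subrK.
rewrite Ex; apply: gradedD => //; apply: IH.
  have := perm_size (msupp_rem P (mlead P)).
  rewrite size_rem ?mlead_supp // => ->.
  have : (0 < size (msupp P))%N by rewrite lt0n size_eq0 msupp_eq0.
  by move: sP; case: (size _).
move=> k; have -> : poly_embed (P - c1 *: 'X_[mlead P]) * chi (- e) = poly_embed P * chi (- e) - t.
  by rewrite Ex addrK.
rewrite exprBn mulr_sumr; apply: (smod_sum (subring_smod hsub)) => i _.
rewrite -mulr_natr mulrA mulr_natr; apply: subringMn => //.
have -> : s * ((-1) ^+ i * (poly_embed P * chi (- e)) ^+ (k - i) * t ^+ i) =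
    (-1) ^+ i * t ^+ i * (s * (poly_embed P * chi (- e)) ^+ (k - i)) by ring.
do 2?[apply: subringM => //]; apply: subringX => //.
by apply: subringN => //; apply: subring1.
Qed.

End Graded.

Lemma KM_subring : subring (@KM K n).
Proof. exact: graded_subring. Qed.

Lemma KM_poly_embed P : KM (poly_embed P).
Proof.
have h : graded (fun _ _ => True) (poly_embed P * chi (- 0)) by apply/graded_rep.
by move: h; rewrite oppr0 chi0 mulr1.
Qed.

Lemma KM_chi m : KM (chi m).
Proof. by exists [:: (m, 1)]; split=> //; rewrite big_seq1 emb1 mul1r. Qed.

Lemma fracS_KM x : fracS (@KM K n) x.
Proof.
have [P [Q [Q0 ->]]] := poly_embed_ex x; exists (poly_embed P), (poly_embed Q).
by split; [exact: KM_poly_embed|exact: KM_poly_embed|rewrite poly_embed_eq0|].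
Qed.

Lemma fracS_full (S : L -> Prop) : subring S ->
  (forall a, fracS S (emb a)) -> (forall m, fracS S (chi m)) -> forall x, fracS S x.
Proof.
move=> hS he hc x; have hF := fracS_subring hS.
have hi P : fracS S (poly_embed P).
  rewrite (mpolyE P) poly_embed_sum; apply: (smod_sum (subring_smod hF)) => u _.
  by rewrite poly_embed_term; apply: subringM.
have [P [Q [Q0 ->]]] := poly_embed_ex x.
by apply: subringM => //; apply: fracSV.
Qed.

Lemma cic_mpoly_field P Q (S : poly) : Q != 0 -> S != 0 ->
  (forall k, exists T, S * P ^+ k = T * Q ^+ k) -> exists T, P = T * Q.
Proof. exact: (@cic_mpoly n K (@cic_field K)). Qed.

(** An integral P / Q is almost integral with denominator a power of Q, which is what [cic] asks
    for. *)
Lemma poly_embed_normal (p : {poly L}) x : p \is monic ->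
  (forall i, exists P, p`_i = poly_embed P) -> root p x -> exists P, x = poly_embed P.
Proof.
move=> pm hp rp; have [P [Q [Q0 E]]] := poly_embed_ex x.
have hS : subring (fun y => exists P, y = poly_embed P).
  split; [by exists 0; rewrite poly_embed0|by exists 1; rewrite poly_embed1| |].
    by move=> _ _ [P1 ->] [P2 ->]; exists (P1 - P2); rewrite poly_embedD poly_embedN.
  by move=> _ _ [P1 ->] [P2 ->]; exists (P1 * P2); rewrite poly_embedM.
have iQ0 : poly_embed Q != 0 by rewrite poly_embed_eq0.
rewrite E in rp; have h := integral_almost_integral hS pm hp (ex_intro _ P erefl)
  (ex_intro _ Q erefl) iQ0 rp.
set N := (size p).-1 in h.
have [||t Et] := @cic_mpoly_field P Q (Q ^+ N) Q0.
- exact: expf_neq0.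
- move=> k; have [T ET] := h k; exists T; apply: poly_embed_inj.
  rewrite !poly_embedM !poly_embedX -ET -mulrA; congr (_ * _).
  by rewrite (divXK _ _ iQ0).
- by exists t; rewrite E Et poly_embedM mulfK.
Qed.

(** Multiplying x by a large enough monomial turns its equation into one with polynomial
    coefficients, so the product is a polynomial. *)
Lemma KM_normal x : integral_over (@KM K n) x -> KM x.
Proof.
move=> [p [pm pK rp]].
pose N := size p.
have [d hd] : exists d : nat, forall i, (i < N)%N -> exists P, p`_i * chi (shift d) = poly_embed P.
  elim: N => [|k [d hd]]; first by exists 0%N.
  have [P [e E]] := KM_rep (pK k).
  have [d' hd'] := shift_bound [:: - e].
  exists (d + d')%N => i; rewrite ltnS leq_eqVlt => /orP [/eqP ->|ik].
    exists (P * 'X_[row_mnm (- e + shift (d + d'))]); rewrite poly_embedM poly_embed_mono row_mnmK.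
      by rewrite E -mulrA -chiD.
    by move=> j; have := hd' (- e) (mem_head _ _) j; rewrite !mxE; lia.
  have [P' E'] := hd i ik.
  exists (P' * 'X_[row_mnm (shift d')]); rewrite poly_embedM poly_embed_mono row_mnmK.
    rewrite -E' -mulrA -chiD; congr (_ * chi _).
    by apply/rowP => j; rewrite !mxE; lia.
  by move=> j; rewrite mxE; lia.
have [q [qm rq q1 q2 q3]] := scale_root (chi (shift d)) pm rp.
have [|P E] := poly_embed_normal qm _ rq.
  move=> i; case: (ltngtP i (size p).-1) => iN.
  - have [|P E] := hd i; first by apply: leq_trans iN (leq_pred _).
    exists (P * 'X_[row_mnm (shift d)] ^+ ((size p).-1 - i).-1).
    rewrite q1 // poly_embedM poly_embedX poly_embed_mono row_mnmK -?E // => j.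
    by rewrite mxE; lia.
  - exists 0; rewrite poly_embed0 q3 //; apply: leq_trans iN.
    exact: leqSpred.
  - by exists 1; rewrite iN q2 poly_embed1.
have -> : x = poly_embed P * chi (- shift d) by rewrite -E chiN mulfK // chi_neq0.
by apply: subringM; [exact: KM_subring|exact: KM_poly_embed|exact: KM_chi].
Qed.

Lemma graded_normal (A : M -> K -> Prop) :
  (forall m, A m 0) -> (forall m a b, A m a -> A m b -> A m (a - b)) -> A 0 1 ->
  (forall m m' a b, A m a -> A m' b -> A (m + m') (a * b)) ->
  (forall m0 m1 c0 c1, c0 != 0 -> c1 != 0 ->
     (forall k, A (m0 + m1 *+ k) (c0 * c1 ^+ k)) -> A m1 c1) ->
  normal (graded A).
Proof.
move=> A0 AB A1 AM CC _ [a [b [Aa Ab b0 ->]]] hint.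
have hS := graded_subring A0 AB A1 AM.
have hKM : KM (a / b).
  by apply: KM_normal; apply: integral_over_mono hint => x; apply: graded_sub_KM.
have [p [pm pA rp]] := hint.
have h := integral_almost_integral hS pm pA Aa Ab b0 rp.
apply: (graded_almost_integral A0 AB A1 AM CC hKM _ _ h); last exact: expf_neq0.
exact: subringX.
Qed.

End LaurentRing.

(** * Sections of polyhedral divisors *)

(** Orders are integers, so the rounding in [H0] disappears and the conditions become linear. *)
Lemma floor_addr_ge0 (k : int) (h : rat) :
  (0 <= k + Num.floor h) = (0 <= k%:~R + h).
Proof.
by rewrite addrC -{1}[k]opprK subr_ge0 floor_ge_int mulrNz -subr_ge0 opprK addrC.
Qed.

Section Divisors.
Variables (K : fieldType) (A0 : K -> Prop).
Hypothesis hA : dedekind A0.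
Hypothesis hK : forall x, fracS A0 x.
Variable n : nat.
Local Notation L := (Lfield K n).
Local Notation M := 'rV[int]_n.
Local Notation V := 'rV[rat]_n.
Local Notation Z := (closed_pt A0).
Implicit Types (sigma : V -> Prop) (D : Z -> V -> Prop) (m : M) (w : V) (z : Z).

Let hS : subring A0. Proof. by case: hA. Qed.
Local Notation ordfM := (ordfM hA hK).
Local Notation ordfD := (ordfD hA hK).

(* The polyhedra of [Df] may be empty, in which case [H0] imposes no condition
   at the point; hence the guard. *)
Definition attains_minima sigma D : Prop := forall z, (exists w, D z w) ->
  forall m, dualQ sigma (toQ m) -> exists h, is_min (D z) m h.

Definition sections sigma D m (g : K) : Prop :=
  g = 0 \/ dualQ sigma (toQ m) /\ forall z w, D z w -> 0 <= (ordf z g)%:~R + pair m w.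

Lemma compDE sigma D m g : attains_minima sigma D -> compD sigma D m g <-> sections sigma D m g.
Proof.
move=> hD; split.
  case=> [[hm [->|[g0 hg]]]|->]; [by left| |by left].
  right; split=> // z w Dw; have [h hh] := hD z (ex_intro _ w Dw) m hm.
  have := hg z (ordf z g) h; rewrite floor_addr_ge0 => /(_ _ hh) h1.
  have /h1 : ord z g (ordf z g) by apply/(ordfP hA hK).
  by case: hh => _ /(_ w Dw); lra.
have [->|g0] := eqVneq g 0; first by move=> _; right.
case=> [E|[hm hg]]; first by rewrite E eqxx in g0.
left; split=> //; right; split=> // z k h /(ordfP hA hK _ _ g0) -> [[w [Dw <-]] _].
by rewrite floor_addr_ge0; apply: hg.
Qed.

Lemma compD_eq sigma D : attains_minima sigma D -> compD sigma D = sections sigma D.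
Proof.
move=> hD; apply: functional_extensionality => m; apply: functional_extensionality => g.
by apply: propositional_extensionality; apply: compDE.
Qed.

Lemma val_smod z (r : rat) : smod A0 (fun g => g = 0 \/ 0 <= (ordf z g)%:~R + r).
Proof.
split; first by left.
  move=> x y [->|hx] [->|hy]; rewrite ?addr0 ?add0r; [by left|by right|by right|].
  have [xy0|xy0] := eqVneq (x + y) 0; first by left.
  have [x0|x0] := eqVneq x 0; first by right; rewrite x0 add0r.
  have [y0|y0] := eqVneq y 0; first by right; rewrite y0 addr0.
  right; have := ordfD z x0 y0 xy0; rewrite ge_min => /orP [] h.
    by move: hx; rewrite -(ler_int rat) in h; lra.
  by move: hy; rewrite -(ler_int rat) in h; lra.
move=> c x Ac [->|hx]; first by rewrite mulr0; left.
have [->|c0] := eqVneq c 0; first by rewrite mul0r; left.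
have [->|x0] := eqVneq x 0; first by rewrite mulr0; left.
right; rewrite ordfM // intrD; have := ordf_ge0 hA hK z c0 Ac.
by rewrite -(ler_int rat); lra.
Qed.

Section Sections.
Variables (sigma : V -> Prop) (D : Z -> V -> Prop).
Local Notation S := (sections sigma D).

Lemma sectionsE m g : dualQ sigma (toQ m) -> S m g <->
  forall z w, D z w -> g = 0 \/ 0 <= (ordf z g)%:~R + pair m w.
Proof.
move=> hm; split=> [[-> z w _|[_ h] z w Dw]|h]; [by left|by right; apply: h|].
have [->|g0] := eqVneq g 0; first by left.
by right; split=> // z w /(h z w) [E|//]; rewrite E eqxx in g0.
Qed.

Lemma sections_dual m g : S m g -> g != 0 -> dualQ sigma (toQ m).
Proof. by case=> [->|[]//]; rewrite eqxx. Qed.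

Lemma sections0 m : S m 0. Proof. by left. Qed.

Lemma sections_smod m : smod A0 (S m).
Proof.
split; first exact: sections0.
- move=> a b ha hb.
  have [a0|a0] := eqVneq a 0; first by rewrite a0 add0r.
  have hm := sections_dual ha a0.
  apply/(sectionsE _ hm) => z w Dw.
  case: (val_smod z (pair m w)) => _ + _; apply; first exact: (proj1 (sectionsE a hm)).
  exact: (proj1 (sectionsE b hm)).
- move=> r a Ar ha.
  have [a0|a0] := eqVneq a 0; first by rewrite a0 mulr0; left.
  have hm := sections_dual ha a0.
  apply/(sectionsE _ hm) => z w Dw.
  case: (val_smod z (pair m w)) => _ _; apply=> //; exact: (proj1 (sectionsE a hm)).
Qed.

Lemma sectionsB m a b : S m a -> S m b -> S m (a - b).
Proof. exact: (smodB hS (sections_smod m)). Qed.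

Lemma sectionsM m m' a b : S m a -> S m' b -> S (m + m') (a * b).
Proof.
case=> [->|[hm ha]]; first by rewrite mul0r; left.
case=> [->|[hm' hb]]; first by rewrite mulr0; left.
have [->|a0] := eqVneq a 0; first by rewrite mul0r; left.
have [->|b0] := eqVneq b 0; first by rewrite mulr0; left.
right; split=> [w sw|z w Dw].
  by rewrite toQD pairQDl addr_ge0 // ?hm ?hm'.
by rewrite ordfM // intrD pairD; have := ha z w Dw; have := hb z w Dw; lra.
Qed.

Lemma dualQ0 : dualQ sigma (toQ (0 : M)).
Proof. by move=> w _; rewrite toQ0 pairQ0l. Qed.

Lemma sections_deg0 a : A0 a -> S 0 a.
Proof.
move=> Aa; have [->|a0] := eqVneq a 0; first by left.
right; split=> [|z w _]; first exact: dualQ0.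
by rewrite pair0 addr0 ler0z; apply: (ordf_ge0 hA hK).
Qed.

Lemma archi_ge0 (a b : rat) : (forall k : nat, 0 <= a + k%:R * b) -> 0 <= b.
Proof.
move=> h; rewrite leNgt; apply/negP => b0.
have := h (Num.truncn (a / - b)).+1.
have : a / - b < (Num.truncn (a / - b)).+1%:R by exact: truncnS_gt.
rewrite ltr_pdivrMr ?oppr_gt0 //; lra.
Qed.

(** Each hypothesis is an inequality affine in k whose slope is the quantity to be bounded. *)
Lemma sections_root m0 m1 c0 c1 : c0 != 0 -> c1 != 0 ->
  (forall k, S (m0 + m1 *+ k) (c0 * c1 ^+ k)) -> S m1 c1.
Proof.
move=> c00 c10 h.
have hk k : dualQ sigma (toQ (m0 + m1 *+ k)) /\ forall z w, D z w ->
   0 <= (ordf z (c0 * c1 ^+ k))%:~R + pair (m0 + m1 *+ k) w.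
  have := h k; case=> // /eqP; rewrite mulf_eq0 (negbTE c00) expf_eq0.
  by rewrite (negbTE c10) andbF.
right; split=> [w sw|z w Dw].
  apply: (@archi_ge0 (pairQ (toQ m0) w)) => k.
  by have [/(_ w sw) + _] := hk k; rewrite toQD toQMn pairQDl pairQZl.
apply: (@archi_ge0 ((ordf z c0)%:~R + pair m0 w)) => k.
have [_ /(_ z w Dw)] := hk k.
rewrite ordfM ?expf_neq0 // (ordfX hA hK) // pairD pairMn intrD rmorphMn /= -mulr_natl.
lra.
Qed.

Lemma sections_graded_subring : subring (@graded K n S).
Proof.
apply: graded_subring; [exact: sections0|exact: sectionsB| |exact: sectionsM].
by apply: sections_deg0; apply: subring1.
Qed.

Lemma sections_normal : normal (@graded K n S).
Proof.
apply: graded_normal; [exact: sections0|exact: sectionsB| |exact: sectionsM|].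
  by apply: sections_deg0; apply: subring1.
exact: sections_root.
Qed.

End Sections.

Lemma A0D_sections sigma D : attains_minima sigma D -> @A0D K A0 n sigma D = graded (sections sigma D).
Proof. by move=> hD; rewrite /A0D compD_eq. Qed.

Lemma minimum_in (s : seq V) m : s != [::] -> exists2 x, x \in s &
  forall y, y \in s -> pair m x <= pair m y.
Proof.
elim: s => // a [|b s] IH _.
  by exists a; rewrite ?mem_head // => y; rewrite inE => /eqP ->.
have [//|x xs hx] := IH.
case: (lerP (pair m a) (pair m x)) => h.
  exists a; first exact: mem_head.
  move=> y; rewrite inE => /orP [/eqP ->//|/hx]; exact: le_trans.
exists x; first by rewrite inE xs orbT.
by move=> y; rewrite inE => /orP [/eqP ->|/hx //]; apply: ltW.
Qed.

Lemma pol_sigma_min sigma (Delta : V -> Prop) m : sigma 0 -> pol_sigma sigma Delta ->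
  dualQ sigma (toQ m) -> exists h, is_min Delta m h.
Proof.
move=> s0 [s [sn hs]] hm; have [x xs hx] := minimum_in m sn.
exists (pair m x); split.
  exists x; split=> //; apply/hs; exists x, 0; rewrite addr0; split=> //.
  exact: whull_mem.
move=> w /hs [q [c [hq sc ->]]]; rewrite /pair pairQDr.
have := hm c sc; have := whull_pair_ge hq hx; rewrite mulr1 /pair; lra.
Qed.

Lemma polyhedral_cone0 sigma : polyhedral_cone sigma -> sigma 0.
Proof. by case=> G hG; apply/hG/cone_genE; case: (cone_convex G). Qed.

Lemma polyhedral_divisor_minima sigma D : polyhedral_cone sigma ->
  polyhedral_divisor sigma D -> attains_minima sigma D.
Proof.
move=> hs [hD _] z _ m hm; apply: pol_sigma_min (hD z) hm.
exact: polyhedral_cone0.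
Qed.

Lemma min_unique (Delta : V -> Prop) m h h' :
  is_min Delta m h -> is_min Delta m h' -> h = h'.
Proof.
move=> [[x [Dx <-]] hx] [[y [Dy <-]] hy]; apply/eqP.
by rewrite eq_le hx ?hy.
Qed.

(** Injectivity lets each listed point carry its own coordinate of an integer vector. *)
Lemma finite_pts_enum (Q : Z -> Prop) : finite_pts Q <-> exists k (zs : 'I_k -> Z), injective zs /\
  forall z, Q z -> exists i, z = zs i.
Proof.
split; last first.
  move=> [k [zs [_ h]]]; exists [seq zs i | i <- enum 'I_k] => z /h [i ->].
  by apply: List.in_map; apply/In_mem; rewrite mem_enum.
move=> [l hl].
have [k [zs [zi hz]]] : exists k (zs : 'I_k -> Z), injective zs /\
    forall z, List.In z l -> exists i, z = zs i.
  elim: l {hl} => [|z l [k [zs [zi hz]]]].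
    exists 0%N, (fun i : 'I_0 => False_rect Z (notF (ltn_ord i))).
    by split=> [[]|].
  case: (classic (exists i, z = zs i)) => [hzi|nz].
    by exists k, zs; split=> // y [<-|/hz].
  exists k.+1, (fun i => oapp zs z (unlift ord0 i)); split.
    move=> i j; case: unliftP => [i' ->|->]; case: unliftP => [j' ->|->] //=.
    - by move=> /zi ->.
    - by move=> E; case: nz; exists i'.
    - by move=> E; case: nz; exists j'.
  move=> y [<-|/hz [i ->]]; first by exists ord0; rewrite unlift_none.
  by exists (lift ord0 i); rewrite liftK.
by exists k, zs; split=> // z /hl /hz.
Qed.

Lemma divisor_support sigma D : polyhedral_divisor sigma D ->
  finite_pts (fun z => ~ forall w, D z w <-> sigma w).
Proof.
move=> [_ [k [zs h]]]; exists [seq zs i | i <- enum 'I_k] => z hz.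
have [i ->] : exists i, z = zs i.
  by apply: NNPP => nz; apply: hz; apply: h => i zi; apply: nz; exists i.
by apply: List.in_map; apply/In_mem; rewrite mem_enum.
Qed.

(* The divisor [- floor (D m)] has finite support, so some section attains
   it at any prescribed point. *)
Lemma section_exact sigma D m z0 : polyhedral_cone sigma -> polyhedral_divisor sigma D ->
  dualQ sigma (toQ m) -> exists g, [/\ g != 0, sections sigma D m g &
    forall h, is_min (D z0) m h -> ordf z0 g = - Num.floor h].
Proof.
move=> hs hD hm; have hreg := polyhedral_divisor_minima hs hD.
have hne z : exists w, D z w.
  case: hD => /(_ z) [s [sn h]] _; case: s sn h => // x s _ h.
  exists x; apply/h; exists x, 0; rewrite addr0; split=> //.
    by apply: whull_mem; apply: mem_head.
  exact: polyhedral_cone0.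
pose mn z := sval (constructive_indefinite_description _ (hreg z (hne z) m hm)).
have hmn z : is_min (D z) m (mn z) by exact: svalP.
have [|g [g0 vg hg]] := @exists_exact_order _ _ hA hK (fun z => - Num.floor (mn z)) z0.
  apply: finite_pts_sub (divisor_support hD) => z nz hz; apply: nz.
  suff -> : mn z = 0 by rewrite floor0 oppr0.
  apply: min_unique (hmn z) _; split.
    by exists 0; split; [apply/hz; exact: polyhedral_cone0|rewrite /pair pairQ0r].
  by move=> w /hz /hm.
exists g; split=> //; last by move=> h hh; rewrite vg (min_unique hh (hmn z0)).
right; split=> // z w Dw; have [_ /(_ w Dw) h1] := hmn z.
have := hg z; rewrite -(ler_int rat) mulrNz; have := floor_le (mn z); lra.
Qed.

End Divisors.

Definition decide (P : Prop) : bool := excluded_middle_informative P.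

Lemma decideP (P : Prop) : reflect P (decide P).
Proof. by rewrite /decide; case: excluded_middle_informative => h; constructor. Qed.

Lemma noetherian_image (F F' : fieldType) (phi : F -> F') (S : F -> Prop) :
  phi 0 = 0 -> phi 1 = 1 -> {morph phi : x y / x - y} -> {morph phi : x y / x * y} ->
  injective phi -> subring S -> noetherian S ->
  subring (fun y => exists a, S a /\ y = phi a) /\
  noetherian (fun y => exists a, S a /\ y = phi a).
Proof.
move=> phi0 phi1 phiB phiM phi_inj hS nS.
have phiD : {morph phi : x y / x + y}.
  by move=> x y; rewrite -[y in LHS]opprK -[- y]sub0r !phiB phi0 sub0r opprK.
have hS' : subring (fun y => exists a, S a /\ y = phi a).
  split.
  - by exists 0; rewrite phi0; split=> //; apply: subring0.
  - by exists 1; rewrite phi1; split=> //; apply: subring1.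
  - move=> _ _ [a [Sa ->]] [b [Sb ->]]; exists (a - b).
    by rewrite phiB; split=> //; apply: subringB.
  - move=> _ _ [a [Sa ->]] [b [Sb ->]]; exists (a * b).
    by rewrite phiM; split=> //; apply: subringM.
split=> // I hI; case: (hI) => IS I0 ID IM.
have hJ : ideal S (fun a => S a /\ I (phi a)).
  split.
  - by move=> a [].
  - by rewrite phi0; split=> //; apply: subring0.
  - by move=> a b [Sa Ia] [Sb Ib]; rewrite phiD; split; [exact: subringD|exact: ID].
  - move=> r a Sr [Sa Ia]; rewrite phiM; split; first exact: subringM.
    by apply: IM => //; exists r.
have [s [hs1 hs2]] := fin_gen_span hJ (nS _ hJ).
apply: (@span_fin_gen _ _ I [seq phi a | a <- s]) => //.
  by move=> _ /mapP [a /hs1 [_ Ia] ->].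
move=> N [N0 ND NM] hN x Ix; have [a [Sa E]] := IS x Ix.
rewrite E; apply: (hs2 (fun a => N (phi a))); last by rewrite -E.
- split; first by rewrite phi0.
    by move=> b c Nb Nc; rewrite phiD; apply: ND.
  by move=> r b Sr Nb; rewrite phiM; apply: NM => //; exists r.
- by move=> b bs; apply: hN; apply/mapP; exists b.
Qed.

(** B is pinned down by minimality, so that it can be identified both with [gen_ring] and with a
    ring of sections. *)
Lemma noetherian_adjoin_seq (F : fieldType) (S : F -> Prop) (s : seq F) :
  subring S -> noetherian S -> exists B : F -> Prop,
    [/\ subring B, noetherian B, (forall x, S x -> B x), (forall x, x \in s -> B x) &
        forall N, subring N -> (forall x, S x -> N x) -> (forall x, x \in s -> N x) ->
          forall x, B x -> N x].
Proof.
move=> hS nS; elim: s => [|a s [B [hB nB SB sB Bmin]]].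
  by exists S; split=> // N _ SN _ x /SN.
exists (adjoin B a); split.
- exact: adjoin_subring.
- exact: hilbert_basis.
- by move=> x /SB; apply: adjoin_sub.
- move=> x; rewrite inE => /orP [/eqP ->|/sB]; first exact: adjoin_gen.
  exact: adjoin_sub.
- move=> N hN SN sN; apply: adjoin_min => //; last by apply: sN; apply: mem_head.
  by apply: Bmin => // x xs; apply: sN; rewrite inE xs orbT.
Qed.

Definition ipair (n : nat) (m m' : 'rV[int]_n) : int := \sum_i m 0 i * m' 0 i.

Lemma ipairD n (m1 m2 m' : 'rV[int]_n) : ipair (m1 + m2) m' = ipair m1 m' + ipair m2 m'.
Proof. by rewrite -big_split; apply: eq_bigr => i _; rewrite mxE mulrDl. Qed.

Lemma ipairE n (m m' : 'rV[int]_n) : (ipair m m')%:~R = pairQ (toQ m) (toQ m').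
Proof. by rewrite rmorph_sum; apply: eq_bigr => i _ /=; rewrite !mxE rmorphM. Qed.

(** * Finite generation and fraction field of the ring of sections *)

Section FiniteGeneration.
Variables (K : fieldType) (A0 : K -> Prop).
Hypothesis hA : dedekind A0.
Hypothesis hK : forall x, fracS A0 x.
Variable n : nat.
Local Notation L := (Lfield K n).
Local Notation M := 'rV[int]_n.
Local Notation V := 'rV[rat]_n.
Local Notation Z := (closed_pt A0).
Local Notation emb := (@emb K n).
Local Notation chi := (@chi K n).
Implicit Types (m : M) (w : V) (z : Z).

Let hS : subring A0. Proof. by case: hA. Qed.

Definition emb_ring (y : L) : Prop := exists a, A0 a /\ y = emb a.

Lemma emb_ring_noetherian : subring emb_ring /\ noetherian emb_ring.
Proof.
apply: (@noetherian_image _ _ emb).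
- exact: emb0.
- exact: emb1.
- by move=> x y; rewrite embD embN.
- exact: embM.
- exact: emb_inj.
- exact: hS.
- by case: hA.
Qed.

Section Divisor.
Variables (sigma : V -> Prop) (D : Z -> V -> Prop).
Hypothesis hsigma : polyhedral_cone sigma.
Hypothesis hD : polyhedral_divisor sigma D.
Local Notation S := (sections sigma D).

Section Support.
Variables (G : seq V) (k : nat) (zs : 'I_k -> Z) (s : 'I_k -> seq V).
Hypothesis hG : forall c, sigma c <-> cone G c.
Hypothesis zs_inj : injective zs.
Hypothesis hzs : forall z, (forall i, z <> zs i) -> forall w, D z w <-> sigma w.
Hypothesis hs : forall i w, D (zs i) w <->
  exists q c, [/\ in_hull (s i) q, sigma c & w = q + c].

Let E := 'rV[int]_k.
Implicit Types e : E.

Definition bounds e z : int := \sum_(j | decide (z = zs j)) e 0 j.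

Lemma bounds_at e j : bounds e (zs j) = e 0 j.
Proof.
rewrite /bounds (bigD1 j) /=; last exact/decideP.
rewrite big1 ?addr0 // => i /andP [/decideP /zs_inj ->].
by rewrite eqxx.
Qed.

Lemma bounds_out e z : (forall j, z <> zs j) -> bounds e z = 0.
Proof. by move=> h; rewrite /bounds big1 // => j /decideP /h. Qed.

Lemma boundsD e e' z : bounds (e + e') z = bounds e z + bounds e' z.
Proof. by rewrite -big_split; apply: eq_bigr => j _; rewrite mxE. Qed.

Lemma bounds_fin e : finite_pts (fun z => bounds e z <> 0).
Proof.
apply/finite_pts_enum; exists k, zs; split=> // z hz; apply: NNPP => nz; apply: hz.
by apply: bounds_out => j zj; apply: nz; exists j.
Qed.

(** The pairs (m, e) for which every function of order at least e is a section of degree m. Testing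
    the vertices [s j] suffices, because m is nonnegative on the recession cone; the pairs are thus
    the lattice points of a rational polyhedral cone, and every nonzero section occurs for some
    e. *)
Definition admissible (x : M * E) : Prop := dualQ sigma (toQ x.1) /\
  forall j w, w \in s j -> 0 <= (x.2 0 j)%:~R + pair x.1 w.

Lemma admissible_sections m e x : admissible (m, e) -> above (bounds e) x -> S m x.
Proof.
move=> [/= hm he] [->|hx]; first by left.
right; split=> // z w Dw.
case: (classic (exists j, z = zs j)) => [[j zj]|nz].
  subst z; have [q [c [hq sc ->]]] := proj1 (hs j w) Dw.
  rewrite /pair pairQDr; have := hm c sc.
  have := hx (zs j); rewrite bounds_at -(ler_int rat).
  have : - (e 0 j)%:~R * 1 <= pairQ (toQ m) q.
    by apply: whull_pair_ge hq _ => y ys; have := he j y ys; rewrite /pair; lra.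
  lra.
have nz' j : z <> zs j by move=> zj; apply: nz; exists j.
have := hx z; rewrite bounds_out // -(ler_int rat).
by move: Dw => /(hzs nz') /hm; rewrite /pair; lra.
Qed.

Lemma sections_admissible m x : S m x -> x != 0 ->
  exists e, admissible (m, e) /\ above (bounds e) x.
Proof.
case=> [->|[hm hx]] x0; first by rewrite eqxx in x0.
pose e : E := \row_j ordf (zs j) x.
exists e; split.
  split=> // j w ws /=; rewrite mxE; apply: hx; apply/hs; exists w, 0.
  by rewrite addr0; split=> //; [exact: whull_mem|exact: polyhedral_cone0].
right=> z; case: (classic (exists j, z = zs j)) => [[j ->]|nz].
  by rewrite bounds_at mxE.
have nz' j : z <> zs j by move=> zj; apply: nz; exists j.
rewrite bounds_out // -(ler_int rat) -[leRHS]addr0 -(pairQ0r (toQ m)).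
by apply: hx; apply/(hzs nz'); apply: polyhedral_cone0.
Qed.

(** Gordan's lemma needs integral forms, hence the denominators [den]: [fs] and [fd] are positive
    multiples of the defining inequalities. The coordinate forms [cM] and [cE] are added so that the
    forms jointly separate points. *)
Lemma admissible_ind : exists T : seq (M * E), (forall x, List.In x T -> admissible x) /\
  forall Q : M * E -> Prop, Q 0 ->
    (forall x y, List.In x T -> admissible y -> Q y -> Q (x + y)) ->
    forall x, admissible x -> Q x.
Proof.
have hd w : {p : nat * M | (0 < p.1)%N /\ toQ p.2 = p.1%:R *: w}.
  apply: constructive_indefinite_description.
  by have [d d0 [m hm]] := clear_denom_row w; exists (d, m).
pose den w := (sval (hd w)).1; pose num w := (sval (hd w)).2.
have den0 w : 0 < (den w)%:R :> rat by rewrite ltr0n; case: (svalP (hd w)).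
have numE m w : (ipair m (num w))%:~R = (den w)%:R * pair m w.
  by rewrite ipairE; case: (svalP (hd w)) => _ ->; rewrite pairQZr.
pose fs w (x : M * E) := ipair x.1 (num w).
pose fd j w (x : M * E) := (den w)%:Z * x.2 0 j + ipair x.1 (num w).
pose ds := List.map fs G ++ List.flat_map (fun j => List.map (fd j) (s j)) (enum 'I_k).
pose cM := List.map (fun i (x : M * E) => x.1 0 i) (enum 'I_n).
pose cE := List.map (fun i (x : M * E) => x.2 0 i) (enum 'I_k).
have hEx x : (forall d, List.In d ds -> 0 <= d x) <-> admissible x.
  split.
    move=> h; split.
      move=> c /hG; move: c; apply: (cone_min (half_space_convex _)) => g gG.
      have : 0 <= fs g x.
        by apply: h; apply/In_cat; left; apply: List.in_map; apply/In_mem.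
      by rewrite -(ler_int rat) numE pmulr_rge0.
    move=> j w ws; have : 0 <= fd j w x.
      apply: h; apply/In_cat; right; apply/List.in_flat_map; exists j.
      split; first by apply/In_mem; rewrite mem_enum.
      by apply: List.in_map; apply/In_mem.
    rewrite -(ler_int rat) intrD intrM numE -mulrDr pmulr_rge0 //; exact: den0.
  move=> [h1 h2] d /In_cat [/List.in_map_iff [w [<- /In_mem wG]]|].
    rewrite -(ler_int rat) numE pmulr_rge0 //; apply: h1; apply/hG.
    exact: cone_mem.
  move=> /List.in_flat_map [j [_ /List.in_map_iff [w [<- /In_mem ws]]]].
  rewrite -(ler_int rat) intrD intrM numE -mulrDr pmulr_rge0 ?h2 //; exact: den0.
have [|||T [hT hind]] := @gordan (M * E)%type (ds ++ cM ++ cE) ds.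
- move=> c /In_cat [/In_cat [/List.in_map_iff [w [<- _]]|]|/In_cat []].
  + by move=> x y; rewrite /fs ipairD.
  + move=> /List.in_flat_map [j [_ /List.in_map_iff [w [<- _]]]] x y.
    by rewrite /fd ipairD !mxE mulrDr addrACA.
  + by move=> /List.in_map_iff [i [<- _]] x y; rewrite mxE.
  + by move=> /List.in_map_iff [i [<- _]] x y; rewrite mxE.
- move=> [m e] h; suff [-> ->] : m = 0 /\ e = 0 by [].
  split; apply/rowP => i; rewrite mxE.
    apply: (h (fun x => x.1 0 i)); apply/In_cat; right; apply/In_cat; left.
    apply/List.in_map_iff; exists i; split=> //.
    by apply/In_mem; rewrite mem_enum.
  apply: (h (fun x => x.2 0 i)); apply/In_cat; right; apply/In_cat; right.
  apply/List.in_map_iff; exists i; split=> //.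
  by apply/In_mem; rewrite mem_enum.
- by move=> d h; apply/In_cat; left.
exists T; split=> [x /hT h|Q Q0 QD x /hEx hx]; first exact/hEx.
by apply: hind hx => // y x' yT /hEx hx'; apply: QD.
Qed.

(** Each Gordan generator p contributes module generators of its fractional ideal. Induction along
    sums works because the product of the fractional ideals of e and e' is that of e + e', which can
    be checked locally. *)
Lemma support_generators : exists gs : seq L, (forall g, g \in gs -> graded S g) /\
  forall B, subring B -> (forall a, A0 a -> B (emb a)) -> (forall g, g \in gs -> B g) ->
    forall m x, S m x -> B (emb x * chi m).
Proof.
have [T [hT Tind]] := admissible_ind.
have hg (p : M * E) := constructive_indefinite_description _
  (above_fin_gen hA hK (bounds_fin p.2)).
exists (flatten [seq [seq emb x * chi p.1 | x <- sval (hg p)] | p <- T]); split.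
  move=> _ /flatten_mapP [p /In_mem pT /mapP [x xs ->]].
  apply/graded_term; [exact: sections0|exact: (sectionsB hA hK)|].
  apply: (@admissible_sections _ p.2); first by case: p pT {xs} => ? ? /hT.
  by case: (svalP (hg p)) => h _; apply: h.
move=> B hB AB gB m x Sx.
have [->|x0] := eqVneq x 0; first by rewrite emb0 mul0r; apply: subring0.
have [e [he hx]] := sections_admissible Sx x0.
suff main : forall p, admissible p -> forall x, above (bounds p.2) x -> B (emb x * chi p.1).
  exact: (main (m, e)).
have smodB (m' : M) : smod A0 (fun y => B (emb y * chi m')).
  split; first by rewrite emb0 mul0r; apply: subring0.
    by move=> a b Ba Bb; rewrite embD mulrDl; apply: subringD.
  by move=> r a Ar Ba; rewrite embM -mulrA; apply: subringM => //; apply: AB.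
move=> {m x Sx x0 e he hx}; apply: Tind.
  move=> x hx; rewrite chi0 mulr1; apply: AB.
  have [->|x0] := eqVneq x 0; first exact: subring0.
  case: hx => [->|hx]; first exact: subring0.
  apply: (ordf_ge0_mem hA hK x0) => z; apply: le_trans (hx z).
  by rewrite /bounds big1 // => j _; rewrite mxE.
move=> p q pT hq IH x hx.
have hp y : above (bounds p.2) y -> B (emb y * chi p.1).
  have [h1 h2] := svalP (hg p); move: y; apply: (h2 _ (smodB p.1)) => y ys.
  apply: gB; apply/flatten_mapP; exists p; first exact/In_mem.
  by apply/mapP; exists y.
apply: (local_mem hA (smodB (p + q).1)) => z.
have [->|x0] := eqVneq x 0.
  exists 1; rewrite mulr0 emb0 mul0r; split; [exact: subring1| |exact: subring0].
  by case: (svalP z).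
case: hx => [E0|hx]; first by rewrite E0 eqxx in x0.
(* At z the elements a and b generate the two fractional ideals, so x / (a b) has nonnegative order
   there and a denominator t outside z brings it into [A0]. *)
have [a [a0 va ha]] := exists_exact_order hA hK z (bounds_fin p.2).
have [b [b0 vb hb]] := exists_exact_order hA hK z (bounds_fin q.2).
have ab0 : a * b != 0 by apply: mulf_neq0.
have [||t [At nt Atx]] := @ordf_ge0_local _ _ hA hK z (x / (a * b)).
- by rewrite mulf_neq0 ?invr_eq0.
- rewrite (ordfM hA hK) ?invr_eq0 // (ordfV hA hK) // (ordfM hA hK) // va vb.
  by have := hx z; rewrite boundsD subr_ge0.
exists t; split=> //.
have -> : t * x = t * (x / (a * b)) * (a * b) by rewrite -!mulrA mulVf ?mulr1.
rewrite embM (embM _ a b) chiD -mulrA; apply: subringM => //; first exact: AB.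
rewrite mulrACA; apply: subringM => //; first by apply: hp; right.
by apply: IH; right.
Qed.

End Support.

Lemma sections_generators : exists gs : seq L, (forall g, g \in gs -> graded S g) /\
  forall B, subring B -> (forall a, A0 a -> B (emb a)) -> (forall g, g \in gs -> B g) ->
    forall m x, S m x -> B (emb x * chi m).
Proof.
have [G hG] := hsigma; have [k [zs [zi hz]]] := proj1 (finite_pts_enum _) (divisor_support hD).
have hs i := constructive_indefinite_description _ (proj1 hD (zs i)).
apply: (@support_generators G k zs (fun i => sval (hs i))) => //.
- by move=> c; split=> [/hG /cone_genE|/cone_genE /hG].
- move=> z nz; apply: NNPP => h; have [i zi'] := hz z h.
  exact: nz zi'.
- by move=> i w; have [_ h] := svalP (hs i); apply: h.
Qed.

Lemma sections_noetherian : noetherian (@graded K n S).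
Proof.
have [gs [hgs hgen]] := sections_generators.
have [hE nE] := emb_ring_noetherian.
have [B [hB nB EB gB Bmin]] := noetherian_adjoin_seq gs hE nE.
have hSub := sections_graded_subring hA hK sigma D.
suff -> : @graded K n S = B by [].
apply: functional_extensionality => y; apply: propositional_extensionality; split.
  move=> [s [hs ->]]; rewrite big_seq; apply: (smod_sum (subring_smod hB)) => p ps.
  by apply: hgen => //; [move=> a Aa; apply: EB; exists a|exact: hs].
move: y; apply: Bmin => // _ [a [Aa ->]].
rewrite -[emb a]mulr1 -(chi0 K n); apply/graded_term.
- exact: sections0.
- exact: sectionsB.
- exact: sections_deg0.
Qed.

Hypothesis sigma_sc : strongly_convex sigma.

(** The vector u is a multiple of the sum of the inequalities cutting out [sigma]. By strong
    convexity this sum is positive on nonzero vectors of [sigma], so a large multiple of u outweighs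
    any m on the finitely many generators. *)
Lemma dual_interior : exists u : M, forall m, exists k : nat,
  dualQ sigma (toQ (m + u *+ k)) /\ dualQ sigma (toQ (u *+ k)).
Proof.
have [G hG0] := hsigma.
have hG c : sigma c <-> cone G c by split=> [/hG0 /cone_genE|/cone_genE /hG0].
have [B hB] := weyl G.
pose b := \sum_(b <- B) b.
have [d d0 [u hu]] := clear_denom_row b.
have bge c : sigma c -> forall b', b' \in B -> 0 <= pairQ b' c by move=> /hG /hB.
have hb c : sigma c -> 0 <= pairQ b c.
  move=> sc; rewrite pairQ_suml big_seq; apply: sumr_ge0 => b' bB; exact: bge.
have hb0 c : sigma c -> pairQ b c <= 0 -> c = 0.
  move=> sc hc; apply: sigma_sc => //; apply/hG/hB => b' b'B.
  rewrite pairQNr oppr_ge0; apply: le_trans hc.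
  rewrite pairQ_suml (big_rem b') //= lerDl big_seq; apply: sumr_ge0 => b'' /mem_rem b''B.
  exact: bge.
exists u => m.
have [k hk] : exists k : nat, forall g, g \in G -> 0 <= pairQ (toQ (m + u *+ k)) g.
  have sG g : g \in G -> sigma g by move=> /cone_mem /hG.
  elim: G sG {hG0 hG hB} => [|g G IH] sG; first by exists 0%N.
  have [|k hk] := IH; first by move=> g' g'G; apply: sG; rewrite inE g'G orbT.
  have sg : sigma g by apply: sG; apply: mem_head.
  have ug c : sigma c -> 0 <= pairQ (toQ u) c.
    by move=> sc; rewrite hu pairQZl mulr_ge0 ?hb // ler0n.
  have [l hl] : exists l : nat, 0 <= pairQ (toQ (m + u *+ l)) g.
    case: (lerP (pairQ b g) 0) => [/(hb0 _ sg) ->|bg].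
      by exists 0%N; rewrite pairQ0r.
    have uPos : 0 < pairQ (toQ u) g by rewrite hu pairQZl mulr_gt0 // ltr0n.
    exists (Num.truncn (- pairQ (toQ m) g / pairQ (toQ u) g)).+1.
    rewrite toQD toQMn pairQDl pairQZl.
    have := truncnS_gt (- pairQ (toQ m) g / pairQ (toQ u) g).
    by rewrite ltr_pdivrMr //; lra.
  exists (k + l)%N => g'; rewrite inE mulrnDr => /orP [/eqP ->|g'G].
    by rewrite addrCA toQD pairQDl addr_ge0 // toQMn pairQZl mulr_ge0 ?ler0n // ug.
  rewrite addrA toQD pairQDl addr_ge0 ?hk // toQMn pairQZl mulr_ge0 ?ler0n // ug //.
  by apply: sG; rewrite inE g'G orbT.
exists k; split=> c sc; last first.
  by rewrite toQMn pairQZl hu pairQZl !mulr_ge0 ?ler0n // hb.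
by apply: (cone_min (half_space_convex _) hk); apply/hG.
Qed.

(** Write m as (m + k u) - k u with both degrees in the dual cone. Each has a nonzero section, and
    constants are fractions already, so chi^m is a quotient. *)
Lemma sections_frac x : fracS (@graded K n S) x.
Proof.
have hSub := sections_graded_subring hA hK sigma D.
have hF := fracS_subring hSub.
have hemb a : fracS (graded S) (emb a).
  have [b [c [Ab Ac c0 ->]]] := hK a.
  have h b' : A0 b' -> graded S (emb b').
    move=> Ab'; rewrite -[emb b']mulr1 -(chi0 K n); apply/graded_term.
    - exact: sections0.
    - exact: sectionsB.
    - exact: sections_deg0.
  exists (emb b), (emb c); split; [exact: h|exact: h|by rewrite emb_eq0|].
  by rewrite embM embV.
apply: fracS_full => // m.
have [u hu] := dual_interior; have [k [h1 h2]] := hu m.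
have [z0] := closed_pt_inhabited hA.
have hdeg m' : dualQ sigma (toQ m') -> fracS (graded S) (chi m').
  move=> hm'; have [g [g0 Sg _]] := section_exact hA hK z0 hsigma hD hm'.
  have -> : chi m' = emb g^-1 * (emb g * chi m').
    by rewrite mulrA -embM mulVf // emb1 mul1r.
  apply: subringM => //; apply: fracS_sub => //; apply/graded_term => //.
  - exact: sections0.
  - exact: sectionsB.
rewrite -(addrK (u *+ k) m) chiD chiN; apply: subringM => //; first exact: hdeg.
by apply: fracSV => //; apply: hdeg.
Qed.

End Divisor.
End FiniteGeneration.

(** * Normalization of a graded ring given by generators *)

Lemma homogenize_sum n (r : nat) (c : 'I_r -> rat) (a : 'I_r -> 'rV[rat]_n) (b : 'I_r -> rat) :
  \sum_i c i *: homogenize (a i) (b i) = homogenize (\sum_i c i *: a i) (\sum_i c i * b i).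
Proof.
elim/big_rec3: _ => [|i x y w _ ->]; first by rewrite homogenize0.
by rewrite homogenizeZ homogenizeD.
Qed.

Lemma power_almost_integral (F : fieldType) (S : F -> Prop) x d : subring S ->
  (0 < d)%N -> fracS S x -> S (x ^+ d) -> exists b, b != 0 /\ forall k, S (b * x ^+ k).
Proof.
move=> hS d0 [a [b [Sa Sb b0 ->]]] Sx.
pose p : {poly F} := 'X^d - ((a / b) ^+ d)%:P.
exists (b ^+ (size p).-1); split; first exact: expf_neq0.
apply: integral_almost_integral => //.
- exact: monicXnsubC.
- move=> i; rewrite coefB coefXn coefC; apply: subringB => //.
    by case: eqP => _; [exact: subring1|exact: subring0].
  by case: eqP => _ //; exact: subring0.
- by rewrite /root !hornerE subrr.
Qed.

Section Normalization.
Variables (K : fieldType) (A0 : K -> Prop).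
Hypothesis hA : dedekind A0.
Hypothesis hK : forall x, fracS A0 x.
Variable n : nat.
Local Notation L := (Lfield K n).
Local Notation M := 'rV[int]_n.
Local Notation V := 'rV[rat]_n.
Local Notation Z := (closed_pt A0).
Local Notation emb := (@emb K n).
Local Notation chi := (@chi K n).
Implicit Types (m : M) (w : V) (z : Z).

Let hS : subring A0. Proof. by case: hA. Qed.

Lemma chi_sum (r : nat) (ms : 'I_r -> M) : chi (\sum_i ms i) = \prod_i chi (ms i).
Proof.
elim/big_rec2: _ => [|i x y _ <-]; first exact: chi0.
exact: chiD.
Qed.

Lemma chi_scale (c : int) m : chi (c *: m) = chi m ^ c.
Proof.
have E (k : nat) : k%:Z *: m = m *+ k.
  by apply/rowP => i; rewrite mulmxnE mxE -mulr_natl natz.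
case: c => c; first by rewrite E chiMn.
by rewrite NegzE scaleNr chiN E chiMn exprnN.
Qed.

Lemma emb_prod (r : nat) (f : 'I_r -> K) : emb (\prod_i f i) = \prod_i emb (f i).
Proof.
elim/big_rec2: _ => [|i x y _ <-]; first exact: emb1.
exact: embM.
Qed.

Lemma gen_ring_subring r (g : 'I_r -> L) : subring (gen_ring A0 g).
Proof.
split.
- by move=> S hS' _ _; apply: subring0.
- by move=> S hS' _ _; apply: subring1.
- by move=> x y hx hy S hS' AS gS; apply: subringB => //; [apply: hx|apply: hy].
- by move=> x y hx hy S hS' AS gS; apply: subringM => //; [apply: hx|apply: hy].
Qed.

Lemma gen_ring_noetherian r (g : 'I_r -> L) : noetherian (gen_ring A0 g).
Proof.
have [hE nE] := emb_ring_noetherian hA n.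
have [B [hB nB EB gB Bmin]] := noetherian_adjoin_seq [seq g i | i <- enum 'I_r] hE nE.
suff -> : gen_ring A0 g = B by [].
apply: functional_extensionality => y; apply: propositional_extensionality; split.
  apply=> // [a Aa|i]; first by apply: EB; exists a.
  by apply: gB; apply/mapP; exists i; rewrite ?mem_enum.
move=> By S hS' AS gS; apply: Bmin By => // [_ [a [Aa ->]]|_ /mapP [i _ ->]] //.
exact: AS.
Qed.

Variables (r : nat) (f : 'I_r -> K) (ms : 'I_r -> M).
Hypothesis f0 : forall i, f i != 0.
Hypothesis ms_gen : forall m, exists c : 'I_r -> int, m = \sum_(i < r) c i *: ms i.
Let sigma w := forall i, 0 <= pair (ms i) w.
Let D := @Df K A0 n r f ms.
Let g i : L := emb (f i) * chi (ms i).
Let B := gen_ring A0 g.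
Local Notation S := (sections sigma D).

Let hB : subring B. Proof. exact: gen_ring_subring. Qed.
Let AB a : A0 a -> B (emb a).
Proof. by move=> Aa S _ AS _; apply: AS. Qed.
Let gB i : B (g i).
Proof. by move=> S _ _; apply. Qed.

Lemma DfE z w : D z w <-> forall i, - (ordf z (f i))%:~R <= pair (ms i) w.
Proof.
split=> [h i|h i k /(ordfP hA hK _ _ (f0 i)) -> //].
exact/h/(ordfP hA hK _ _ (f0 i)).
Qed.

Lemma Df_pol_sigma z : (exists w, D z w) -> pol_sigma sigma (D z).
Proof.
move=> [w0 /DfE h0].
have [s [sn hs]] := @polyhedron_decomposition n r (fun i => toQ (ms i)) _ w0 h0.
exists s; split=> // w; split=> [/DfE h|h]; first exact: (proj1 (hs w) h).
apply/DfE; exact: (proj2 (hs w) h).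
Qed.

Lemma Df_attains_minima : attains_minima sigma D.
Proof.
move=> z hz m hm; apply: (pol_sigma_min (sigma := sigma)) (Df_pol_sigma hz) hm.
by move=> i; rewrite /pair pairQ0r.
Qed.

Lemma gen_ring_frac x : fracS B x.
Proof.
have hF := fracS_subring hB.
have hemb a : fracS B (emb a).
  have [b [c [Ab Ac c0 ->]]] := hK a.
  exists (emb b), (emb c); split; [exact: AB|exact: AB|by rewrite emb_eq0|].
  by rewrite embM embV.
apply: fracS_full => // m.
have [c ->] := ms_gen m; rewrite chi_sum; apply: subring_prod => // i _.
rewrite chi_scale; apply: fracSXz => //.
have -> : chi (ms i) = emb (f i)^-1 * g i.
  by rewrite /g mulrA -embM mulVf // emb1 mul1r.
by apply: subringM => //; apply: fracS_sub.
Qed.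

Lemma gen_ring_sections x : B x -> graded S x.
Proof.
have hSub := sections_graded_subring hA hK sigma D.
apply=> // [a Aa|i].
  rewrite -[emb a]mulr1 -(chi0 K n); apply/graded_term.
  - exact: sections0.
  - exact: sectionsB.
  - exact: sections_deg0.
apply/graded_term; [exact: sections0|exact: sectionsB|].
right; split=> [w|z w /DfE /(_ i)]; first by apply.
by rewrite -subr_ge0 opprK addrC.
Qed.

(* Farkas in the space of pairs (degree, order), where the extra generator
   (0, 1) accounts for multiplying by elements of [A0]. *)
Lemma sections_combination m h z : h != 0 -> S m h -> exists c : 'I_r -> rat,
  [/\ forall i, 0 <= c i, toQ m = \sum_i c i *: toQ (ms i) &
      \sum_i c i * (ordf z (f i))%:~R <= (ordf z h)%:~R].
Proof.
move=> h0 [E|[hm hh]]; first by rewrite E eqxx in h0.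
pose a i := homogenize (toQ (ms i)) (ordf z (f i))%:~R.
case: (farkas (homogenize 0 1 :: [seq a i | i <- enum 'I_r]) (homogenize (toQ m) (ordf z h)%:~R)).
  move=> [t [t0 /cone_sum [c [c0]]]].
  rewrite homogenize_sum homogenizeZ scaler0 mulr1 -scaleN1r homogenizeZ scaler0 homogenizeD addr0 mulN1r.
  move=> /homogenize_inj [Em Ev]; exists c; split=> //.
  by rewrite -Ev; lra.
move=> [y [hy]]; have [u [s Ey]] := homogenizeE y.
have s0 : 0 <= s.
  by have := hy _ (mem_head _ _); rewrite Ey pair_homogenize pairQ0l add0r mul1r.
have ha i : 0 <= pairQ (toQ (ms i)) u + (ordf z (f i))%:~R * s.
  rewrite -pair_homogenize -Ey; apply: hy; rewrite inE; apply/orP; right.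
  by apply/mapP; exists i; rewrite ?mem_enum.
rewrite Ey pair_homogenize.
move: s0; rewrite le_eqVlt => /orP [/eqP s0|s0].
  rewrite -s0 mulr0 addr0 ltNge; case/negP; apply: hm => i.
  by have := ha i; rewrite -s0 mulr0 addr0.
have /hh h1 : D z (s^-1 *: u).
  apply/DfE => i; rewrite /pair pairQZr mulrC ler_pdivlMr // mulNr.
  by have := ha i; lra.
move: h1; rewrite /pair pairQZr => h1 h2.
have : 0 <= s * ((ordf z h)%:~R + s^-1 * pairQ (toQ m) u) by apply: mulr_ge0 => //; apply: ltW.
by rewrite mulrDr mulrA divff ?gt_eqF //; lra.
Qed.

(** With d a common denominator of c, u is the product of the f_i^(d c_i), and u chi^(d m) lies in
    B. The order inequality says that h^d is a local multiple of u. Since d depends only on c, it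
    serves every z where the inequality holds. *)
Lemma combination_power m h (c : 'I_r -> rat) : h != 0 -> (forall i, 0 <= c i) ->
  toQ m = \sum_i c i *: toQ (ms i) -> exists d : nat, (0 < d)%N /\
  forall z, \sum_i c i * (ordf z (f i))%:~R <= (ordf z h)%:~R ->
    exists t, [/\ A0 t, ~ sval z t & B (emb (t * h ^+ d) * chi (m *+ d))].
Proof.
move=> h0 c0 Em; have [d d0 hd] := clear_denom c.
have ha i : {k : nat | d%:R * c i = k%:R}.
  apply: constructive_indefinite_description; have [k Ek] := hd i.
  exists (absz k); rewrite Ek.
  have : 0 <= k by rewrite -(ler0z rat) -Ek mulr_ge0 ?ler0n.
  by case: (k).
pose a i := sval (ha i); have Ea i : d%:R * c i = (a i)%:R by exact: (svalP (ha i)).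
have Emd : m *+ d = \sum_i ms i *+ a i.
  apply: toQ_inj; rewrite toQMn Em scaler_sumr.
  have toQ_sum : forall s : seq 'I_r, toQ (\sum_(i <- s) ms i *+ a i) = \sum_(i <- s) toQ (ms i *+ a i).
    by elim=> [|i s IH]; rewrite ?big_nil ?toQ0 // !big_cons toQD IH.
  by rewrite toQ_sum; apply: eq_bigr => i _; rewrite scalerA toQMn Ea.
pose u := \prod_i f i ^+ a i.
have u0 : u != 0 by apply/prodf_neq0 => i _; apply: expf_neq0.
have Bu : B (emb u * chi (m *+ d)).
  rewrite Emd chi_sum emb_prod -big_split; apply: subring_prod => // i _.
  by rewrite /= embX chiMn -exprMn; apply: (subringX hB); apply: gB.
exists d; split=> // z hz.
have hd0 : h ^+ d != 0 by apply: expf_neq0.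
have [||t [At nt Atx]] := @ordf_ge0_local _ _ hA hK z (h ^+ d / u).
- by rewrite mulf_neq0 ?invr_eq0.
- rewrite (ordfM hA hK) ?invr_eq0 // (ordfV hA hK) // (ordfX hA hK) // subr_ge0.
  rewrite (ordf_prod hA hK) => [|i]; last by apply: expf_neq0.
  rewrite -(ler_int rat) rmorphMn /= -mulr_natl rmorph_sum /=.
  have -> : \sum_i (ordf z (f i ^+ a i))%:~R = d%:R * \sum_i c i * (ordf z (f i))%:~R :> rat.
    rewrite mulr_sumr; apply: eq_bigr => i _.
    by rewrite (ordfX hA hK) // rmorphMn /= -mulr_natl mulrA Ea.
  by apply: ler_wpM2l => //; rewrite ler0n.
exists t; split=> //.
have -> : t * h ^+ d = t * (h ^+ d / u) * u by rewrite -!mulrA mulVf ?mulr1.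
by rewrite embM -mulrA; apply: (subringM hB) => //; apply: AB.
Qed.

(** One exponent must work at all points. Local success with d implies success with every multiple
    of d, so the exponents of finitely many exceptional points can be multiplied together. *)
Lemma sections_power m h : h != 0 -> S m h ->
  exists d : nat, (0 < d)%N /\ B ((emb h * chi m) ^+ d).
Proof.
move=> h0 Sh.
pose ok (d : nat) z := exists t, [/\ A0 t, ~ sval z t & B (emb (t * h ^+ d) * chi (m *+ d))].
have okM d e z : ok d z -> ok (d * e)%N z.
  move=> [t [At nt Bt]]; exists (t ^+ e); split.
  - exact: subringX.
  - elim: e => [|e IH]; first by rewrite expr0; case: (svalP z).
    by rewrite exprS; apply: (maximal_notM hA (svalP z)) => //; apply: subringX.
  - by rewrite mulrnA chiMn exprM -exprMn embX -exprMn; apply: (subringX hB).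
have [z1] := closed_pt_inhabited hA.
(* Where h and all f_i have order 0 the order inequality reads 0 <= 0, so the combination found at
   an arbitrary [z1] serves all those points. *)
have [c1 [c10 Em1 _]] := sections_combination z1 h0 Sh.
have [d1 [d10 hd1]] := combination_power h0 c10 Em1.
have hbad : finite_pts (fun z => ordf z h <> 0 \/ exists i, ordf z (f i) <> 0).
  apply: finite_ptsU; first exact: (finite_pts_ordf hA hK h0).
  by apply: finite_pts_bigU => i; apply: (finite_pts_ordf hA hK).
have [l hl] := hbad.
have ok1 z : ~ List.In z l -> ok d1 z.
  move=> nz; apply: hd1.
  have vz : ordf z h = 0 by apply: NNPP => h1; apply: nz; apply: hl; left.
  rewrite vz big1 // => i _.
  have -> : ordf z (f i) = 0 by apply: NNPP => h1; apply: nz; apply: hl; right; exists i.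
  by rewrite mulr0.
have [d [d0 hd]] : exists d, (0 < d)%N /\ forall z, (List.In z l \/ ok d1 z) -> ok d z.
  elim: l {hl ok1} => [|z l [d [d0 IH]]]; first by exists d1; split=> // z [].
  have [c [c0 Em hc]] := sections_combination z h0 Sh.
  have [e [e0 he]] := combination_power h0 c0 Em.
  exists (d * e)%N; split; first by rewrite muln_gt0 d0.
  move=> z' [[<-|zl]|o1].
  - by rewrite mulnC; apply: okM; apply: he.
  - by apply: okM; apply: IH; left.
  - by apply: okM; apply: IH; right.
exists d; split=> //; rewrite exprMn -embX -chiMn.
apply: (local_mem hA (N := fun y => B (emb y * chi (m *+ d)))).
  split; first by rewrite emb0 mul0r; apply: (subring0 hB).
    by move=> a b Ba Bb; rewrite embD mulrDl; apply: (subringD hB).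
  by move=> c a Ac Ba; rewrite embM -mulrA; apply: (subringM hB) => //; apply: AB.
move=> z; apply: hd; case: (classic (List.In z l)) => h1; [by left|right].
exact: ok1.
Qed.

(** One inclusion holds since the ring of sections is normal and contains B. For the other, each
    homogeneous term has a power in B, so it is almost integral; the sum is too, with the product of
    the denominators. *)
Lemma normalization_gen_ring x : normalization B x <-> @A0D K A0 n sigma D x.
Proof.
rewrite (A0D_sections hA hK Df_attains_minima); split.
  move=> [hfr hint]; apply: (sections_normal hA hK).
    by apply: fracS_mono hfr; apply: gen_ring_sections.
  by apply: integral_over_mono hint; apply: gen_ring_sections.
move=> [s [hs Ex]]; split; first exact: gen_ring_frac.
have [b [b0 hb]] : exists b, b != 0 /\ forall k, B (b * x ^+ k).
  rewrite Ex; elim: s hs {Ex} => [|p s IH] hs.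
    exists 1; rewrite oner_neq0 big_nil; split=> // k.
    by rewrite mul1r; apply: (subringX hB); apply: (subring0 hB).
  have [|b [b0 hb]] := IH; first by move=> q qs; apply: hs; rewrite inE qs orbT.
  have [p0|p0] := eqVneq p.2 0.
    by exists b; split=> // k; rewrite big_cons p0 emb0 mul0r add0r.
  have [d [d0 hd]] := sections_power p0 (hs p (mem_head _ _)).
  have [c [c0 hc]] := power_almost_integral hB d0 (gen_ring_frac _) hd.
  exists (c * b); split; first exact: mulf_neq0.
  by rewrite big_cons; apply: almost_integralD.
apply: (almost_integral_integral hB _ b0 hb).
exact: gen_ring_noetherian.
Qed.

End Normalization.

(** * Graded noetherian rings and the converse *)

Section GradedNoetherian.
Variables (K : fieldType) (A0 : K -> Prop) (n : nat).
Local Notation L := (Lfield K n).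
Local Notation M := 'rV[int]_n.
Local Notation emb := (@emb K n).
Local Notation chi := (@chi K n).
Variable A : M -> K -> Prop.
Hypothesis hA : graded_subalg A0 A.
Hypothesis A1 : A 0 1.
Hypothesis nA : noetherian (graded A).

Let Az m : A m 0. Proof. by case: hA. Qed.
Let AB m a b : A m a -> A m b -> A m (a - b). Proof. by case: hA => _ h _ _; apply: h. Qed.
Let AM m m' a b : A m a -> A m' b -> A (m + m') (a * b).
Proof. by case: hA => _ _ h _; apply: h. Qed.
Let hG : subring (graded A). Proof. exact: graded_subring. Qed.

(** The ideal generated by all homogeneous elements with degree in P has finitely many generators;
    the homogeneous elements occurring in them form l. The coefficients can be taken homogeneous
    because the combinations of the right degrees, [W], again form a graded module. *)
Lemma homogeneous_ideal_gens (P : M -> Prop) : exists l : seq (M * K),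
  (forall p, p \in l -> P p.1 /\ A p.1 p.2) /\
  forall m a, P m -> A m a -> exists c : M * K -> K,
    (forall p, p \in l -> A (m - p.1) (c p)) /\ a = \sum_(p <- l) c p * p.2.
Proof.
pose I (y : L) := exists s : seq (L * (M * K)),
  (forall q, q \in s -> [/\ graded A q.1, P q.2.1 & A q.2.1 q.2.2]) /\
  y = \sum_(q <- s) q.1 * (emb q.2.2 * chi q.2.1).
have hI : ideal (graded A) I.
  split.
  - move=> _ [s [hs ->]]; rewrite big_seq; apply: (smod_sum (subring_smod hG)) => q /hs [h1 _ h2].
    by apply: subringM => //; apply/graded_term.
  - by exists [::]; rewrite big_nil.
  - move=> _ _ [s [hs ->]] [t [ht ->]]; exists (s ++ t); rewrite big_cat; split=> // q.
    by rewrite mem_cat => /orP [/hs|/ht].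
  - move=> r _ Ar [s [hs ->]]; exists [seq (r * q.1, q.2) | q <- s]; split.
      by move=> _ /mapP [q /hs [h1 h2 h3] ->]; split=> //; apply: subringM.
    by rewrite big_map mulr_sumr; apply: eq_bigr => q _; rewrite mulrA.
have [ys [ysI ysgen]] := fin_gen_span hI (nA hI).
have [l [hl hys]] : exists l : seq (M * K), (forall p, p \in l -> P p.1 /\ A p.1 p.2) /\
    forall y, y \in ys -> exists s : seq (L * (M * K)),
      (forall q, q \in s -> graded A q.1 /\ q.2 \in l) /\
      y = \sum_(q <- s) q.1 * (emb q.2.2 * chi q.2.1).
  elim: ys ysI {ysgen} => [|y ys IH] ysI; first by exists [::].
  have [|l [hl hys]] := IH; first by move=> x xs; apply: ysI; rewrite inE xs orbT.
  have [s [hs Ey]] := ysI y (mem_head _ _).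
  exists ([seq q.2 | q <- s] ++ l); split.
    by move=> p; rewrite mem_cat => /orP [/mapP [q /hs [_ h1 h2] ->]|/hl].
  move=> x; rewrite inE => /orP [/eqP ->|/hys [t [ht Ex]]].
    exists s; split=> // q qs; have [h1 _ _] := hs q qs; split=> //.
    by rewrite mem_cat; apply/orP; left; apply/mapP; exists q.
  exists t; split=> // q /ht [h1 h2]; split=> //.
  by rewrite mem_cat h2 orbT.
(* Coefficients are indexed by elements rather than positions, so repetitions must go for a
   Kronecker delta to pick out a single generator. *)
exists (undup l); split=> [p|]; first by rewrite mem_undup => /hl.
pose W m a := exists c : M * K -> K,
    (forall p, p \in undup l -> A (m - p.1) (c p)) /\ a = \sum_(p <- undup l) c p * p.2.
have W0 m : W m 0.
  by exists (fun=> 0); split=> //; rewrite big1 // => p _; rewrite mul0r.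
have WB m a b : W m a -> W m b -> W m (a - b).
  move=> [c [hc ->]] [d [hd ->]]; exists (fun p => c p - d p); split=> [p pl|].
    by apply: AB; [exact: hc|exact: hd].
  by rewrite -sumrB; apply: eq_bigr => p _; rewrite mulrBl.
have WM m m' a b : A m a -> W m' b -> W (m + m') (a * b).
  move=> Aa [c [hc ->]]; exists (fun p => a * c p); split=> [p pl|].
    by rewrite -addrA; apply: AM => //; apply: hc.
  by rewrite mulr_sumr; apply: eq_bigr => p _; rewrite mulrA.
have hN : smod (graded A) (graded W).
  split.
  - by exists [::]; rewrite big_nil.
  - by move=> x y; apply: gradedD.
  - move=> _ _ [s [hs ->]] [t [ht ->]].
    exists [seq (p.1 + q.1, p.2 * q.2) | p <- s, q <- t]; split.
      by move=> _ /allpairsP [[p q] /= [ps qt ->]]; apply: WM; [apply: hs|apply: ht].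
    rewrite big_allpairs_dep mulr_suml; apply: eq_bigr => p _.
    rewrite mulr_sumr; apply: eq_bigr => q _ /=.
    by rewrite embM chiD mulrACA.
move=> m a Pm Aa; apply/(graded_term W0 WB); apply: (ysgen _ hN).
  move=> y /hys [s [hs ->]]; rewrite big_seq; apply: (smod_sum hN) => q /hs [h1 h2].
  case: hN => _ _; apply=> //; apply/(graded_term W0 WB).
  have h2' : q.2 \in undup l by rewrite mem_undup.
  exists (fun p => (p == q.2)%:R); split=> [p _|].
    by case: eqP => [->|_]; rewrite ?subrr.
  rewrite (bigD1_seq q.2) ?undup_uniq //= eqxx mul1r big1 ?addr0 // => p /negbTE ->.
  by rewrite mul0r.
exists [:: (1, (m, a))]; split; last by rewrite big_seq1 mul1r.
by move=> q; rewrite inE => /eqP ->; split=> //=; apply: subring1.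
Qed.

Definition generates (P : M -> Prop) (F : seq (M * K)) : Prop :=
  (forall p, p \in F -> A p.1 p.2) /\
  forall B : L -> Prop, subring B -> (forall a, A0 a -> B (emb a)) ->
    (forall p, p \in F -> B (emb p.2 * chi p.1)) ->
    forall m a, P m -> A m a -> B (emb a * chi m).

Lemma combination_mem (B : L -> Prop) (l : seq (M * K)) (c : M * K -> K) m :
  subring B -> (forall p, p \in l -> B (emb p.2 * chi p.1)) ->
  (forall p, p \in l -> B (emb (c p) * chi (m - p.1))) ->
  B (emb (\sum_(p <- l) c p * p.2) * chi m).
Proof.
move=> hB hl hc.
have -> : emb (\sum_(p <- l) c p * p.2) * chi m =
    \sum_(p <- l) (emb (c p) * chi (m - p.1)) * (emb p.2 * chi p.1).
  have -> : emb (\sum_(p <- l) c p * p.2) = \sum_(p <- l) emb (c p * p.2).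
    elim: l {hl hc} => [|p l IH]; first by rewrite !big_nil emb0.
    by rewrite !big_cons embD IH.
  rewrite mulr_suml; apply: eq_bigr => p _.
  by rewrite embM mulrACA -chiD subrK.
rewrite big_seq; apply: (smod_sum (subring_smod hB)) => p pl.
by apply: (subringM hB); [exact: hc|exact: hl].
Qed.

Definition vanish (j : nat) (m : M) : Prop := forall i : 'I_n, (i < j)%N -> m 0 i = 0.

(* Only ideals of the whole ring are used: the coefficients in a homogeneous
   combination automatically have their degrees in the smaller subgroup. *)
Lemma generates_step (j : 'I_n) (eps : int) F : eps != 0 ->
  generates (vanish j.+1) F ->
  exists F', generates (fun m => vanish j m /\ 0 <= eps * m 0 j) F'.
Proof.
move=> eps0 [FA Fgen].
have vanishB m p : vanish j m -> vanish j p -> vanish j (m - p).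
  by move=> hm hp i ij; rewrite !mxE hm // hp // subrr.
have slice (t : nat) : exists F', generates (fun m => vanish j m /\ eps * m 0 j = t%:Z) F'.
  have [l [hl hgen]] := homogeneous_ideal_gens (fun m => vanish j m /\ eps * m 0 j = t%:Z).
  exists (l ++ F); split.
    by move=> p; rewrite mem_cat => /orP [/hl []|/FA].
  move=> B hB AB0 FB m a Pm Aa; have [c [hc ->]] := hgen m a Pm Aa.
  apply: combination_mem => // p pl; first by apply: FB; rewrite mem_cat pl.
  apply: (Fgen B hB AB0); last exact: hc.
    by move=> q qF; apply: FB; rewrite mem_cat qF orbT.
  have [[vp Ep] _] := hl p pl; have [vm Em] := Pm.
  move=> i; rewrite ltnS leq_eqVlt => /orP [/eqP ij|ij]; last exact: vanishB ij.
  have -> : i = j by apply: val_inj.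
  by apply: (mulfI eps0); rewrite !mxE mulrDr mulrN Em Ep subrr mulr0.
have slices (T : nat) : exists F', generates (fun m => vanish j m /\ 0 <= eps * m 0 j < T%:Z) F'.
  elim: T => [|T [F1 [F1A F1gen]]].
    by exists [::]; split=> // B _ _ _ m a [_ /andP [h1 h2]]; lia.
  have [F2 [F2A F2gen]] := slice T.
  exists (F1 ++ F2); split; first by move=> p; rewrite mem_cat => /orP [/F1A|/F2A].
  move=> B hB AB0 FB m a [vm /andP [h1 h2]] Aa.
  have [E|nE] := eqVneq (eps * m 0 j) T%:Z.
    apply: (F2gen B hB AB0) Aa => //.
    by move=> p pF; apply: FB; rewrite mem_cat pF orbT.
  apply: (F1gen B hB AB0) Aa => [p pF|]; first by apply: FB; rewrite mem_cat pF.
  by split=> //; lia.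
(* T bounds the signed j-th coordinates of these generators. A degree beyond T is lowered strictly
   by each of them and stays positive, so the descent ends in the slices up to T. *)
have [l [hl hgen]] := homogeneous_ideal_gens (fun m => vanish j m /\ 0 < eps * m 0 j).
have [T hT] : exists T : nat, forall p, p \in l -> eps * p.1 0 j < T%:Z.
  elim: l {hl hgen} => [|p l [T hT]]; first by exists 0%N.
  exists (T + (absz (eps * p.1 0 j)%R).+1)%N => q; rewrite inE => /orP [/eqP ->|/hT].
    by move: (eps * p.1 0 j) => y; lia.
  by move: (eps * q.1 0 j) (eps * p.1 0 j) => y y'; lia.
have [F1 [F1A F1gen]] := slices T.+1.
exists (l ++ F1); split; first by move=> p; rewrite mem_cat => /orP [/hl []|/F1A].
move=> B hB AB0 FB m a [vm hm]; move: a.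
have [N] := ubnP (absz (eps * m 0 j)); elim: N m vm hm => // N IH m vm hm mN a Aa.
case: (ltrP (eps * m 0 j) T.+1%:Z) => hmT.
  apply: (F1gen B hB AB0) Aa; last by rewrite hm hmT.
  by move=> p pF; apply: FB; rewrite mem_cat pF orbT.
have [|c [hc ->]] := hgen m a _ Aa; first by split=> //; lia.
apply: combination_mem => // p pl; first by apply: FB; rewrite mem_cat pl.
have [[vp pp] _] := hl p pl; have pT := hT p pl.
have E : eps * (m - p.1) 0 j = eps * m 0 j - eps * p.1 0 j by rewrite !mxE mulrBr.
apply: IH; [exact: vanishB| | |exact: hc].
  by rewrite E; lia.
rewrite E; move: mN hm pp pT hmT.
by move: (eps * m 0 j) (eps * p.1 0 j) => x y; lia.
Qed.

(** Coordinates are released one at a time, starting from degree 0 where the component is [A0]; each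
    is split by sign, since the descent needs it bounded below. *)
Lemma generates_vanish k : (k <= n)%N -> exists F, generates (vanish (n - k)) F.
Proof.
elim: k => [|k IH] kn.
  exists [::]; split=> // B hB AB0 _ m a vm Aa.
  have m0 : m = 0 by apply/rowP => i; rewrite vm ?mxE // subn0.
  rewrite m0 chi0 mulr1; apply: AB0; case: hA => _ _ _ h; apply/h.
  by rewrite -m0.
have [F hF] := IH (ltnW kn).
have jn : (n - k.+1 < n)%N by lia.
have Ej : (n - k.+1).+1 = (n - k)%N by lia.
have [F1 [F1A F1gen]] := @generates_step (Ordinal jn) 1 F isT (eq_ind_r (fun j => generates (vanish j) F) hF Ej).
have [F2 [F2A F2gen]] := @generates_step (Ordinal jn) (-1) F isT (eq_ind_r (fun j => generates (vanish j) F) hF Ej).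
exists (F1 ++ F2); split; first by move=> p; rewrite mem_cat => /orP [/F1A|/F2A].
move=> B hB AB0 FB m a vm Aa.
case: (lerP 0 (m 0 (Ordinal jn))) => h.
  apply: (F1gen B hB AB0) Aa; last by split=> //; rewrite mul1r.
  by move=> p pF; apply: FB; rewrite mem_cat pF.
apply: (F2gen B hB AB0) Aa; last by split=> //; rewrite mulN1r oppr_ge0 ltW.
by move=> p pF; apply: FB; rewrite mem_cat pF orbT.
Qed.

Lemma graded_noetherian_generators : exists F : seq (M * K),
  (forall p, p \in F -> A p.1 p.2) /\
  forall B : L -> Prop, subring B -> (forall a, A0 a -> B (emb a)) ->
    (forall p, p \in F -> B (emb p.2 * chi p.1)) ->
    forall m a, A m a -> B (emb a * chi m).
Proof.
have [F [FA Fgen]] := generates_vanish (leqnn n); exists F; split=> //.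
move=> B hB AB0 FB m a; apply: Fgen => //.
by rewrite subnn.
Qed.

End GradedNoetherian.

(** * Recovering the divisor from its ring *)

Section Main.
Variables (K : fieldType) (A0 : K -> Prop).
Hypothesis hA : dedekind A0.
Hypothesis hK : forall x, fracS A0 x.
Variable n : nat.
Local Notation L := (Lfield K n).
Local Notation M := 'rV[int]_n.
Local Notation V := 'rV[rat]_n.
Local Notation Z := (closed_pt A0).
Local Notation emb := (@emb K n).
Local Notation chi := (@chi K n).
Implicit Types (m : M) (w : V) (z : Z).

Let hS : subring A0. Proof. by case: hA. Qed.

(* A polyhedron is cut out by the integral inequalities that it satisfies with
   integral bounds, and those are attained by sections. *)
Lemma divisor_of_sections (sigma : V -> Prop) (D : Z -> V -> Prop) z w :
  polyhedral_cone sigma -> polyhedral_divisor sigma D ->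
  D z w <-> forall m a, sections sigma D m a -> a != 0 -> 0 <= (ordf z a)%:~R + pair m w.
Proof.
move=> hs hD; split.
  move=> Dw m a [->|[_ h] _]; first by rewrite eqxx.
  exact: h.
move=> h; apply: NNPP => nD.
have [s [sn hz]] := proj1 hD z; have [G hG] := hs.
have [||b [hb bs]] := @polyhedron_separation n s sigma G w.
- by move=> c; split=> [/hG /cone_genE|/cone_genE /hG].
- by move=> hx; apply: nD; apply/hz.
have [d d0 [m0 Em0]] := clear_denom_row b.
have [x xs hx] := minimum_in m0 sn.
have [e e0 he] := clear_denom (fun _ : 'I_1 => pair m0 x).
have [H EH] := he ord0.
pose m := m0 *+ e.
have pm y : pair m y = (e%:R * d%:R) * pairQ b y by rewrite pairMn /pair Em0 pairQZl mulrA.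
have ed0 : 0 < e%:R * d%:R :> rat by rewrite mulr_gt0 // ltr0n.
have hm : dualQ sigma (toQ m).
  by move=> c /hb hc; rewrite -[pairQ _ _]/(pair m c) pm mulr_ge0 // ltW.
have Hx : pair m x = H%:~R by rewrite pairMn.
have hmin : is_min (D z) m H%:~R.
  split.
    exists x; split=> //; apply/hz; exists x, 0; rewrite addr0; split=> //.
      exact: whull_mem.
    exact: polyhedral_cone0.
  move=> y /hz [q [c [hq /hm hc ->]]]; rewrite /pair pairQDr.
  have : H%:~R * 1 <= pairQ (toQ m) q.
    apply: whull_pair_ge hq _ => y' /hx hy'; rewrite -Hx -/(pair m y') !pairMn.
    by rewrite ler_wpM2l // ler0n.
  by lra.
have [g [g0 Sg hg]] := section_exact hA hK z hs hD hm.
have := h m g Sg g0; rewrite (hg _ hmin) intrKfloor mulrNz pm.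
have := bs x xs; rewrite -(ltr_pM2l ed0) -!pm Hx pm; lra.
Qed.

Lemma A0D_term (sigma : V -> Prop) (D : Z -> V -> Prop) m a : attains_minima sigma D ->
  @A0D K A0 n sigma D (emb a * chi m) <-> sections sigma D m a.
Proof.
move=> hD; rewrite (A0D_sections hA hK hD); apply: graded_term.
  exact: sections0.
exact: sectionsB.
Qed.

Section Converse.
Variables (sigma : V -> Prop) (A : M -> K -> Prop).
Hypothesis hs : polyhedral_cone sigma.
Hypothesis hAg : graded_subalg A0 A.
Hypothesis A_normal : normal (graded A).
Hypothesis A_noeth : noetherian (graded A).
Hypothesis A_cone : forall u, weight_cone A u <-> dualQ sigma u.
Hypothesis A_frac : forall x, fracS (graded A) x <-> fracS (@KM K n) x.

Let Az m : A m 0. Proof. by case: hAg. Qed.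
Let AB m a b : A m a -> A m b -> A m (a - b). Proof. by case: hAg => _ h _ _; apply: h. Qed.
Let AM m m' a b : A m a -> A m' b -> A (m + m') (a * b).
Proof. by case: hAg => _ _ h _; apply: h. Qed.
Let A00 a : A 0 a <-> A0 a. Proof. by case: hAg. Qed.
Let A1 : A 0 1. Proof. by apply/A00; apply: subring1. Qed.
Let hG : subring (graded A). Proof. exact: graded_subring. Qed.

Lemma converse_generators : exists (r : nat) (f : 'I_r -> K) (ms : 'I_r -> M),
  [/\ forall i, f i != 0, forall i, A (ms i) (f i) &
      forall x, graded A x <-> gen_ring A0 (fun i => emb (f i) * chi (ms i)) x].
Proof.
have [F0 [F0A F0gen]] := graded_noetherian_generators hAg A1 A_noeth.
pose F := [seq p <- F0 | p.2 != 0].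
have nthF i : (i < size F)%N -> (nth (0, 0) F i).2 != 0 /\ A (nth (0, 0) F i).1 (nth (0, 0) F i).2.
  by move=> /(mem_nth (0, 0)); rewrite mem_filter => /andP [h /F0A].
exists (size F), (fun i => (nth (0, 0) F i).2), (fun i => (nth (0, 0) F i).1); split.
- by move=> i; case: (nthF i (ltn_ord i)).
- by move=> i; case: (nthF i (ltn_ord i)).
move=> x; split.
  move=> [s [hs' ->]] B hB AB0 gB; rewrite big_seq.
  apply: (smod_sum (subring_smod hB)) => p ps.
  apply: (F0gen B hB AB0); last exact: hs'.
  move=> q qF; have [->|q0] := eqVneq q.2 0.
    by rewrite emb0 mul0r; apply: subring0.
  have qF' : q \in F by rewrite mem_filter q0.
  have hi : (index q F < size F)%N by rewrite index_mem.
  by have := gB (Ordinal hi); rewrite /= nth_index.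
apply=> // [a Aa|i].
  by rewrite -[emb a]mulr1 -(chi0 K n); apply/graded_term => //; apply/A00.
by apply/graded_term => //; case: (nthF i (ltn_ord i)).
Qed.

(** This is where the hypothesis on fraction fields enters. Write chi^m = p / q with p and q in A.
    All degrees occurring in A lie in the subgroup H spanned by the generators, and p = q chi^m, so
    H contains both the leading degree of q and its translate by m. *)
Lemma degrees_span r (f : 'I_r -> K) (ms : 'I_r -> M) :
  (forall x, graded A x <-> gen_ring A0 (fun i => emb (f i) * chi (ms i)) x) ->
  forall m, exists c : 'I_r -> int, m = \sum_(i < r) c i *: ms i.
Proof.
move=> hB m.
pose H m' := exists c : 'I_r -> int, m' = \sum_(i < r) c i *: ms i.
have H0 : H 0 by exists (fun=> 0); rewrite big1 // => i _; rewrite scale0r.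
have HD m1 m2 : H m1 -> H m2 -> H (m1 + m2).
  move=> [c ->] [d ->]; exists (fun i => c i + d i).
  by rewrite -big_split; apply: eq_bigr => i _; rewrite scalerDl.
have HN m1 : H m1 -> H (- m1).
  move=> [c ->]; exists (fun i => - c i).
  by rewrite -sumrN; apply: eq_bigr => i _; rewrite scaleNr.
pose A' m' (a : K) := a = 0 \/ H m'.
have A'0 m' : A' m' 0 by left.
have A'B m' a b : A' m' a -> A' m' b -> A' m' (a - b).
  by case=> [->|h]; [case=> [->|h]; [left; rewrite subrr|right]|right].
have A'M m1 m2 a b : A' m1 a -> A' m2 b -> A' (m1 + m2) (a * b).
  case=> [->|h]; first by left; rewrite mul0r.
  by case=> [->|h']; [left; rewrite mulr0|right; apply: HD].
have hG' : subring (graded A') by apply: graded_subring => //; right.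
have sub x : graded A x -> graded A' x.
  move/hB; apply=> // [a Aa|i].
    by rewrite -[emb a]mulr1 -(chi0 K n); apply/graded_term => //; right.
  apply/graded_term => //; right; exists (fun j => (j == i)%:R).
  rewrite (bigD1 i) //= eqxx scale1r big1 ?addr0 // => j /negbTE ->.
  by rewrite scale0r.
have : fracS (graded A) (chi m) by apply/A_frac; apply: fracS_KM.
move=> [p [q [/sub Ap /sub Aq q0 E]]].
have Ep : p = q * chi m by rewrite E mulrCA divff ?mulr1.
have [Q [e Eq]] := KM_rep (graded_sub_KM Aq).
have Q0 : Q != 0 by apply: contraNneq q0 => Q0; rewrite Eq Q0 poly_embed0 mul0r.
have hQ := mleadc_eq0 Q; rewrite (negbTE Q0) in hQ.
move: Aq; rewrite Eq => /(graded_rep A'0 A'B) /(_ (mlead Q)) [E0|H1].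
  by rewrite E0 eqxx in hQ.
move: Ap; rewrite Ep Eq -mulrA -chiD.
have -> : - e + m = - (e - m) by rewrite opprB addrC.
move=> /(graded_rep A'0 A'B) /(_ (mlead Q)) [E0|H2].
  by rewrite E0 eqxx in hQ.
have -> : m = (mnm_row (mlead Q) - (e - m)) + - (mnm_row (mlead Q) - e).
  by rewrite !opprB; apply/rowP => i; rewrite !mxE; ring.
by apply: HD => //; apply: HN.
Qed.

(** For homogeneous generators of A, normality makes A its own normalization, which is the ring of
    [Df]; the cone there must still be matched with [sigma] and the polyhedra shown nonempty. Two
    divisors with the same ring have the same sections, and these determine them. *)
Lemma polyhedral_divisor_of_graded : exists D : Z -> V -> Prop, [/\ polyhedral_divisor sigma D,
  (forall x, graded A x <-> @A0D K A0 n sigma D x)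
  & forall D' : Z -> V -> Prop, polyhedral_divisor sigma D' ->
      (forall x, graded A x <-> @A0D K A0 n sigma D' x) -> forall z w, D' z w <-> D z w].
Proof.
have [r [f [ms [f0 Af hB]]]] := converse_generators.
have span := degrees_span hB.
pose D := @Df K A0 n r f ms.
pose sigma' w := forall i, 0 <= pair (ms i) w.
have norm x : normalization (gen_ring A0 (fun i => emb (f i) * chi (ms i))) x <-> graded A x.
  split.
    move=> [h1 h2]; apply: A_normal.
      by apply: fracS_mono h1 => y /hB.
    by apply: integral_over_mono h2 => y /hB.
  move=> Ax; split; first by apply: fracS_sub; [exact: gen_ring_subring|exact/hB].
  exists ('X - x%:P); split; [exact: monicXsubC| |by rewrite root_XsubC].
  move=> i; apply/hB; rewrite coefB coefX coefC; apply: subringB => //.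
    by case: eqP => _; [exact: subring1|exact: subring0].
  by case: eqP => _ //; exact: subring0.
have hreg : attains_minima sigma' D by apply: Df_attains_minima.
have AD' x : graded A x <-> @A0D K A0 n sigma' D x.
  by rewrite -norm; apply: normalization_gen_ring.
have AS m a : A m a <-> sections sigma' D m a.
  rewrite -(A0D_term _ _ hreg) -AD'; symmetry; exact: graded_term.
(* A point of [sigma'] outside [sigma] would be separated from it by some y in the dual cone. That
   cone is the weight cone, whose degrees are nonnegative on [sigma']. *)
have Esig : sigma' = sigma.
  apply: functional_extensionality => w; apply: propositional_extensionality; split.
    move=> hw; have [G hGs] := hs; apply/hGs/cone_genE.
    case: (farkas G w) => // -[y [hy wy]].
    have : weight_cone A y.
      apply/A_cone => c /hGs /cone_genE; apply: (cone_min (half_space_convex y)) => g gG.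
      by rewrite pairQC; apply: hy.
    move=> [s [hs' [lam [lam0 Ey]]]].
    have : 0 <= pairQ y w.
      rewrite Ey pairQ_suml; apply: sumr_ge0 => i _; rewrite pairQZl mulr_ge0 //.
      have [m [-> [a [/AS [->|[hm _]] a0]]]] := hs' _ (mem_nth 0 (ltn_ord i)).
        by rewrite eqxx in a0.
      exact: hm.
    by rewrite pairQC leNgt wy.
  move=> sw i; have : dualQ sigma (toQ (ms i)).
    apply/A_cone; exists [:: toQ (ms i)]; split.
      by move=> u; rewrite inE => /eqP ->; exists (ms i); split=> //; exists (f i).
    by exists (fun=> 1); split=> //; rewrite big_ord1 scale1r.
  by apply.
rewrite Esig in hreg AD' AS.
(* An empty polyhedron would impose no condition at z, and a function whose only pole is a simple
   one at z would lie in degree 0, hence in [A0]. *)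
have Dne z : exists w, D z w.
  apply: NNPP => nD.
  have [|h [h0 vh hh]] := @exists_exact_order _ _ hA hK (fun z' => if decide (z' = z) then -1 else 0) z.
    exists [:: z] => z'; case: decideP => [->|//] _; by left.
  have : A 0 h.
    apply/AS; right; split=> [|z' w Dw]; first exact: dualQ0.
    have := hh z'; case: decideP => [E|_]; first by case: nD; exists w; rewrite -E.
    by rewrite pair0 addr0 ler0z.
  move=> /A00 /(ordf_ge0 hA hK z h0); rewrite vh.
  by have -> : decide (z = z) by exact/decideP.
have hD : polyhedral_divisor sigma D.
  split=> [z|]; first by rewrite -Esig; apply: Df_pol_sigma.
  have hfin : finite_pts (fun z => exists i, ordf z (f i) <> 0).
    by apply: finite_pts_bigU => i; apply: (finite_pts_ordf hA hK).
  have [k [zs [_ hz]]] := proj1 (finite_pts_enum _) hfin; exists k, zs => z nz w.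
  have vz i : ordf z (f i) = 0.
    by apply: NNPP => h; have [|j zj] := hz z; [exists i|case: (nz j)].
  rewrite -Esig; split=> [/(DfE hA hK ms f0) h i|h].
    by have := h i; rewrite vz oppr0.
  by apply/(DfE hA hK ms f0) => i; rewrite vz oppr0.
exists D; split=> // D' hD' AD'' z w.
have hreg' := polyhedral_divisor_minima hs hD'.
have E m a : sections sigma D' m a <-> sections sigma D m a.
  rewrite -(A0D_term _ _ hreg') -AD'' -AS; exact: graded_term.
rewrite (divisor_of_sections _ _ hs hD) (divisor_of_sections _ _ hs hD').
by split=> h m a /E Sa a0; apply: h.
Qed.

End Converse.
End Main.

Theorem theorem2p5 (K0 : fieldType) (A0 : K0 -> Prop)
    (hA0 : dedekind A0) (hK0 : forall x, fracS A0 x) (n : nat) :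
  (forall sigma : 'rV[rat]_n -> Prop,
     polyhedral_cone sigma -> strongly_convex sigma ->
     (* (i) *)
     (forall D : (closed_pt A0 -> 'rV[rat]_n -> Prop), polyhedral_divisor sigma D ->
        [/\ normal (A0D sigma D), noetherian (A0D sigma D)
          & forall x, fracS (A0D sigma D) x <-> fracS (@KM K0 n) x])
     /\
     (* (ii) *)
     (forall A : 'rV[int]_n -> K0 -> Prop,
        graded_subalg A0 A ->
        normal (graded A) -> noetherian (graded A) ->
        (forall u, weight_cone A u <-> dualQ sigma u) ->
        (forall x, fracS (graded A) x <-> fracS (@KM K0 n) x) ->
        exists D : (closed_pt A0 -> 'rV[rat]_n -> Prop), [/\ polyhedral_divisor sigma D,
          (forall x, graded A x <-> A0D sigma D x)
          & forall D' : (closed_pt A0 -> 'rV[rat]_n -> Prop), polyhedral_divisor sigma D' ->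
              (forall x, graded A x <-> A0D sigma D' x) ->
              forall z v, D' z v <-> D z v]))
  /\
  (* (iii) *)
  (forall (r : nat) (f : 'I_r -> K0) (ms : 'I_r -> 'rV[int]_n),
     (forall i, f i != 0) -> (forall i, ms i != 0) ->
     (forall m : 'rV[int]_n, exists c : 'I_r -> int,
        m = \sum_(i < r) c i *: ms i) ->
     let sigma := fun v : 'rV[rat]_n => forall i, 0 <= pair (ms i) v in
     forall x, normalization
                 (gen_ring A0 (fun i => emb n (f i) * @chi K0 n (ms i))) x
               <-> A0D sigma (@Df K0 A0 n r f ms) x).
Proof.
split=> [sigma hs hsc|r f ms f0 _ hms sigma x]; last exact: normalization_gen_ring.
split=> [D hD|A hA hnorm hnoeth hcone hfrac]; last exact: polyhedral_divisor_of_graded.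
rewrite (A0D_sections hA0 hK0 (polyhedral_divisor_minima hs hD)); split.
- exact: sections_normal.
- exact: sections_noetherian.
- move=> x; split=> _; first exact: fracS_KM.
  exact: sections_frac.
Qed.
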